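(* Let $M\subset\mathbf{P}^N$ be a complex projective variety, let $f:\mathbf{C}\to M$ be a holomorphic curve, and let $\mu$ be the Riesz measure corresponding to $f$. If $$\limsup_{k\to\infty}\mu\bigl(\{z\in\mathbf{C}:2^k\le |z|\le 2^{k+1}\}\bigr)=\infty,$$ then $f$ has at least one Julia direction.
   Context: $\mathbf{P}^N$ is complex projective space of dimension $N$; a projective variety $M\subset\mathbf{P}^N$ is a Zariski closed subset. A holomorphic curve $f:\mathbf{C}\to M$ is a holomorphic map $\mathbf{C}\to\mathbf{P}^N$ whose image lies in $M$. Riesz measure of $f$: write $f$ in a homogeneous representation $F=(f_0:\dots:f_N)$ with $f_j$ entire functions without common zeros, and let $u=\log\|F\|=\frac12\log(|f_0|^2+\dots+|f_N|^2)$, a subharmonic function on $\mathbf{C}$. The measure $\mu$ is the Riesz measure of $u$, i.e. $\mu=\frac{1}{2\pi}\Delta u$; it does not depend on the choice of $F$. A divisor on $M$ is the set-theoretic intersection of a hyperplane in $\mathbf{P}^N$ with $M$. Julia direction: a number $\theta\in[0,2\pi)$ is called a Julia direction for $f:\mathbf{C}\to M$ if, for every natural number $n$, for every finite system of divisors $D_1,\dots,D_q$ on $M$ such that any $n+1$ of them have empty intersection (i.e. $\bigcap_{j\in I}D_j=\emptyset$ for every $I\subset\{1,\dots,q\}$ with $\operatorname{card} I=n+1$), and for every $\epsilon>0$, all but at most $2n$ of these divisors have infinitely many preimages in the angle $\{z\neq 0:|\arg z-\theta|<\epsilon\}$ (with $\arg z$ taken modulo $2\pi$); that is, the set of $z$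 in this angle with $f(z)\in D_j$ is infinite for all but at most $2n$ of the indices $j$. *)

(* Defs.v *)
(* MathComp / MathComp-Analysis, over an arbitrary R : realType; the complex
   plane is R[i]. *)
From HB Require Import structures.
From mathcomp Require Import all_boot all_order all_algebra.
From mathcomp Require Import all_classical all_reals all_analysis.
From mathcomp Require Import complex.
(* Canonical structures and coercions only: the notations of mpoly clash
   with those of MathComp-Analysis. *)
From mathcomp Require mpoly.
Import (canonicals, coercions) mpoly.

Set Implicit Arguments.
Unset Strict Implicit.
Unset Printing Implicit Defensive.

Import Order.TTheory GRing.Theory Num.Theory.
Import numFieldNormedType.Exports.

Local Open Scope classical_set_scope.
Local Open Scope ring_scope.
Local Open Scope complex_scope.

Section ProjectiveSpace.
Variables (R : realType) (N : nat).

(* Points of P^N are the lines through the origin of C^(N+1). *)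
Definition projspace : Type :=
  {L : {vspace 'rV[R[i]]_N.+1} | \dim L == 1%N}.

Definition homog_coords (p : projspace) (v : 'rV[R[i]]_N.+1) : Prop :=
  v != 0 /\ sval p = <[v]>%VS.

Definition hyperplane (H : set projspace) : Prop :=
  exists W : {vspace 'rV[R[i]]_N.+1},
    \dim W = N /\ H = [set p | (sval p <= W)%VS].

Definition homogeneous_mpoly (P : mpoly.mpoly N.+1 R[i]) : Prop :=
  exists d : nat, P \is mpoly.ishomog1 d mpoly.mdeg.

Definition zero_locus (S : set (mpoly.mpoly N.+1 R[i])) : set projspace :=
  [set p | forall P, S P -> forall v, homog_coords p v ->
     mpoly.meval (fun j => v 0 j) P = 0].

(* Zariski closed; neither irreducibility nor smoothness is required. *)
Definition projective_variety (M : set projspace) : Prop :=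
  exists S : set (mpoly.mpoly N.+1 R[i]),
    (forall P, S P -> homogeneous_mpoly P) /\ M = zero_locus S.

(* The set-theoretic intersection of M with a hyperplane, without
   multiplicities. *)
Definition divisor_on (M D : set projspace) : Prop :=
  exists H, hyperplane H /\ D = H `&` M.

End ProjectiveSpace.

Section HolomorphicCurves.
Variables (R : realType) (N : nat).

(* R[i]^o carries the normed-space structure of C over itself, so this is
   complex differentiability. *)
Definition complex_derivable (g : R[i] -> R[i]) (z : R[i]) : Prop :=
  derivable (g : R[i]^o -> R[i]^o) z 1.

Definition entire (g : R[i] -> R[i]) : Prop :=
  forall z, complex_derivable g z.

(* A map to P^N is holomorphic when it lifts, locally, to a nowhere zero
   holomorphic map to C^(N+1). *)
Definition holomorphic_map (f : R[i] -> projspace R N) : Prop :=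
  forall z0 : R[i], exists G : R[i] -> 'rV[R[i]]_N.+1,
    \forall z \near (z0 : R[i]^o),
      (forall j, complex_derivable (fun w => G w 0 j) z) /\
      homog_coords (f z) (G z).

Definition holomorphic_curve (M : set (projspace R N))
    (f : R[i] -> projspace R N) : Prop :=
  holomorphic_map f /\ forall z, M (f z).

(* That the coordinates of F have no common zero is part of homog_coords. *)
Definition homogeneous_representation (f : R[i] -> projspace R N)
    (F : R[i] -> 'rV[R[i]]_N.+1) : Prop :=
  (forall j, entire (fun z => F z 0 j)) /\
  (forall z, homog_coords (f z) (F z)).

(* log ||F||, as a function on R * R; (x, y) stands for x + iy. *)
Definition log_norm (F : R[i] -> 'rV[R[i]]_N.+1) (p : R * R) : R :=
  2^-1 * ln (\sum_j (complex.Re (F (p.1 +i* p.2) 0 j) ^+ 2 +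
                     complex.Im (F (p.1 +i* p.2) 0 j) ^+ 2)).

End HolomorphicCurves.

Section RieszMeasure.
Variable R : realType.

Definition dx (phi : R * R -> R) (p : R * R) : R := 'D_(1, 0) phi p.
Definition dy (phi : R * R -> R) (p : R * R) : R := 'D_(0, 1) phi p.

Definition laplacian (phi : R * R -> R) (p : R * R) : R :=
  dx (dx phi) p + dy (dy phi) p.

Fixpoint class_C (k : nat) (phi : R * R -> R) : Prop :=
  continuous phi /\
  if k is k'.+1 then
    [/\ forall p, derivable phi p (1, 0), forall p, derivable phi p (0, 1),
        class_C k' (dx phi) & class_C k' (dy phi)]
  else True.

Definition test_function (phi : R * R -> R) : Prop :=
  (forall k, class_C k phi) /\ compact (closure [set p | phi p != 0]).

(* mu = (1 / 2 pi) Delta u in the sense of distributions, for a Radon measure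
   mu on the plane. *)
Definition riesz_measure (u : R * R -> R)
    (mu : {measure set (R * R)%type -> \bar R}) : Prop :=
  (forall K : set (R * R), compact K -> (mu K < +oo)%E) /\
  (forall phi, test_function phi ->
     (\int[mu]_p (phi p)%:E =
      \int[lebesgue_measure \x lebesgue_measure]_p
         ((2 * pi)^-1 * (u p * laplacian phi p))%:E)%E).

(* Independent of the choice of F: two homogeneous representations differ by
   an entire factor without zeros. *)
Definition riesz_measure_of_curve (N : nat) (f : R[i] -> projspace R N)
    (mu : {measure set (R * R)%type -> \bar R}) : Prop :=
  exists F, homogeneous_representation f F /\ riesz_measure (log_norm F) mu.

Definition annulus (r s : R) : set (R * R) :=
  [set p | r <= Num.sqrt (p.1 ^+ 2 + p.2 ^+ 2) <= s].

End RieszMeasure.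

Section JuliaDirections.
Variables (R : realType) (N : nat).

(* The angle {z <> 0 : |arg z - theta| < eps}: some value of the multivalued
   argument of z is at distance less than eps from theta. *)
Definition angle (theta eps : R) : set R[i] :=
  [set z | exists r t : R,
     [/\ 0 < r, `|t - theta| < eps & z = (r * cos t) +i* (r * sin t)]].

Definition julia_direction (M : set (projspace R N))
    (f : R[i] -> projspace R N) (theta : R) : Prop :=
  0 <= theta < 2 * pi /\
  forall (n q : nat) (D : 'I_q -> set (projspace R N)),
    (forall j, divisor_on M (D j)) ->
    (forall I : {set 'I_q}, #|I| = n.+1 ->
       \bigcap_(j in [set j | j \in I]) D j = set0) ->
    forall eps : R, 0 < eps ->
      exists E : {set 'I_q}, (#|E| <= 2 * n)%N /\
        forall j, j \notin E ->
          infinite_set [set z | angle theta eps z /\ D j (f z)].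

End JuliaDirections.

(* Main.v *)
(* Suppose that no theta is a Julia direction. Every z1 with 1 <= |z1| <= 2
   then has linear forms l_1, ..., l_q, q > 2n, no n+1 of which vanish together
   on M, such that the entire functions g_j = l_j(F) have no zeros in the disc
   of centre 2^k z1 and radius 2^k rho, for all large k. By compactness of M, at
   each point at most n of the |g_j| are small compared with ||F||, so all but n
   of the harmonic functions -log|g_j| are within a constant of their minimum
   there. Since q > 2n, the sets of near-minimizers at two points always meet;
   after a rescaling and a limit this forces one single -log|g_j| to be within a
   constant A, independent of k, of the minimum on the whole of a smaller disc.
   On that disc log||F|| is at bounded distance from the harmonic function
   log|g_j|, and testing the Riesz measure against a cut-off function bounds the
   mass of a square of size comparable to 2^k. Finitely many such squares cover
   the annulus 2^k <= |z| <= 2^(k+1). *)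

(* The obstacle is that the differences of the functions $-\log|g_j|$ have no a priori bound, so no
   limit can be taken directly. [selection] therefore looks for a disc on which the bound $S$, for
   which some index stays within $S$ of the minimum, cannot be halved. Harnack's inequality along a
   chain of discs shows that one index $j_0$ is within a constant multiple of $S$ of the minimum on
   the concentric disc of twice the radius. Subtracting the function of index $j_0$, dividing by $S$
   and adding a constant gives nonnegative functions, one of them constant, and the gap $C_0/S$ is
   small when $S$ is large. In the limit near-minimizers become minimizers. Some majority set $I$ is
   the set of minimizers along points accumulating at 0 on many rays, so its members have equal
   expansions. As $I$ meets the near-minimizers at every point, a member of $I$ is almost minimal
   everywhere, which contradicts the failure of $S/2$. Harmonic functions are handled as real parts
   of power series, so that convergence is convergence of coefficients. *)
Require Import Defs.
From mathcomp Require Import all_boot all_order all_algebra all_field.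
From mathcomp Require Import all_classical all_reals all_analysis.
From mathcomp Require Import complex ring lra zify.
From mathcomp Require mpoly.

Set Implicit Arguments.
Unset Strict Implicit.
Unset Printing Implicit Defensive.

Import Order.TTheory GRing.Theory Num.Theory.
Import numFieldNormedType.Exports.
Local Open Scope classical_set_scope.
Local Open Scope ring_scope.
Local Open Scope complex_scope.

Local Notation Re := (@complex.Re _).
Local Notation Im := (@complex.Im _).

(** * Complex modulus and differentiability *)

Section Modulus.
Variable R : realType.
Local Notation C := R[i].
Implicit Types z w : C.

(* [`|z|] takes its values in [R[i]]; [cmod z] is the same number in [R]. *)
Definition cmod z : R := Num.sqrt (Re z ^+ 2 + Im z ^+ 2).

Lemma cmodE z : `|z| = (cmod z)%:C.
Proof. exact: normc_def. Qed.

Lemma cmod_ge0 z : 0 <= cmod z. Proof. exact: sqrtr_ge0. Qed.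

Lemma cmod_sqr z : cmod z ^+ 2 = Re z ^+ 2 + Im z ^+ 2.
Proof. by rewrite sqr_sqrtr// addr_ge0// sqr_ge0. Qed.

Lemma cmodM z w : cmod (z * w) = cmod z * cmod w.
Proof. by apply: (@complexI R); rewrite -cmodE normrM !cmodE -rmorphM. Qed.

Lemma cmodN z : cmod (- z) = cmod z.
Proof. by apply: (@complexI R); rewrite -!cmodE normrN. Qed.

Lemma cmodD z w : cmod (z + w) <= cmod z + cmod w.
Proof. by rewrite -lecR -cmodE rmorphD/= -!cmodE ler_normD. Qed.

Lemma cmodB z w : cmod (z - w) <= cmod z + cmod w.
Proof. by rewrite -(cmodN w) cmodD. Qed.

Lemma cmodBC z w : cmod (z - w) = cmod (w - z).
Proof. by rewrite -cmodN opprB. Qed.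

Lemma cmod_dist z w : cmod z - cmod w <= cmod (z - w).
Proof. by rewrite lerBlDr -{1}(subrK w z) cmodD. Qed.

Lemma cmodV z : cmod z^-1 = (cmod z)^-1.
Proof. by apply: (@complexI R); rewrite -cmodE normfV cmodE fmorphV. Qed.

Lemma cmodX z n : cmod (z ^+ n) = cmod z ^+ n.
Proof. by apply: (@complexI R); rewrite -cmodE normrX cmodE rmorphXn. Qed.

Lemma cmod_eq0 z : (cmod z == 0) = (z == 0).
Proof. by rewrite -[RHS]normr_eq0 cmodE (inj_eq (@complexI R) _ 0). Qed.

Lemma cmod_gt0 z : (0 < cmod z) = (z != 0).
Proof. by rewrite lt0r cmod_eq0 cmod_ge0 andbT. Qed.

Lemma cmod0 : cmod 0 = 0. Proof. by apply/eqP; rewrite cmod_eq0. Qed.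

Lemma cmodR (x : R) : cmod x%:C = `|x|.
Proof. by rewrite /cmod/= expr0n/= addr0 sqrtr_sqr. Qed.

Lemma cmod1 : cmod 1 = 1. Proof. by rewrite (cmodR 1) normr1. Qed.

Lemma cmodi : cmod 'i = 1.
Proof. by rewrite /cmod/= expr0n/= add0r expr1n sqrtr1. Qed.

Lemma Re_le_cmod z : `|Re z| <= cmod z.
Proof. by rewrite -sqrtr_sqr ler_wsqrtr// lerDl sqr_ge0. Qed.

Lemma Im_le_cmod z : `|Im z| <= cmod z.
Proof. by rewrite -sqrtr_sqr ler_wsqrtr// lerDr sqr_ge0. Qed.

Lemma cmod_le_ReIm z : cmod z <= `|Re z| + `|Im z|.
Proof.
rewrite -(@ler_pXn2r _ 2)// ?nnegrE ?cmod_ge0 ?addr_ge0//.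
rewrite cmod_sqr sqrrD !real_normK ?num_real// lerD2r lerDl.
by rewrite mulrn_wge0// mulr_ge0.
Qed.

Lemma cmod_sum (I : Type) (r : seq I) (P : pred I) (F : I -> C) :
  cmod (\sum_(i <- r | P i) F i) <= \sum_(i <- r | P i) cmod (F i).
Proof.
elim/big_ind2: _ => [|x1 x2 y1 y2 h1 h2|//]; first by rewrite cmod0.
by rewrite (le_trans (cmodD _ _))// lerD.
Qed.

Lemma cReM z w : Re (z * w) = Re z * Re w - Im z * Im w.
Proof. by case: z w => [a b] [c d]. Qed.

Lemma cImM z w : Im (z * w) = Re z * Im w + Im z * Re w.
Proof. by case: z w => [a b] [c d]. Qed.

Lemma cReD z w : Re (z + w) = Re z + Re w.
Proof. by case: z w => [a b] [c d]. Qed.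

Lemma cImD z w : Im (z + w) = Im z + Im w.
Proof. by case: z w => [a b] [c d]. Qed.

Lemma cReN z : Re (- z) = - Re z. Proof. by case: z. Qed.

Lemma cImN z : Im (- z) = - Im z. Proof. by case: z. Qed.

Lemma cReB z w : Re (z - w) = Re z - Re w.
Proof. by rewrite cReD cReN. Qed.

Lemma cImB z w : Im (z - w) = Im z - Im w.
Proof. by rewrite cImD cImN. Qed.

Lemma cReZ (x : R) z : Re (x%:C * z) = x * Re z.
Proof. by rewrite cReM/= mul0r subr0. Qed.

Lemma cImZ (x : R) z : Im (x%:C * z) = x * Im z.
Proof. by rewrite cImM/= mul0r addr0. Qed.

Lemma cRe_sum (I : Type) (r : seq I) (P : pred I) (F : I -> C) :
  Re (\sum_(i <- r | P i) F i) = \sum_(i <- r | P i) Re (F i).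
Proof. by apply: (big_morph _ cReD). Qed.

End Modulus.

Section ComplexDerivative.
Variable R : realType.
Local Notation C := R[i].
Implicit Types (f g : C -> C) (z w d : C).

(** The error is compared with $e|h|$ instead of forming a quotient, so $h = 0$ is allowed and all
    estimates are inequalities in [R]. *)
Definition cderiv f z d := forall e : R, 0 < e -> exists2 r : R, 0 < r &
  forall h, cmod h < r -> cmod (f (z + h) - f z - d * h) <= e * cmod h.

Definition ccont f z := forall e : R, 0 < e -> exists2 r : R, 0 < r &
  forall h, cmod h < r -> cmod (f (z + h) - f z) <= e.

Lemma complex_derivable_cderiv f z : complex_derivable f z -> exists d, cderiv f z d.
Proof.
move=> /cvg_ex[/= d] fd; exists d => e e0.
move/cvgrPdist_le : fd => /(_ e%:C).
rewrite ltcR => /(_ e0); rewrite /= nearE /dnbhs /within /= => /nbhs_ballP[r].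
(* The radius of the ball is an element of [R[i]]; being positive, it is real. *)
case: r => a b; rewrite /= ltcE/= => /andP[/eqP b0 a0] H; subst b.
exists a => // h ha; have [->|h0] := eqVneq h 0.
  by rewrite addr0 subrr mulr0 subr0 cmod0 mulr0.
have {H} := H h; rewrite /ball/= sub0r normrN cmodE ltcR => /(_ ha h0).
rewrite cmodE lecR => H.
have -> : f (z + h) - f z - d * h = - ((d - h^-1 * (f (h%:A + z) - f z)) * h).
  by rewrite /GRing.scale/= mulr1 (addrC h z); field.
by rewrite cmodN cmodM ler_wpM2r ?cmod_ge0.
Qed.

Lemma cderiv_ccont f z d : cderiv f z d -> ccont f z.
Proof.
move=> fd e e0; have [r r0 H] := fd 1 ltr01.
have k0 : 0 < 1 + cmod d by rewrite ltr_wpDr ?cmod_ge0.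
exists (Num.min r (e / (1 + cmod d))) => [|h]; first by rewrite lt_min r0 divr_gt0.
rewrite lt_min => /andP[/H]; rewrite mul1r => h1 h2.
rewrite -(subrK (d * h) (f (z + h) - f z)) (le_trans (cmodD _ _))//.
rewrite (le_trans (lerD h1 (lexx _)))// cmodM -{1}(mul1r (cmod h)) -mulrDl.
by rewrite mulrC -ler_pdivlMr// ltW.
Qed.

Lemma cderiv_ext f g z d : f =1 g -> cderiv f z d -> cderiv g z d.
Proof. by move=> /funext ->. Qed.

Lemma cderiv_eq f z d d' : cderiv f z d -> d = d' -> cderiv f z d'.
Proof. by move=> ? <-. Qed.

Lemma cderiv_near f g z d (r : R) : 0 < r ->
  (forall h, cmod h < r -> f (z + h) = g (z + h)) -> cderiv f z d -> cderiv g z d.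
Proof.
move=> r0 fg fd e e0; have [s s0 H] := fd e e0.
exists (Num.min r s) => [|h]; first by rewrite lt_min r0.
rewrite lt_min => /andP[hr hs]; rewrite -fg//.
by rewrite -{2}(addr0 z) -fg ?cmod0// addr0 H.
Qed.

Lemma cderivC (c : C) z : cderiv (fun=> c) z 0.
Proof.
by move=> e e0; exists 1 => // h _; rewrite mul0r !subrr cmod0 mulr_ge0 ?cmod_ge0// ltW.
Qed.

Lemma cderiv_id z : cderiv id z 1.
Proof.
move=> e e0; exists 1 => // h _.
have -> : id (z + h) - id z - 1 * h = 0 by rewrite /=; ring.
by rewrite cmod0 mulr_ge0 ?cmod_ge0// ltW.
Qed.

Lemma cderivD f g z d d' : cderiv f z d -> cderiv g z d' ->
  cderiv (fun w => f w + g w) z (d + d').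
Proof.
move=> fd gd e e0; have e20 : 0 < e / 2 by rewrite divr_gt0.
have [r r0 Hf] := fd _ e20; have [s s0 Hg] := gd _ e20.
exists (Num.min r s) => [|h]; first by rewrite lt_min r0.
rewrite lt_min => /andP[/Hf Hf' /Hg Hg'].
rewrite (_ : _ - _ = (f (z + h) - f z - d * h) + (g (z + h) - g z - d' * h)).
  by rewrite (le_trans (cmodD _ _))// (splitr e) mulrDl lerD.
by ring.
Qed.

Lemma cderivM f g z d d' : cderiv f z d -> cderiv g z d' ->
  cderiv (fun w => f w * g w) z (d * g z + f z * d').
Proof.
move=> fd gd e e0.
(* Each of the three error terms [A1], [A2], [A3] is at most $e' K |h|$, whence the factor 3 in
   $e'$. *)
pose K := 1 + cmod (f z) + cmod (g z) + cmod d.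
have fz := cmod_ge0 (f z); have gz := cmod_ge0 (g z); have dz := cmod_ge0 d.
have K1 : 1 <= K by rewrite /K; lra.
have K0 : 0 < K by lra.
pose e' := Num.min 1 (e / (3 * K)).
have e'0 : 0 < e' by rewrite /e' lt_min ltr01 divr_gt0// mulr_gt0.
have e'e : e' <= e / (3 * K) by rewrite /e' ge_min lexx orbT.
have [r r0 Hf] := fd _ e'0; have [s s0 Hg] := gd _ e'0.
have [t t0 Ht] := cderiv_ccont gd e'0.
exists (Num.min r (Num.min s t)) => [|h]; first by rewrite !lt_min r0 s0.
rewrite !lt_min => /andP[/Hf {}Hf /andP[/Hg {}Hg /Ht {}Ht]].
rewrite (_ : _ - _ = (f (z + h) - f z - d * h) * g z +
   (f z * (g (z + h) - g z - d' * h) +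
   ((f (z + h) - f z - d * h) + d * h) * (g (z + h) - g z))); last by ring.
have h0 := cmod_ge0 h.
have e'1 : e' <= 1 by rewrite /e' ge_min lexx.
have A1 : cmod ((f (z + h) - f z - d * h) * g z) <= e' * K * cmod h.
  rewrite cmodM (le_trans (ler_wpM2r gz Hf))// -!mulrA ler_wpM2l ?(ltW e'0)//.
  by rewrite mulrC ler_wpM2r// /K; lra.
have A2 : cmod (f z * (g (z + h) - g z - d' * h)) <= e' * K * cmod h.
  rewrite cmodM (le_trans (ler_wpM2l fz Hg))// mulrA ler_wpM2r//.
  by rewrite mulrC ler_wpM2l ?(ltW e'0)// /K; lra.
have A3 : cmod (((f (z + h) - f z - d * h) + d * h) * (g (z + h) - g z))
   <= e' * K * cmod h.
  rewrite cmodM mulrC -mulrA ler_pM ?cmod_ge0// (le_trans (cmodD _ _))//.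
  rewrite cmodM (le_trans (lerD Hf (lexx _)))// -mulrDl ler_wpM2r// /K; lra.
rewrite (le_trans (cmodD _ _))// (le_trans (lerD A1 (le_trans (cmodD _ _) (lerD A2 A3))))//.
rewrite (_ : _ + _ = e' * (3 * K) * cmod h); last by ring.
by rewrite ler_wpM2r// -ler_pdivlMr// mulr_gt0.
Qed.

Lemma cderivV z : z != 0 -> cderiv (fun w => w^-1) z (- z ^- 2).
Proof.
move=> z0 e e0; have m0 : 0 < cmod z by rewrite cmod_gt0.
exists (Num.min (cmod z / 2) (e * cmod z ^+ 3 / 2)) => [|h].
  by rewrite lt_min !divr_gt0// mulr_gt0// exprn_gt0.
rewrite lt_min => /andP[h1 h2].
have zh : cmod z / 2 <= cmod (z + h).
  have := cmod_dist z (- h); rewrite cmodN opprK; lra.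
have zh0 : z + h != 0.
  by rewrite -cmod_gt0 (lt_le_trans _ zh)// divr_gt0.
have -> : (z + h)^-1 - z^-1 - - z ^- 2 * h = h * h * (z ^- 2 * (z + h)^-1).
  by field; rewrite zh0 z0.
rewrite !cmodM !cmodV cmodX mulrAC.
rewrite ler_wpM2r ?cmod_ge0// -invfM ler_pdivrMr; last first.
  by rewrite mulr_gt0 ?exprn_gt0// (lt_le_trans _ zh)// divr_gt0.
apply: (le_trans (ltW h2)).
rewrite (_ : e * _ / 2 = e * (cmod z ^+ 2 * (cmod z / 2))); last by field.
by rewrite ler_wpM2l ?(ltW e0)// ler_wpM2l// exprn_ge0// ltW.
Qed.

End ComplexDerivative.

(** * Integrals along segments *)

Section SegmentIntegral.
Variable R : realType.
Local Notation C := R[i].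
Local Notation leb := (@lebesgue_measure R).
Implicit Types (f g : R -> C) (a b x : R).

Definition rcont f x := forall e : R, 0 < e -> exists2 r : R, 0 < r &
  forall h, `|h| < r -> cmod (f (x + h) - f x) <= e.

Definition rcont_on f a b := forall x, a <= x <= b -> rcont f x.

Definition rderiv f x (d : C) := forall e : R, 0 < e -> exists2 r : R, 0 < r &
  forall h : R, `|h| < r -> cmod (f (x + h) - f x - d * h%:C) <= e * `|h|.

Lemma rcont_ReIm f x : rcont f x ->
  {for x, continuous (fun t => Re (f t))} /\ {for x, continuous (fun t => Im (f t))}.
Proof.
move=> fx; split; apply/cvgrPdist_le => e /fx[r r0 H];
  near=> t; have /H : `|t - x| < r by near: t; rewrite near_simpl; near=> t;
    rewrite distrC; near: t; exact: cvgr_dist_lt.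
- rewrite (addrC x) subrK => /(le_trans _); apply.
  by rewrite distrC -cReB Re_le_cmod.
- rewrite (addrC x) subrK => /(le_trans _); apply.
  by rewrite distrC -cImB Im_le_cmod.
Unshelve. all: by end_near. Qed.

Lemma rcont_within f a b : rcont_on f a b ->
  {within `[a, b], continuous (fun t => Re (f t))} /\
  {within `[a, b], continuous (fun t => Im (f t))}.
Proof.
move=> fab; split; apply: continuous_in_subspaceT => x;
  by rewrite inE/= in_itv/= => /fab /rcont_ReIm[].
Qed.

Lemma rcont_integrable f a b : rcont_on f a b ->
  leb.-integrable `[a, b] (EFin \o (fun t => Re (f t))) /\
  leb.-integrable `[a, b] (EFin \o (fun t => Im (f t))).
Proof.
by move=> /rcont_within[? ?]; split; apply: continuous_compact_integrable => //;
  exact: segment_compact.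
Qed.

Definition seg f a b : C :=
  (\int[leb]_(t in `[a, b]) Re (f t)) +i* (\int[leb]_(t in `[a, b]) Im (f t)).

Lemma eq_seg f g a b : (forall t, a <= t <= b -> f t = g t) -> seg f a b = seg g a b.
Proof.
by move=> fg; congr (_ +i* _); apply: eq_Rintegral => t; rewrite inE/= in_itv/= => /fg ->.
Qed.

Lemma segD f g a b : rcont_on f a b -> rcont_on g a b ->
  seg (fun t => f t + g t) a b = seg f a b + seg g a b.
Proof.
move=> /rcont_integrable[f1 f2] /rcont_integrable[g1 g2]; rewrite /seg/=.
congr (_ +i* _); first by under eq_Rintegral do rewrite cReD; rewrite RintegralD.
by under eq_Rintegral do rewrite cImD; rewrite RintegralD.
Qed.

Lemma segZ (c : C) f a b : rcont_on f a b ->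
  seg (fun t => c * f t) a b = c * seg f a b.
Proof.
move=> /rcont_integrable[f1 f2]; case: c => c d.
have Z (k : R) (h : R -> R) : leb.-integrable `[a, b] (EFin \o h) ->
    leb.-integrable `[a, b] (EFin \o (fun t => k * h t)).
  move=> hi; apply: (@integrableZl _ _ _ leb _ _ k _ hi); exact: measurable_itv.
have E1 : seg (fun t => (c +i* d) * f t) a b =
  (\int[leb]_(t in `[a, b]) (c * Re (f t) - d * Im (f t))) +i*
  (\int[leb]_(t in `[a, b]) (c * Im (f t) + d * Re (f t))).
  rewrite /seg; apply/eqP; rewrite eq_complex; apply/andP; split; apply/eqP; rewrite /=.
    by apply: eq_Rintegral => t _; rewrite cReM.
  by apply: eq_Rintegral => t _; rewrite cImM.
rewrite E1 RintegralB//; [|exact: Z|exact: Z].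
rewrite RintegralD//; [|exact: Z|exact: Z].
rewrite !RintegralZl//.
Qed.

(** The factor 2 comes from bounding the real and imaginary parts separately. It propagates to the
    constants 4 of [rect_bound] and 16 of [oint_bound]. *)
Lemma seg_bound f a b (M : R) : a <= b -> rcont_on f a b ->
  (forall t, a <= t <= b -> cmod (f t) <= M) -> cmod (seg f a b) <= 2 * M * (b - a).
Proof.
move=> ab fab fM; have [i1 i2] := rcont_integrable fab.
have B (h : R -> R) : leb.-integrable `[a, b] (EFin \o h) ->
    (forall t, a <= t <= b -> `|h t| <= M) ->
    `|\int[leb]_(t in `[a, b]) h t| <= M * (b - a).
  move=> hi hM; apply: le_trans (le_normr_Rintegral _ hi) _ => //.
  have -> : M * (b - a) = \int[leb]_(t in `[a, b]) M.
    rewrite Rintegral_cst; last exact: measurable_itv.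
    congr (_ * _); rewrite [X in fine X](@lebesgue_measure_itv R `[a, b])/= lte_fin.
    by case: ltP => [//|ba]; rewrite (@le_anti _ _ a b) ?ab// subrr.
  apply: le_Rintegral => //.
  - by have := integrable_norm hi.
  - by apply: continuous_compact_integrable; [exact: segment_compact|move=> ?; exact: cvg_cst].
apply: (le_trans (cmod_le_ReIm _)); rewrite -mulrA (_ : 2 = 1 + 1)// mulrDl mul1r.
apply: lerD.
- by apply: B => // t /fM; apply: le_trans; exact: Re_le_cmod.
- by apply: B => // t /fM; apply: le_trans; exact: Im_le_cmod.
Qed.

Lemma seg_split f a b c : a <= b -> b <= c -> rcont_on f a c ->
  seg f a c = seg f a b + seg f b c.
Proof.
move=> ab bc /rcont_integrable[i1 i2].
have S (h : R -> R) : leb.-integrable `[a, c] (EFin \o h) ->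
   \int[leb]_(t in `[a, c]) h t = \int[leb]_(t in `[a, b]) h t + \int[leb]_(t in `[b, c]) h t.
  move=> hi; have := Rintegral_itvB hi (x := b); rewrite !bnd_simp => /(_ ab bc).
  rewrite Rintegral_itv_obnd_cbnd//; first by move=> <-; rewrite addrC subrK.
  apply: integrableS hi => //; apply: subset_itvr.
  by rewrite bnd_simp.
by rewrite /seg (S _ i1) (S _ i2).
Qed.

(** [P] stands for [Re] or [Im]: a real-linear map bounded by the modulus. *)
Lemma rderiv_is_derive (P : C -> R) (F : R -> C) t (d : C) :
  (forall z w, P (z - w) = P z - P w) ->
  (forall (x : R) z, P (z * x%:C) = P z * x) ->
  (forall z, `|P z| <= cmod z) ->
  rderiv F t d -> is_derive t 1 (fun s => P (F s)) (P d).
Proof.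
move=> PB PZ Ple Fd.
have H : ((fun h => h^-1 *: (P (F (h + t)) - P (F t))) @ 0^' --> P d).
  apply/cvgrPdist_le => e e0; have [r r0 H] := Fd e e0.
  near=> h; have hr : `|h| < r.
    near: h; apply: dnbhs0_lt => //.
  have h0 : h != 0 by near: h; exact: nbhs_dnbhs_neq.
  have := H h hr; rewrite (addrC t).
  move/(le_trans (Ple _)); rewrite !PB PZ.
  rewrite (_ : P d - _ = - h^-1 * ((P (F (h + t)) - P (F t)) - P d * h)); last first.
    by rewrite /GRing.scale/=; field.
  by rewrite normrM normrN normfV ler_pdivrMl ?normr_gt0// [leRHS]mulrC.
have E : (fun h : R => h^-1 *: (P (F (h *: 1 + t)) - P (F t))) =
         (fun h => h^-1 *: (P (F (h + t)) - P (F t))).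
  by apply/funext => h; rewrite /GRing.scale/= mulr1.
apply: DeriveDef; first by apply/cvg_ex; exists (P d); rewrite E.
by apply/cvg_lim => //; rewrite E.
Unshelve. all: by end_near. Qed.

Lemma rderiv_Re (F : R -> C) t (d : C) :
  rderiv F t d -> is_derive t 1 (fun s => Re (F s)) (Re d).
Proof.
apply: rderiv_is_derive; [exact: cReB| |exact: Re_le_cmod].
by move=> x z; rewrite mulrC cReZ mulrC.
Qed.

Lemma rderiv_Im (F : R -> C) t (d : C) :
  rderiv F t d -> is_derive t 1 (fun s => Im (F s)) (Im d).
Proof.
apply: rderiv_is_derive; [exact: cImB| |exact: Im_le_cmod].
by move=> x z; rewrite mulrC cImZ mulrC.
Qed.

Lemma seg_FTC (F f : R -> C) a b : a <= b -> rcont_on f a b ->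
  (forall t, a <= t <= b -> rderiv F t (f t)) -> seg f a b = F b - F a.
Proof.
rewrite le_eqVlt => /predU1P[<- _ _|ab fab Fd].
  by rewrite /seg set_itv1 !Rintegral_set1 subrr.
have [c1 c2] := rcont_within fab.
have G (P : C -> R) : (forall t, a <= t <= b -> is_derive t 1 (fun s => P (F s)) (P (f t))) ->
   {within `[a, b], continuous (fun t => P (f t))} ->
   \int[leb]_(t in `[a, b]) P (f t) = P (F b) - P (F a).
  move=> D cP; rewrite /Rintegral (@continuous_FTC2 _ _ (fun s => P (F s)))//.
  - have cont t : a <= t <= b -> {for t, continuous (fun s => P (F s))}.
      move=> tab; apply: differentiable_continuous; apply/derivable1_diffP.
      by have [] := D t tab.
    split.
    + move=> x; rewrite in_itv/= => /andP[ax xb].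
      by have [] := D x; rewrite ?(ltW ax) ?(ltW xb).
    + by apply: cvg_at_right_filter; apply: cont; rewrite lexx ltW.
    + by apply: cvg_at_left_filter; apply: cont; rewrite lexx ltW.
  - move=> x; rewrite in_itv/= => /andP[ax xb].
    by rewrite derive1E; apply: (@derive_val _ _ _ _ _ _ _ (D x _)); rewrite ?ltW.
rewrite /seg (G Re (fun t tab => rderiv_Re (Fd t tab)) c1).
rewrite (G Im (fun t tab => rderiv_Im (Fd t tab)) c2).
by case: (F a) (F b) => [? ?] [? ?].
Qed.

Lemma ccont_comp (f : C -> C) (z v : C) t : ccont f (z + t%:C * v) ->
  rcont (fun s => f (z + s%:C * v)) t.
Proof.
move=> fc e /fc[r r0 H]; have v0 : 0 < 1 + cmod v by rewrite ltr_wpDr ?cmod_ge0.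
exists (r / (1 + cmod v)) => [|h]; first by rewrite divr_gt0.
rewrite ltr_pdivlMr// => hr.
rewrite (_ : z + (t + h)%:C * v = z + t%:C * v + h%:C * v); last by rewrite rmorphD/=; ring.
apply: H; rewrite cmodM cmodR (le_lt_trans _ hr)// ler_wpM2l// lerDr//.
Qed.

Lemma cderiv_comp (f : C -> C) (z v : C) t d : cderiv f (z + t%:C * v) d ->
  rderiv (fun s => f (z + s%:C * v)) t (d * v).
Proof.
move=> fd e e0; have v0 : 0 < 1 + cmod v by rewrite ltr_wpDr ?cmod_ge0.
have [r r0 H] := fd (e / (1 + cmod v)) (divr_gt0 e0 v0).
exists (r / (1 + cmod v)) => [|h]; first by rewrite divr_gt0.
rewrite ltr_pdivlMr// => hr.
rewrite (_ : z + (t + h)%:C * v = z + t%:C * v + h%:C * v); last by rewrite rmorphD/=; ring.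
rewrite -mulrA (mulrC v) (le_trans (H _ _))//.
  by rewrite cmodM cmodR (le_lt_trans _ hr)// ler_wpM2l// lerDr.
rewrite cmodM cmodR mulrAC ler_pdivrMr// mulrA.
rewrite (mulrC _ (cmod v)) -mulrA mulrC -mulrA ler_wpM2l ?(ltW e0)//.
by rewrite ler_wpM2l// lerDr.
Qed.

End SegmentIntegral.

(** * Goursat's theorem *)

Section Rectangles.
Variable R : realType.
Local Notation C := R[i].
Implicit Types (f F : C -> C) (x y : R).

Lemma nested_intervals (a d : nat -> R) : (forall n, 0 <= d n) ->
  (forall n, a n <= a n.+1) -> (forall n, a n.+1 + d n.+1 <= a n + d n) ->
  exists p, forall n, a n <= p <= a n + d n.
Proof.
move=> d0 ha hd.
have mono : {homo a : m n / (m <= n)%N >-> m <= n} by exact: homo_leq le_trans ha.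
have anti : {homo (fun n => - (a n + d n)) : m n / (m <= n)%N >-> m <= n}.
  by apply: homo_leq => //; [exact: le_trans|move=> n; rewrite lerN2].
have ub n m : a n <= a m + d m.
  have [nm|/ltnW mn] := leqP n m; first by rewrite (le_trans (mono _ _ nm))// lerDl.
  by have := anti _ _ mn; rewrite lerN2; apply: le_trans; rewrite lerDl.
exists (sup (range a)) => n; apply/andP; split.
  by apply: ub_le_sup; [exists (a 0%N + d 0%N) => _ [m _ <-]; exact: ub|exists n].
by apply: ge_sup; [exists (a n), n|move=> _ [m _ <-]; exact: ub].
Qed.

(** The subdivision argument, separated from integration: [Phi x y n] is attached to the rectangle
    with lower left corner $(x, y)$ and sides $A/2^n$, $B/2^n$, and is additive under cutting into
    four. If the initial value had modulus $\eta > 0$, some quarter would always keep at least a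
    quarter of the modulus, and the nested rectangles would shrink to a point contradicting the
    smallness hypothesis. *)
Lemma bisection (Phi : R -> R -> nat -> C) (A B x0 y0 : R) (h := fun n : nat => 2^-1 ^+ n : R) :
  0 <= A -> 0 <= B ->
  (forall x y n, x0 <= x -> x + A * h n <= x0 + A -> y0 <= y -> y + B * h n <= y0 + B ->
    Phi x y n = Phi x y n.+1 + Phi (x + A * h n.+1) y n.+1
      + Phi x (y + B * h n.+1) n.+1 + Phi (x + A * h n.+1) (y + B * h n.+1) n.+1) ->
  (forall p q, x0 <= p <= x0 + A -> y0 <= q <= y0 + B -> forall e : R, 0 < e ->
    exists n, forall x y, x0 <= x -> x + A * h n <= x0 + A -> y0 <= y -> y + B * h n <= y0 + B ->
      x <= p <= x + A * h n -> y <= q <= y + B * h n -> cmod (Phi x y n) <= e * h n ^+ 2) ->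
  Phi x0 y0 0%N = 0.
Proof.
move=> A0 B0 split4 small.
have h0 n : 0 < h n by rewrite exprn_gt0// invr_gt0.
have h2 n : h n = h n.+1 + h n.+1 by rewrite /h exprS; field.
apply/eqP; rewrite -cmod_eq0 eq_le cmod_ge0 andbT leNgt; apply/negP.
set eta := cmod _ => eta0.
pose inv (s : nat * (R * R)) := [/\ x0 <= s.2.1, s.2.1 + A * h s.1 <= x0 + A,
  y0 <= s.2.2, s.2.2 + B * h s.1 <= y0 + B & eta * h s.1 ^+ 2 <= cmod (Phi s.2.1 s.2.2 s.1)].
pose rel (s s' : nat * (R * R)) := [/\ s'.1 = s.1.+1,
  s.2.1 <= s'.2.1, s'.2.1 + A * h s'.1 <= s.2.1 + A * h s.1,
  s.2.2 <= s'.2.2 & s'.2.2 + B * h s'.1 <= s.2.2 + B * h s.1].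
have step (s : {s | inv s}) : {s' : {s | inv s} | rel (sval s) (sval s')}.
  apply: cid; case: s => -[n [x y]] [/= x1 x2 y1 y2 L].
  have Ah := mulr_ge0 A0 (ltW (h0 n.+1)); have Bh := mulr_ge0 B0 (ltW (h0 n.+1)).
  have hn := h2 n.
  have EA : A * h n = A * h n.+1 + A * h n.+1 by rewrite -mulrDr -h2.
  have EB : B * h n = B * h n.+1 + B * h n.+1 by rewrite -mulrDr -h2.
  have K (x' y' : R) : (x' = x \/ x' = x + A * h n.+1) -> (y' = y \/ y' = y + B * h n.+1) ->
      eta * h n.+1 ^+ 2 <= cmod (Phi x' y' n.+1) ->
      exists s' : {s | inv s}, rel (n, (x, y)) (sval s').
    move=> X Y L'.
    have I : inv (n.+1, (x', y')).
      by case: X => ?; case: Y => ?; subst; split => //=; lra.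
    by exists (exist _ _ I); case: X => ?; case: Y => ?; subst; split => //=; lra.
  have := split4 x y n x1 x2 y1 y2 => E.
  have D : eta * h n ^+ 2 = eta * h n.+1 ^+ 2 + eta * h n.+1 ^+ 2 + eta * h n.+1 ^+ 2 + eta * h n.+1 ^+ 2.
    by rewrite hn; ring.
  have [?|L1] := leP (eta * h n.+1 ^+ 2) (cmod (Phi x y n.+1)).
    by apply: (K x y) => //; left.
  have [?|L2] := leP (eta * h n.+1 ^+ 2) (cmod (Phi (x + A * h n.+1) y n.+1)).
    by apply: (K (x + A * h n.+1) y) => //; [right|left].
  have [?|L3] := leP (eta * h n.+1 ^+ 2) (cmod (Phi x (y + B * h n.+1) n.+1)).
    by apply: (K x (y + B * h n.+1)) => //; [left|right].
  apply: (K (x + A * h n.+1) (y + B * h n.+1)); [by right|by right|].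
  move: L; rewrite E D => L.
  have T1 := cmodD (Phi x y n.+1 + Phi (x + A * h n.+1) y n.+1 + Phi x (y + B * h n.+1) n.+1)
     (Phi (x + A * h n.+1) (y + B * h n.+1) n.+1).
  have T2 := cmodD (Phi x y n.+1 + Phi (x + A * h n.+1) y n.+1) (Phi x (y + B * h n.+1) n.+1).
  have T3 := cmodD (Phi x y n.+1) (Phi (x + A * h n.+1) y n.+1).
  lra.
have I0 : inv (0%N, (x0, y0)) by split; rewrite //= /h ?expr0 ?expr1n ?mulr1.
pose S n := iter n (fun s => sval (step s)) (exist _ _ I0).
pose s n := sval (S n).
have sS n : rel (s n) (s n.+1) by rewrite /s /=; case: (step _).
have si n : inv (s n) by rewrite /s; case: (S n).
have s1 n : (s n).1 = n by elim: n => // n IH; have [-> _ _ _ _] := sS n; rewrite IH.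
have dec (D : R) n : 0 <= D -> 0 <= D * h n by move=> D0; rewrite mulr_ge0// ltW.
have [p Hp] : exists p, forall n, (s n).2.1 <= p <= (s n).2.1 + A * h n.
  by apply: nested_intervals => n; [exact: dec|case: (sS n)|case: (sS n); rewrite !s1].
have [q Hq] : exists q, forall n, (s n).2.2 <= q <= (s n).2.2 + B * h n.
  by apply: nested_intervals => n; [exact: dec|case: (sS n)|case: (sS n); rewrite !s1].
have [|||n Hn] := small p q _ _ (eta / 2); last 1 first.
- have := si n; have := Hp n; have := Hq n; have := s1 n.
  move: (s n) => -[m [x y]] /= mn; subst m; rewrite /inv/= => qn pn [i1 i2 i3 i4 L].
  have := Hn _ _ i1 i2 i3 i4 pn qn; apply/negP; rewrite -ltNge.
  apply: lt_le_trans L; rewrite ltr_pM2r ?exprn_gt0//.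
  by rewrite ltr_pdivrMr// ltr_pMr// ltr1n.
- by have := Hp 0%N; rewrite /= /h expr0 mulr1.
- by have := Hq 0%N; rewrite /= /h expr0 mulr1.
- by rewrite divr_gt0.
Qed.

(** The contour integral taken counterclockwise; ['i] is the derivative of the parametrization of a
    vertical side. *)
Definition rect f (x1 x2 y1 y2 : R) : C :=
  seg (fun t => f (t +i* y1)) x1 x2 + 'i * seg (fun t => f (x2 +i* t)) y1 y2
  - seg (fun t => f (t +i* y2)) x1 x2 - 'i * seg (fun t => f (x1 +i* t)) y1 y2.

Lemma hline x y : x +i* y = 0 +i* y + x%:C * 1.
Proof. by apply/eqP; rewrite mulr1 eq_complex/= !(add0r, addr0) !eqxx. Qed.

Lemma vline x y : x +i* y = x%:C + y%:C * 'i.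
Proof. by apply/eqP; rewrite eq_complex/= !(mul0r, mulr0, mulr1, subr0, addr0, add0r) !eqxx. Qed.

Lemma ccont_hline f x y : ccont f (x +i* y) -> rcont (fun t => f (t +i* y)) x.
Proof.
rewrite {1}hline => /ccont_comp.
by under [X in _ -> rcont X _]eq_fun do rewrite hline.
Qed.

Lemma ccont_vline f x y : ccont f (x +i* y) -> rcont (fun t => f (x +i* t)) y.
Proof.
rewrite {1}vline => /ccont_comp.
by under [X in _ -> rcont X _]eq_fun do rewrite vline.
Qed.

Lemma cderiv_hline f x y d : cderiv f (x +i* y) d -> rderiv (fun t => f (t +i* y)) x d.
Proof.
rewrite {1}hline => /cderiv_comp; rewrite mulr1.
by under [X in _ -> rderiv X _ _]eq_fun do rewrite hline.
Qed.

Lemma cderiv_vline f x y d : cderiv f (x +i* y) d -> rderiv (fun t => f (x +i* t)) y (d * 'i).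
Proof.
rewrite {1}vline => /cderiv_comp.
by under [X in _ -> rderiv X _ _]eq_fun do rewrite vline.
Qed.

Lemma rect_splitx f x1 x x2 y1 y2 : x1 <= x -> x <= x2 ->
  (forall t, x1 <= t <= x2 -> ccont f (t +i* y1)) ->
  (forall t, x1 <= t <= x2 -> ccont f (t +i* y2)) ->
  rect f x1 x2 y1 y2 = rect f x1 x y1 y2 + rect f x x2 y1 y2.
Proof.
move=> h1 h2 c1 c2; rewrite /rect.
rewrite (seg_split h1 h2 (fun t tx => ccont_hline (c1 t tx))).
rewrite (seg_split h1 h2 (fun t tx => ccont_hline (c2 t tx))).
by ring.
Qed.

Lemma rect_splity f x1 x2 y1 y y2 : y1 <= y -> y <= y2 ->
  (forall t, y1 <= t <= y2 -> ccont f (x1 +i* t)) ->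
  (forall t, y1 <= t <= y2 -> ccont f (x2 +i* t)) ->
  rect f x1 x2 y1 y2 = rect f x1 x2 y1 y + rect f x1 x2 y y2.
Proof.
move=> h1 h2 c1 c2; rewrite /rect.
rewrite (seg_split h1 h2 (fun t tx => ccont_vline (c1 t tx))).
rewrite (seg_split h1 h2 (fun t tx => ccont_vline (c2 t tx))).
by ring.
Qed.

Definition on_boundary (x1 x2 y1 y2 : R) (P : C -> Prop) :=
  [/\ forall t, x1 <= t <= x2 -> P (t +i* y1), forall t, x1 <= t <= x2 -> P (t +i* y2),
      forall t, y1 <= t <= y2 -> P (x1 +i* t) & forall t, y1 <= t <= y2 -> P (x2 +i* t)].

Lemma on_boundary_in x1 x2 y1 y2 (P : C -> Prop) : x1 <= x2 -> y1 <= y2 ->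
  (forall x y, x1 <= x <= x2 -> y1 <= y <= y2 -> P (x +i* y)) ->
  on_boundary x1 x2 y1 y2 P.
Proof. by move=> hx hy H; split => t ht; apply: H; rewrite ?lexx ?hx ?hy. Qed.

Lemma rect_bound f x1 x2 y1 y2 (M : R) : x1 <= x2 -> y1 <= y2 ->
  on_boundary x1 x2 y1 y2 (ccont f) ->
  on_boundary x1 x2 y1 y2 (fun z => cmod (f z) <= M) ->
  cmod (rect f x1 x2 y1 y2) <= 4 * M * ((x2 - x1) + (y2 - y1)).
Proof.
move=> hx hy [c1 c2 c3 c4] [m1 m2 m3 m4].
have b1 := seg_bound hx (fun t tx => ccont_hline (c1 t tx)) m1.
have b2 := seg_bound hx (fun t tx => ccont_hline (c2 t tx)) m2.
have b3 := seg_bound hy (fun t tx => ccont_vline (c3 t tx)) m3.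
have b4 := seg_bound hy (fun t tx => ccont_vline (c4 t tx)) m4.
rewrite /rect; apply: (le_trans (cmodB _ _)); rewrite cmodM cmodi mul1r.
apply: (le_trans (lerD (cmodB _ _) b3)).
apply: (le_trans (lerD (lerD (cmodD _ _) b2) (lexx _))).
rewrite cmodM cmodi mul1r; lra.
Qed.

Lemma eq_rect_fun f g x1 x2 y1 y2 : x1 <= x2 -> y1 <= y2 ->
  on_boundary x1 x2 y1 y2 (fun z => f z = g z) -> rect f x1 x2 y1 y2 = rect g x1 x2 y1 y2.
Proof.
move=> hx hy [m1 m2 m3 m4]; rewrite /rect (eq_seg m1) (eq_seg m2) .
by rewrite (eq_seg m3) (eq_seg m4).
Qed.

Lemma rectD f g x1 x2 y1 y2 :
  on_boundary x1 x2 y1 y2 (ccont f) -> on_boundary x1 x2 y1 y2 (ccont g) ->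
  rect (fun z => f z + g z) x1 x2 y1 y2 = rect f x1 x2 y1 y2 + rect g x1 x2 y1 y2.
Proof.
move=> [c1 c2 c3 c4] [d1 d2 d3 d4]; rewrite /rect.
rewrite (segD (fun t tx => ccont_hline (c1 t tx)) (fun t tx => ccont_hline (d1 t tx))).
rewrite (segD (fun t tx => ccont_hline (c2 t tx)) (fun t tx => ccont_hline (d2 t tx))).
rewrite (segD (fun t tx => ccont_vline (c3 t tx)) (fun t tx => ccont_vline (d3 t tx))).
rewrite (segD (fun t tx => ccont_vline (c4 t tx)) (fun t tx => ccont_vline (d4 t tx))).
by ring.
Qed.

Lemma rectZ (c : C) f x1 x2 y1 y2 : on_boundary x1 x2 y1 y2 (ccont f) ->
  rect (fun z => c * f z) x1 x2 y1 y2 = c * rect f x1 x2 y1 y2.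
Proof.
move=> [c1 c2 c3 c4]; rewrite /rect.
rewrite (segZ c (fun t tx => ccont_hline (c1 t tx))).
rewrite (segZ c (fun t tx => ccont_hline (c2 t tx))).
rewrite (segZ c (fun t tx => ccont_vline (c3 t tx))).
rewrite (segZ c (fun t tx => ccont_vline (c4 t tx))).
by ring.
Qed.

(** Each side contributes a difference of values of [F] at two corners, and these cancel around the
    contour. *)
Lemma rect_primitive f F x1 x2 y1 y2 : x1 <= x2 -> y1 <= y2 ->
  on_boundary x1 x2 y1 y2 (ccont f) ->
  on_boundary x1 x2 y1 y2 (fun z => cderiv F z (f z)) ->
  rect f x1 x2 y1 y2 = 0.
Proof.
move=> hx hy [c1 c2 c3 c4] [m1 m2 m3 m4].
have V x : (forall t, y1 <= t <= y2 -> ccont f (x +i* t)) ->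
   (forall t, y1 <= t <= y2 -> cderiv F (x +i* t) (f (x +i* t))) ->
   'i * seg (fun t => f (x +i* t)) y1 y2 = F (x +i* y2) - F (x +i* y1).
  move=> c m; rewrite -(segZ _ (fun t tx => ccont_vline (c t tx))).
  apply: (@seg_FTC _ (fun t => F (x +i* t)) (fun t => 'i * f (x +i* t))) => //.
    move=> t tx e e0; have [r r0 H] := ccont_vline (c t tx) e0.
    by exists r => // h /H; rewrite -mulrBr cmodM cmodi mul1r.
  by move=> t tx; rewrite mulrC; apply: cderiv_vline; exact: m.
rewrite /rect (V _ c3 m3) (V _ c4 m4).
rewrite (seg_FTC hx (fun t tx => ccont_hline (c1 t tx)) (fun t tx => cderiv_hline (m1 t tx))).
rewrite (seg_FTC hx (fun t tx => ccont_hline (c2 t tx)) (fun t tx => cderiv_hline (m2 t tx))).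
by ring.
Qed.

Lemma rect_affine (a b : C) x1 x2 y1 y2 : x1 <= x2 -> y1 <= y2 ->
  rect (fun z => a + b * z) x1 x2 y1 y2 = 0.
Proof.
move=> hx hy; apply: (@rect_primitive _ (fun z => a * z + (b / 2) * (z * z))) => //.
  apply: on_boundary_in => // x y _ _.
  apply: (@cderiv_ccont _ _ _ (0 + (0 * (x +i* y) + b * 1))).
  apply: cderivD; first exact: cderivC.
  by apply: cderivM; [exact: cderivC|exact: cderiv_id].
apply: on_boundary_in => // x y _ _; set z := x +i* y.
apply: (@cderiv_eq _ _ _ ((0 * z + a * 1) + (0 * (z * z) + (b / 2) * (1 * z + z * 1)))).
  apply: cderivD.
    by apply: cderivM; [exact: cderivC|exact: cderiv_id].
  apply: cderivM; first exact: cderivC.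
  by apply: (@cderivM _ id id); exact: cderiv_id.
by field.
Qed.

End Rectangles.

(** * Goursat's theorem on rectangles, with and without a puncture *)

Section GoursatTheorem.
Variable R : realType.
Local Notation C := R[i].
Implicit Types (f F : C -> C) (x y : R).

(** Near the limit point of the bisection, [f] differs by at most $e'|z - z_0|$ from an affine
    function, whose contour integral vanishes. On a rectangle of size $h$ this leaves an integral of
    order $e' h^2$. *)
Lemma goursat f x1 x2 y1 y2 : x1 <= x2 -> y1 <= y2 ->
  (forall x y, x1 <= x <= x2 -> y1 <= y <= y2 -> exists d, cderiv f (x +i* y) d) ->
  rect f x1 x2 y1 y2 = 0.
Proof.
move=> hx hy fd; pose A := x2 - x1; pose B := y2 - y1.
have A0 : 0 <= A by rewrite subr_ge0.
have B0 : 0 <= B by rewrite subr_ge0.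
have ex1 : x1 + A = x2 by rewrite /A addrC subrK.
have ey1 : y1 + B = y2 by rewrite /B addrC subrK.
have fc x y : x1 <= x <= x2 -> y1 <= y <= y2 -> ccont f (x +i* y).
  by move=> xx yy; have [d] := fd x y xx yy; exact: cderiv_ccont.
pose h (n : nat) : R := 2^-1 ^+ n.
have h0 n : 0 < h n by rewrite exprn_gt0// invr_gt0.
have h2 n : h n = h n.+1 + h n.+1 by rewrite /h exprS; field.
have := @bisection R (fun x y n => rect f x (x + A * h n) y (y + B * h n)) A B x1 y1 A0 B0.
rewrite /= /h expr0 !mulr1 ex1 ey1; apply.
  move=> x y n; rewrite -/(h n) -/(h n.+1) => ax xb ay yb.
  have Ah := mulr_ge0 A0 (ltW (h0 n.+1)); have Bh := mulr_ge0 B0 (ltW (h0 n.+1)).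
  have EA : A * h n = A * h n.+1 + A * h n.+1 by rewrite -mulrDr -h2.
  have EB : B * h n = B * h n.+1 + B * h n.+1 by rewrite -mulrDr -h2.
  have -> : x + A * h n = x + A * h n.+1 + A * h n.+1 by rewrite EA addrA.
  have -> : y + B * h n = y + B * h n.+1 + B * h n.+1 by rewrite EB addrA.
  rewrite (@rect_splitx _ _ x (x + A * h n.+1)); [| lra | lra | |]; last 2 first.
  - by move=> t /andP[? ?]; apply: fc; lra.
  - by move=> t /andP[? ?]; apply: fc; lra.
  rewrite (@rect_splity _ _ x _ y (y + B * h n.+1)); [| lra | lra | |]; last 2 first.
  - by move=> t /andP[? ?]; apply: fc; lra.
  - by move=> t /andP[? ?]; apply: fc; lra.
  rewrite (@rect_splity _ _ (x + _) _ y (y + B * h n.+1)); [| lra | lra | |]; last 2 first.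
  - by move=> t /andP[? ?]; apply: fc; lra.
  - by move=> t /andP[? ?]; apply: fc; lra.
  by ring.
move=> p q pp qq e e0; have [d Hd] := fd p q pp qq.
(* The integrand is at most $e' L h$ and half the perimeter at most $L h$; the bound $4 (e' L h)(L
   h)$ of [rect_bound] equals $e h^2$ for this $e'$. The summand 1 keeps [L] positive when the
   rectangle is a point. *)
pose L := A + B + 1; have L0 : 0 < L by rewrite /L; lra.
pose e' := e / (4 * L * L).
have e'0 : 0 < e' by rewrite divr_gt0// !mulr_gt0.
have [r r0 H] := Hd e' e'0.
have [n hn] : exists n, h n * L < r.
  have : (geometric 1 2^-1 : nat -> R) @ \oo --> 0.
    by apply: cvg_geometric; rewrite ger0_norm ?invr_ge0// invf_lt1// ltr1n.
  move/cvgrPdist_lt => /(_ (r / L)); rewrite divr_gt0// => /(_ isT)[n _ /(_ n)] /=.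
  rewrite leqnn => /(_ isT); rewrite sub0r normrN mul1r ger0_norm ?(ltW (h0 n))// => hn.
  by exists n; rewrite -ltr_pdivlMr.
exists n => x y; rewrite -/(h n) => ax xb ay yb xp yq.
have Ah := mulr_ge0 A0 (ltW (h0 n)); have Bh := mulr_ge0 B0 (ltW (h0 n)).
have hxx : x <= x + A * h n by lra.
have hyy : y <= y + B * h n by lra.
pose z0 := p +i* q.
pose g z := f z - (f z0 - d * z0) - d * z.
have gE z : f z = g z + ((f z0 - d * z0) + d * z) by rewrite /g; ring.
have inr (s t : R) : x <= s <= x + A * h n -> y <= t <= y + B * h n -> ccont f (s +i* t).
  by move=> /andP[? ?] /andP[? ?]; apply: fc; lra.
have affd (a b z : C) : cderiv (fun w => a + b * w) z (0 + (0 * z + b * 1)).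
  apply: cderivD; first exact: cderivC.
  by apply: cderivM; [exact: cderivC|exact: cderiv_id].
have gc (s t : R) : x <= s <= x + A * h n -> y <= t <= y + B * h n -> ccont g (s +i* t).
  move=> ss tt; have [||d' Hd'] := fd s t; try (move: ss tt => /andP[? ?] /andP[? ?]; lra).
  apply: cderiv_ccont; apply: (@cderiv_ext _ (fun z => f z + ((- (f z0 - d * z0)) + (- d) * z))).
    by move=> z; rewrite /g; ring.
  by apply: cderivD; [exact: Hd'|exact: affd].
have E : rect f x (x + A * h n) y (y + B * h n) = rect g x (x + A * h n) y (y + B * h n).
  rewrite (@eq_rect_fun _ f (fun z => g z + ((f z0 - d * z0) + d * z)))//.
  rewrite (@rectD _ g (fun z => (f z0 - d * z0) + d * z)); last 2 first.
  - by apply: on_boundary_in => //; exact: gc.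
  - by apply: on_boundary_in => // s t _ _; apply: cderiv_ccont; exact: affd.
  by rewrite rect_affine ?addr0.
rewrite E; apply: (le_trans (rect_bound (M := e' * (L * h n)) _ _ _ _)) => //.
- by apply: on_boundary_in => //; exact: gc.
- apply: on_boundary_in => //.
  move=> s t ss tt; have Hm : cmod (s +i* t - z0) <= (A + B) * h n.
    apply: (le_trans (cmod_le_ReIm _)); rewrite /= mulrDl lerD//.
      by rewrite ler_norml; move: ss xp => /andP[? ?] /andP[? ?]; apply/andP; split; lra.
    by rewrite ler_norml; move: tt yq => /andP[? ?] /andP[? ?]; apply/andP; split; lra.
  have Hm' : (A + B) * h n <= L * h n by rewrite ler_wpM2r ?(ltW (h0 n))// /L; lra.
  have := H (s +i* t - z0); rewrite -/z0 (addrC z0) subrK (le_lt_trans Hm)//; last first.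
    by rewrite (le_lt_trans Hm')// mulrC.
  move=> /(_ isT) Hg; rewrite (_ : g _ = f (s +i* t) - f z0 - d * (s +i* t - z0)); last first.
    by rewrite /g; ring.
  apply: (le_trans Hg); rewrite ler_wpM2l ?(ltW e'0)//; exact: le_trans Hm Hm'.
- rewrite (_ : _ + _ = (A + B) * h n); last by ring.
  rewrite (_ : e * h n ^+ 2 = 4 * (e' * (L * h n)) * (L * h n)); last first.
    rewrite /e'; clearbody L; have L1 : L != 0 by rewrite gt_eqF.
    by field.
  have m0 : 0 <= 4 * (e' * (L * h n)).
    exact: mulr_ge0 (ler0n _ 4) (mulr_ge0 (ltW e'0) (mulr_ge0 (ltW L0) (ltW (h0 n)))).
  by rewrite ler_wpM2l// ler_wpM2r ?(ltW (h0 n))// /L; lra.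
Qed.

(** The left, right, lower and upper strips are cut off in turn, and [goursat] annihilates each of
    them. *)
Lemma rect_shrink f x1 x2 y1 y2 a b c d : x1 <= a -> a <= b -> b <= x2 ->
  y1 <= c -> c <= d -> d <= y2 ->
  (forall x y, x1 <= x <= x2 -> y1 <= y <= y2 -> [|| x <= a, b <= x, y <= c | d <= y] ->
     exists k, cderiv f (x +i* y) k) ->
  rect f x1 x2 y1 y2 = rect f a b c d.
Proof.
move=> xa ab bx yc cd dy fd.
have fc x y : x1 <= x <= x2 -> y1 <= y <= y2 -> [|| x <= a, b <= x, y <= c | d <= y] ->
    ccont f (x +i* y).
  by move=> hx hy h; have [k] := fd x y hx hy h; exact: cderiv_ccont.
have xb := le_trans xa ab; have yd := le_trans yc cd.
have ax := le_trans ab bx; have cy := le_trans cd dy.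
have yy1 : y1 <= y1 <= y2 by rewrite lexx (le_trans yd).
have yy2 : y1 <= y2 <= y2 by rewrite lexx (le_trans yd).
have xxa : x1 <= a <= x2 by rewrite xa.
have xxb : x1 <= b <= x2 by rewrite xb.
have axx t : a <= t <= x2 -> x1 <= t <= x2 by move=> /andP[h ->]; rewrite (le_trans xa h).
have cyy t : c <= t <= y2 -> y1 <= t <= y2 by move=> /andP[h ->]; rewrite (le_trans yc h).
rewrite (@rect_splitx _ _ x1 a x2)//; last 2 first.
- by move=> t tt; apply: fc; rewrite ?yc ?orbT.
- by move=> t tt; apply: fc; rewrite ?dy ?orbT.
rewrite goursat//; last 2 first.
- exact: le_trans yd dy.
- by move=> x y /andP[h1 h2] yy; apply: fd; rewrite ?h1 ?h2 ?(le_trans h2 ax).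
rewrite add0r (@rect_splitx _ _ a b x2)//; last 2 first.
- by move=> t /axx tt; apply: fc; rewrite ?yc ?orbT.
- by move=> t /axx tt; apply: fc; rewrite ?dy ?orbT.
rewrite (@goursat _ b)//; last 2 first.
- exact: le_trans yd dy.
- by move=> x y /andP[h1 h2] yy; apply: fd; rewrite ?h1 ?h2 ?(le_trans xb h1) ?orbT.
rewrite addr0 (@rect_splity _ _ _ _ y1 c y2)//; last 2 first.
- by move=> t tt; apply: fc; rewrite ?lexx.
- by move=> t tt; apply: fc; rewrite ?lexx ?orbT.
rewrite goursat//; last first.
  move=> x y /andP[h1 h2] /andP[h3 h4]; apply: fd; rewrite ?h3 ?h4 ?(le_trans h4 cy) ?orbT//.
  by rewrite (le_trans xa h1) (le_trans h2 bx).
rewrite add0r (@rect_splity _ _ _ _ c d y2)//; last 2 first.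
- by move=> t /cyy tt; apply: fc; rewrite ?lexx.
- by move=> t /cyy tt; apply: fc; rewrite ?lexx ?orbT.
rewrite (@goursat _ _ _ d)// ?addr0// => x y /andP[h1 h2] /andP[h3 h4].
apply: fd; rewrite ?h3 ?h4 ?(le_trans yd h3) ?orbT//.
by rewrite (le_trans xa h1) (le_trans h2 bx).
Qed.

(** The contour shrinks to a square of half-side $e$ around the puncture. As [f] is bounded there,
    the integral is at most $16 M e$ for every small $e$. *)
Lemma goursat_punctured f x1 x2 y1 y2 (p q M r : R) : x1 < p < x2 -> y1 < q < y2 ->
  (forall x y, x1 <= x <= x2 -> y1 <= y <= y2 -> x +i* y != p +i* q ->
     exists d, cderiv f (x +i* y) d) -> 0 < r ->
  (forall z, z != p +i* q -> cmod (z - p +i* q) < r -> cmod (f z) <= M) ->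
  rect f x1 x2 y1 y2 = 0.
Proof.
move=> /andP[px1 px2] /andP[qy1 qy2] fd r0 fM; set z0 := p +i* q in fd fM *.
have key (e : R) : 0 < e -> e < p - x1 -> e < x2 - p -> e < q - y1 -> e < y2 - q -> 2 * e < r ->
    cmod (rect f x1 x2 y1 y2) <= 16 * M * e.
  move=> e0 e1 e2 e3 e4 er.
  have b1 : x1 <= p - e by rewrite lerBrDl -lerBrDr ltW.
  have b2 : p + e <= x2 by rewrite -lerBrDl ltW.
  have b3 : y1 <= q - e by rewrite lerBrDl -lerBrDr ltW.
  have b4 : q + e <= y2 by rewrite -lerBrDl ltW.
  have lt (t : R) : t - e <= t + e by rewrite lerD2l ge0_cp// ltW.
  have ne (t s : R) : (t <= s - e) || (s + e <= t) -> t != s.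
    by move=> H; apply/eqP => ts; move: H; rewrite ts lerDl oppr_ge0 gerDl orbb leNgt e0.
  have fd' x y : x1 <= x <= x2 -> y1 <= y <= y2 ->
      [|| x <= p - e, p + e <= x, y <= q - e | q + e <= y] -> exists k, cderiv f (x +i* y) k.
    move=> hx hy H; apply: fd => //; rewrite eq_complex/= negb_and.
    by move: H; rewrite orbA => /orP[/ne ->|/ne ->]; rewrite ?orbT.
  rewrite (@rect_shrink _ _ _ _ _ (p - e) (p + e) (q - e) (q + e))//.
  have Q (s t : R) : p - e <= s <= p + e -> q - e <= t <= q + e ->
      [|| s <= p - e, p + e <= s, t <= q - e | q + e <= t] ->
      ccont f (s +i* t) /\ cmod (f (s +i* t)) <= M.
    move=> ss tt H; split.
      move: ss tt => /andP[h1 h2] /andP[h3 h4]; have [||//|k] := fd' s t; last exact: cderiv_ccont.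
      - by rewrite (le_trans b1 h1) (le_trans h2 b2).
      - by rewrite (le_trans b3 h3) (le_trans h4 b4).
    apply: fM; first by rewrite eq_complex/= negb_and; move: H; rewrite orbA => /orP[/ne ->|/ne ->]; rewrite ?orbT.
    rewrite (le_lt_trans (cmod_le_ReIm _))//= (le_lt_trans _ er)// mulr_natl mulr2n.
    by rewrite lerD// ler_distl.
  rewrite (_ : 16 * M * e = 4 * M * ((p + e - (p - e)) + (q + e - (q - e)))); last by ring.
  apply: rect_bound => //.
    by split => t tt; apply: (proj1 (Q _ _ _ _ _)); rewrite ?lexx ?lt ?orbT.
  by split => t tt; apply: (proj2 (Q _ _ _ _ _)); rewrite ?lexx ?lt ?orbT.
apply/eqP; rewrite -cmod_eq0 eq_le cmod_ge0 andbT leNgt; apply/negP => c0.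
set c := cmod _ in c0 key.
pose K := 16 * `|M| + 1; have K0 : 0 < K by rewrite /K; have := normr_ge0 M; lra.
pose m := Num.min (c / K) (Num.min (p - x1) (Num.min (x2 - p) (Num.min (q - y1) (Num.min (y2 - q) (r / 2))))).
have m0 : 0 < m by rewrite !lt_min !divr_gt0// !subr_gt0 px1 px2 qy1 qy2.
have : m / 2 < m by rewrite ltr_pdivrMr// ltr_pMr// ltr1n.
set e := m / 2 => em; have e0 : 0 < e by rewrite divr_gt0.
move: (em); rewrite {1}/m !lt_min => /and5P[ec e1 e2 e3 /andP[e4 e5]].
have := key e e0 e1 e2 e3 e4; rewrite -ltr_pdivlMl// mulrC => /(_ e5); apply/negP.
rewrite -ltNge; move: ec; rewrite ltr_pdivlMr//; apply: le_lt_trans.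
have Mn := ler_norm M; rewrite mulrC ler_wpM2l ?(ltW e0)// /K; lra.
Qed.

End GoursatTheorem.

Local Notation on_sides s := (on_boundary (- s) s (- s) s).

(** * Cauchy's integral formula *)

Section CauchyFormula.
Variable R : realType.
Local Notation C := R[i].
Implicit Types (f g : C -> C) (z w a : C).

Definition diffable f z := exists d, cderiv f z d.

Lemma cderiv_chain f g z d d' : cderiv g z d -> cderiv f (g z) d' ->
  cderiv (fun w => f (g w)) z (d' * d).
Proof.
move=> gd fd e e0.
pose K := 1 + cmod d + cmod d'.
have dz := cmod_ge0 d; have dz' := cmod_ge0 d'.
have K0 : 0 < K by rewrite /K; lra.
have e1 : 0 < e / (K + K) by rewrite divr_gt0// addr_gt0.
pose e' := Num.min 1 (e / (K + K)).
have e'0 : 0 < e' by rewrite lt_min ltr01.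
have [r r0 Hf] := fd _ e'0; have [s s0 Hg] := gd _ e'0.
have r20 : 0 < r / 2 by rewrite divr_gt0.
have [t t0 Ht] := cderiv_ccont gd r20.
exists (Num.min s t) => [|h]; first by rewrite lt_min s0.
rewrite lt_min => /andP[/Hg {}Hg /Ht {}Ht].
set k := g (z + h) - g z in Hg Ht.
have -> : g (z + h) = g z + k by rewrite /k; ring.
have kr : cmod k < r by rewrite (le_lt_trans Ht)// ltr_pdivrMr// ltr_pMr// ltr1n.
have {}Hf := Hf k kr.
rewrite (_ : _ - _ = (f (g z + k) - f (g z) - d' * k) + d' * (k - d * h)); last by ring.
apply: (le_trans (cmodD _ _)); rewrite cmodM.
have h0 := cmod_ge0 h.
have e'1 : e' <= 1 by rewrite /e' ge_min lexx.
have e'e : e' <= e / (K + K) by rewrite /e' ge_min lexx orbT.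
have kK : cmod k <= K * cmod h.
  rewrite -(subrK (d * h) k) (le_trans (cmodD _ _))// cmodM.
  apply: (le_trans (lerD Hg (lexx _))); rewrite -mulrDl ler_wpM2r// /K.
  by clear -e'1 dz'; lra.
have A1 : cmod (f (g z + k) - f (g z) - d' * k) <= e' * (K * cmod h).
  by apply: (le_trans Hf); rewrite ler_wpM2l// ltW.
have A2 : cmod d' * cmod (k - d * h) <= K * (e' * cmod h).
  by apply: ler_pM; rewrite ?cmod_ge0// /K; clear -dz dz'; lra.
apply: (le_trans (lerD A1 A2)).
rewrite (_ : _ + _ = e' * (K + K) * cmod h); last by ring.
by rewrite ler_wpM2r// -ler_pdivlMr// addr_gt0.
Qed.

Lemma cderiv_inv g z d : g z != 0 -> cderiv g z d ->
  cderiv (fun w => (g w)^-1) z (- (g z) ^- 2 * d).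
Proof. by move=> gz gd; exact: (cderiv_chain gd (cderivV gz)). Qed.

Lemma diffable_ccont f z : diffable f z -> ccont f z.
Proof. by case=> d; exact: cderiv_ccont. Qed.

Lemma diffableC (c : C) z : diffable (fun=> c) z.
Proof. by exists 0; exact: cderivC. Qed.

Lemma diffable_id z : diffable id z.
Proof. by exists 1; exact: cderiv_id. Qed.

Lemma diffableD f g z : diffable f z -> diffable g z -> diffable (fun w => f w + g w) z.
Proof. by move=> [d fd] [d' gd]; eexists; exact: cderivD fd gd. Qed.

Lemma diffableM f g z : diffable f z -> diffable g z -> diffable (fun w => f w * g w) z.
Proof. by move=> [d fd] [d' gd]; eexists; exact: cderivM fd gd. Qed.

Lemma diffable_inv g z : g z != 0 -> diffable g z -> diffable (fun w => (g w)^-1) z.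
Proof. by move=> gz [d' gd]; eexists; exact: cderiv_inv gz gd. Qed.

Lemma diffable_comp f g z : diffable g z -> diffable f (g z) -> diffable (fun w => f (g w)) z.
Proof. by move=> [d gd] [d' fd]; eexists; exact: cderiv_chain gd fd. Qed.

Lemma diffableB f (c : C) z : diffable f z -> diffable (fun w => f w - c) z.
Proof. by move=> fd; exact: diffableD fd (diffableC _ _). Qed.

Lemma diffableX f n z : diffable f z -> diffable (fun w => f w ^+ n) z.
Proof.
move=> fd; elim: n => [|n IH].
  by under [X in diffable X]eq_fun do rewrite expr0; exact: diffableC.
by under [X in diffable X]eq_fun do rewrite exprS; exact: diffableM fd IH.
Qed.

Lemma diffable_sum (F : nat -> C -> C) m z : (forall n, (n < m)%N -> diffable (F n) z) ->
  diffable (fun w => \sum_(n < m) F n w) z.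
Proof.
elim: m => [_|m IH H].
  by under [X in diffable X]eq_fun do rewrite big_ord0; exact: diffableC.
under [X in diffable X]eq_fun do rewrite big_ord_recr/=.
by apply: diffableD; [apply: IH => n /ltnW; exact: H|exact: H].
Qed.

Lemma cderivVX n z : z != 0 -> cderiv (fun w => w^-1 ^+ n) z (- n%:R * z^-1 ^+ n.+1).
Proof.
move=> z0; elim: n => [|n IH].
  rewrite oppr0 mul0r; under [X in cderiv X]eq_fun do rewrite expr0.
  exact: cderivC.
under [X in cderiv X]eq_fun do rewrite exprSr.
apply: (cderiv_eq (cderivM IH (cderivV z0))).
by rewrite -natr1 -exprVn expr2 !exprSr; ring.
Qed.

Lemma cderiv_unique f z d d' : cderiv f z d -> cderiv f z d' -> d = d'.
Proof.
move=> H H'; apply/eqP; rewrite -subr_eq0 -cmod_eq0 eq_le cmod_ge0 andbT leNgt.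
apply/negP => k0; set k := cmod _ in k0.
have e0 : 0 < k / 4 by rewrite divr_gt0.
have [r r0 {}H] := H _ e0; have [s s0 {}H'] := H' _ e0.
pose t := Num.min r s / 2.
have t0 : 0 < t by rewrite divr_gt0// lt_min r0.
have ts : t < Num.min r s by rewrite /t ltr_pdivrMr ?ltr_pMr ?ltr1n// lt_min r0.
move: ts; rewrite lt_min => /andP[tr ts].
have ct : cmod t%:C = t by rewrite cmodR gtr0_norm.
have {}H := H t%:C; have {}H' := H' t%:C.
move: H H'; rewrite ct => /(_ tr) H /(_ ts) H'.
have : k * t <= k / 4 * t + k / 4 * t.
  rewrite /k -{1}ct -cmodM; apply: le_trans (lerD H' H).
  by apply: le_trans (cmodB _ _); rewrite le_eqVlt; apply/orP; left; apply/eqP; congr cmod; ring.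
rewrite -mulrDl ler_pM2r//; lra.
Qed.

Lemma cderiv_quad f z d (K r : R) : 0 < r ->
  (forall h, cmod h < r -> cmod (f (z + h) - f z - d * h) <= K * cmod h ^+ 2) ->
  cderiv f z d.
Proof.
move=> r0 H e e0; have K0 : 0 < `|K| + 1 by rewrite ltr_wpDl.
exists (Num.min r (e / (`|K| + 1))) => [|h]; first by rewrite lt_min r0 divr_gt0.
rewrite lt_min => /andP[/H hr]; rewrite ltr_pdivlMr// => he.
apply: (le_trans hr); rewrite expr2 mulrA ler_wpM2r ?cmod_ge0//.
apply: le_trans (ltW he); rewrite mulrC ler_wpM2l ?cmod_ge0//.
by rewrite (le_trans (ler_norm _))// lerDl.
Qed.

(** Squares play the role of circles, since [goursat] applies to contours with sides parallel to the
    axes. *)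
Definition oint (s : R) f := rect f (- s) s (- s) s.

Lemma boundary_cmod (s : R) : 0 < s ->
  on_sides s (fun z => s <= cmod z <= 2 * s).
Proof.
move=> s0; have H x y : `|x| <= s -> `|y| <= s -> `|x| = s \/ `|y| = s -> s <= cmod (x +i* y) <= 2 * s.
  move=> hx hy xy; apply/andP; split.
    by case: xy => <-; [apply: (Re_le_cmod (x +i* y))|apply: (Im_le_cmod (x +i* y))].
  by apply: (le_trans (cmod_le_ReIm _)); rewrite (_ : 2 * s = s + s) ?lerD//; ring.
have ns : `|s| = s by rewrite gtr0_norm.
by split => t tt; apply: H; rewrite ?normrN ?ns ?ler_norml//; tauto.
Qed.

Lemma on_boundary_imp x1 x2 y1 y2 (P Q : C -> Prop) : (forall z, P z -> Q z) ->
  on_boundary x1 x2 y1 y2 P -> on_boundary x1 x2 y1 y2 Q.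
Proof. by move=> PQ [a b c d]; split => t tt; apply: PQ; auto. Qed.

Lemma on_boundary_and x1 x2 y1 y2 (P Q : C -> Prop) :
  on_boundary x1 x2 y1 y2 P -> on_boundary x1 x2 y1 y2 Q ->
  on_boundary x1 x2 y1 y2 (fun z => P z /\ Q z).
Proof. by move=> [a b c d] [a' b' c' d']; split => t tt; split; auto. Qed.

Lemma oint_bound s f (M : R) : 0 < s -> on_sides s (diffable f) ->
  on_sides s (fun z => cmod (f z) <= M) -> cmod (oint s f) <= 16 * M * s.
Proof.
move=> s0 fc fM; have ss : - s <= s by clear -s0; lra.
have := @rect_bound _ f (- s) s (- s) s M ss ss.
rewrite (_ : 4 * M * _ = 16 * M * s); last by ring.
by apply=> //; apply: on_boundary_imp fc => z; exact: diffable_ccont.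
Qed.

Lemma ointD s f g : on_sides s (diffable f) ->
  on_sides s (diffable g) ->
  oint s (fun z => f z + g z) = oint s f + oint s g.
Proof.
by move=> fc gc; apply: rectD; [apply: on_boundary_imp fc|apply: on_boundary_imp gc];
  move=> z; exact: diffable_ccont.
Qed.

Lemma ointZ s f (c : C) : on_sides s (diffable f) ->
  oint s (fun z => c * f z) = c * oint s f.
Proof.
by move=> fc; apply: rectZ; apply: on_boundary_imp fc => z; exact: diffable_ccont.
Qed.

Lemma eq_oint s f g : 0 < s -> (forall z, s <= cmod z <= 2 * s -> f z = g z) ->
  oint s f = oint s g.
Proof.
move=> s0 fg; have ss : - s <= s by clear -s0; lra.
by apply: eq_rect_fun => //; apply: on_boundary_imp (boundary_cmod s0) => z; exact: fg.
Qed.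

Lemma oint_sum s (F : nat -> C -> C) m : 
  (forall n, (n < m)%N -> on_sides s (diffable (F n))) ->
  oint s (fun z => \sum_(n < m) F n z) = \sum_(n < m) oint s (F n).
Proof.
elim: m => [_|m IH H].
  rewrite big_ord0; under [X in oint _ X]eq_fun do rewrite big_ord0.
  rewrite (_ : (fun=> 0) = (fun z : C => 0 * 0)); last by apply/funext => z; rewrite mul0r.
  by rewrite ointZ ?mul0r//; split => t _; exact: diffableC.
rewrite big_ord_recr -IH => [|n /ltnW]; last exact: H.
under [X in oint _ X]eq_fun do rewrite big_ord_recr/=.
rewrite ointD//; last exact: H.
split => t tt; apply: diffable_sum => n /ltnW /H[] //;
  by [move=> + _ _ _; exact|move=> _ + _ _; exact|move=> _ _ + _; exact|move=> _ _ _; exact].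
Qed.

End CauchyFormula.

(** * Cauchy's formula and power series on squares *)

Section CauchyExpansion.
Variable R : realType.
Local Notation C := R[i].
Implicit Types (f g : C -> C) (z w a : C).

Definition on_square (s : R) (P : C -> Prop) :=
  forall x y : R, - s <= x <= s -> - s <= y <= s -> P (x +i* y).

Lemma on_square_boundary s P : 0 < s -> on_square s P -> on_sides s P.
Proof. by move=> s0 H; apply: on_boundary_in => //; clear -s0; lra. Qed.

Lemma lt_cmod_on_square s a : cmod a < s -> - s < Re a < s /\ - s < Im a < s.
Proof.
by move=> h; split; rewrite -ltr_norml (le_lt_trans _ h)// ?Re_le_cmod ?Im_le_cmod.
Qed.

Lemma boundary_sub_neq0 s a z : cmod a < s -> s <= cmod z -> z - a != 0.
Proof.
move=> h hz; rewrite -cmod_gt0 (lt_le_trans _ (cmod_dist z a))// subr_gt0.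
exact: lt_le_trans h hz.
Qed.

Lemma diffable_subV a p z : z - a != 0 -> diffable (fun z => (z - a)^-1 ^+ p) z.
Proof.
move=> za; apply: diffableX; apply: (@diffable_inv _ (fun w => w - a)) => //.
by apply: diffableB; exact: diffable_id.
Qed.

Lemma boundary_subV s a p : cmod a < s ->
  on_sides s (diffable (fun z => (z - a)^-1 ^+ p)).
Proof.
move=> h; have s0 : 0 < s by apply: le_lt_trans h; exact: cmod_ge0.
apply: on_boundary_imp (boundary_cmod s0) => z /andP[zs _].
exact/diffable_subV/(boundary_sub_neq0 h).
Qed.

Lemma boundaryM s f g : on_sides s (diffable f) ->
  on_sides s (diffable g) ->
  on_sides s (diffable (fun z => f z * g z)).
Proof.
by move=> F G; apply: on_boundary_imp (on_boundary_and F G) => z []; exact: diffableM.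
Qed.

Lemma boundaryC s (c : C) : on_sides s (diffable (fun=> c)).
Proof. by split => t _; exact: diffableC. Qed.

(** The difference quotient of [f] at [a] is bounded near [a] by $1 + |f'(a)|$, so
    [goursat_punctured] applies to it. The integral of $1/(z-a)$ is left unevaluated; [oint_kappa]
    and [kappa_neq0] deal with it. *)
Lemma cauchy_formula f s a : cmod a < s -> on_square s (diffable f) ->
  oint s (fun z => f z * (z - a)^-1) = f a * oint s (fun z => (z - a)^-1).
Proof.
move=> h fd; have s0 : 0 < s by apply: le_lt_trans h; exact: cmod_ge0.
have [h1 h2] := lt_cmod_on_square h.
have aE : Re a +i* Im a = a by case: (a).
have V1 : on_sides s (diffable (fun z => (z - a)^-1)).
  by have := boundary_subV 1 h; under eq_fun do rewrite expr1.
pose q z := (f z - f a) * (z - a)^-1.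
have q0 : oint s q = 0.
  have [d Hd] : diffable f a.
    by rewrite -aE; apply: fd; rewrite ?(ltW (andP h1).1) ?(ltW (andP h1).2) ?(ltW (andP h2).1) ?(ltW (andP h2).2).
  have [r r0 H] := Hd 1 ltr01.
  apply: (@goursat_punctured _ q _ _ _ _ (Re a) (Im a) (1 + cmod d) r) => //.
    move=> x y hx hy; rewrite aE -subr_eq0 => xy.
    apply: diffableM; first by apply: diffableB; exact: fd.
    by have := @diffable_subV a 1 _ xy; under eq_fun do rewrite expr1.
  move=> z; rewrite aE -subr_eq0 => za zr.
  rewrite /q cmodM cmodV ler_pdivrMr ?cmod_gt0//.
  have {H} := H _ zr; rewrite mul1r (_ : a + (z - a) = z); last by ring.
  move=> H; rewrite -(subrK (d * (z - a)) (f z - f a)) (le_trans (cmodD _ _))//.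
  by rewrite mulrDl mul1r cmodM lerD2r.
have fb := on_square_boundary s0 fd.
have <- : oint s (fun z => q z + f a * (z - a)^-1) = oint s (fun z => f z * (z - a)^-1).
  by apply: eq_oint => // z _; rewrite /q; ring.
rewrite ointD ?q0 ?add0r ?ointZ//.
  apply: boundaryM => //.
  by apply: on_boundary_imp fb => z; exact: diffableB.
by apply: boundaryM => //; exact: boundaryC.
Qed.

Lemma geom_expansion a z m : z != 0 -> z - a != 0 ->
  (z - a)^-1 = \sum_(n < m) a ^+ n * z^-1 ^+ n.+1 + a ^+ m * (z^-1 ^+ m * (z - a)^-1).
Proof.
move=> z0 za; elim: m => [|m IH]; first by rewrite big_ord0 !expr0 !mul1r add0r.
rewrite big_ord_recr/= {1}IH -addrA; congr (_ + _).
rewrite !exprS; move: (a ^+ m) (z^-1 ^+ m) => u v.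
by field; rewrite z0 za.
Qed.

Lemma oint_powV s n : 0 < s -> oint s (fun z => z^-1 ^+ n.+2) = 0.
Proof.
move=> s0.
have n0 : - n.+1%:R != 0 :> C by rewrite oppr_eq0 pnatr_eq0.
have H : on_sides s (fun z => z != 0).
  apply: on_boundary_imp (boundary_cmod s0) => z /andP[zs _].
  by rewrite -cmod_gt0 (lt_le_trans s0).
apply: (@rect_primitive _ _ (fun z => (- n.+1%:R)^-1 * z^-1 ^+ n.+1)).
- by clear -s0; lra.
- by clear -s0; lra.
- apply: on_boundary_imp H => z z0; apply: diffable_ccont; apply: diffableX.
  by apply: (@diffable_inv _ id) => //; exact: diffable_id.
- apply: on_boundary_imp H => z z0.
  apply: (cderiv_eq (cderivM (cderivC _ _) (cderivVX n.+1 z0))).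
  by rewrite mul0r add0r mulrA mulVf// mul1r.
Qed.

Lemma le_cmod0 (x : C) (K th : R) : 0 <= th < 1 ->
  (forall m, cmod x <= K * th ^+ m.+1) -> x = 0.
Proof.
move=> /andP[th0 th1] H; apply/eqP; rewrite -cmod_eq0 eq_le cmod_ge0 andbT.
have C : (fun m => (K * th) * th ^+ m) @ \oo --> 0.
  by apply: cvg_geometric; rewrite ger0_norm.
rewrite -(cvg_lim (@Rhausdorff R) C); apply: limr_ge; first by apply/cvg_ex; exists 0.
by apply: nearW => m; rewrite -mulrA -exprS; exact: H.
Qed.

(* The value is 2 i pi, but only [kappa s != 0] is needed. *)
Definition kappa s := oint s (fun z : C => z^-1).

Lemma boundary_bounded f s : 0 < s -> on_sides s (diffable f) ->
  exists M, 0 <= M /\ on_sides s (fun z => cmod (f z) <= M).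
Proof.
move=> s0 fb; have ss : - s <= s by clear -s0; lra.
have B (g : R -> C) : (rcont_on g (- s) s) -> exists M, forall t, - s <= t <= s -> cmod (g t) <= M.
  move=> /rcont_within[c1 c2].
  have [M1 [_ H1]] := compact_bounded (continuous_compact c1 (@segment_compact R (- s) s)).
  have [M2 [_ H2]] := compact_bounded (continuous_compact c2 (@segment_compact R (- s) s)).
  exists ((M1 + 1) + (M2 + 1)) => t tt; rewrite (le_trans (cmod_le_ReIm _))// lerD//.
    by apply: H1; rewrite ?ltrDl//; exists t => //=; rewrite in_itv.
  by apply: H2; rewrite ?ltrDl//; exists t => //=; rewrite in_itv.
have [b1 b2 b3 b4] := fb.
have [M1 H1] := B _ (fun t tt => ccont_hline (diffable_ccont (b1 t tt))).
have [M2 H2] := B _ (fun t tt => ccont_hline (diffable_ccont (b2 t tt))).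
have [M3 H3] := B _ (fun t tt => ccont_vline (diffable_ccont (b3 t tt))).
have [M4 H4] := B _ (fun t tt => ccont_vline (diffable_ccont (b4 t tt))).
exists (`|M1| + `|M2| + `|M3| + `|M4|); split; first by rewrite !addr_ge0.
have := ler_norm M1; have := ler_norm M2; have := ler_norm M3; have := ler_norm M4.
have := normr_ge0 M1; have := normr_ge0 M2; have := normr_ge0 M3; have := normr_ge0 M4.
move: `|M1| `|M2| `|M3| `|M4| => N1 N2 N3 N4 *.
by split => t tt; [apply: le_trans (H1 t tt) _|apply: le_trans (H2 t tt) _
  |apply: le_trans (H3 t tt) _|apply: le_trans (H4 t tt) _]; lra.
Qed.

(** On the contour $|z| \ge s$ and $|z-a| \ge s-r$, so the kernel is at most $(r/s)^m/(s-r)$. [K]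
    collects the bound of [f] and the length of the contour, and is independent of [r], [a] and
    [m]. *)
Lemma oint_remainder f s : 0 < s -> on_square s (diffable f) -> exists K, 0 <= K /\
  forall r a m, cmod a <= r -> r < s ->
    cmod (oint s (fun z => f z * (a ^+ m * (z^-1 ^+ m * (z - a)^-1)))) <= K / (s - r) * (r / s) ^+ m.
Proof.
move=> s0 fd; have fb := on_square_boundary s0 fd.
have ss : - s <= s by clear -s0; lra.
have [M [M0 HM]] := boundary_bounded s0 fb.
exists (16 * M * s); split; first by rewrite !mulr_ge0// ltW.
move=> r a m ar rs; have h : cmod a < s by exact: le_lt_trans rs.
have d0 : 0 < s - r by rewrite subr_gt0.
rewrite (_ : 16 * M * s / (s - r) * (r / s) ^+ m = 4 * (M * ((r / s) ^+ m / (s - r))) * ((s - - s) + (s - - s)));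
  last first.
  by move: ((r / s) ^+ m) => u; field; rewrite gt_eqF.
apply: rect_bound => //.
  apply: on_boundary_imp (on_boundary_and fb (boundary_cmod s0)) => z [fz /andP[zs _]].
  apply: diffable_ccont; apply: diffableM => //; apply: diffableM; first exact: diffableC.
  apply: diffableM.
    apply: diffableX; apply: (@diffable_inv _ id); last exact: diffable_id.
    by rewrite /= -cmod_gt0 (lt_le_trans s0).
  apply: (@diffable_inv _ (fun w => w - a)); first exact: boundary_sub_neq0 h zs.
  by apply: diffableB; exact: diffable_id.
apply: on_boundary_imp (on_boundary_and HM (boundary_cmod s0)) => z [fz /andP[zs _]].
rewrite !cmodM; apply: ler_pM => //; rewrite ?cmod_ge0 ?mulr_ge0 ?cmod_ge0//.
rewrite mulrA -cmodM -exprMn cmodX cmodM cmodV; apply: ler_pM; rewrite ?exprn_ge0 ?mulr_ge0 ?cmod_ge0//.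
  by rewrite invr_ge0 cmod_ge0.
  apply: lerXn2r; rewrite ?nnegrE ?mulr_ge0 ?cmod_ge0 ?invr_ge0 ?cmod_ge0 ?(ltW s0)//.
    exact: le_trans (cmod_ge0 _) ar.
  apply: ler_pM; rewrite ?cmod_ge0 ?invr_ge0 ?cmod_ge0//.
  by rewrite lef_pV2// posrE// (lt_le_trans s0).
rewrite cmodV lef_pV2 ?posrE//; last by rewrite (lt_le_trans d0)// (le_trans _ (cmod_dist _ _))// lerB.
by rewrite (le_trans _ (cmod_dist _ _))// lerB.
Qed.

Lemma oint_expand f s a m : cmod a < s -> on_square s (diffable f) ->
  oint s (fun z => f z * (z - a)^-1) =
  \sum_(n < m) oint s (fun z => f z * z^-1 ^+ n.+1) * a ^+ n
  + oint s (fun z => f z * (a ^+ m * (z^-1 ^+ m * (z - a)^-1))).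
Proof.
move=> h fd; have s0 : 0 < s by apply: le_lt_trans h; exact: cmod_ge0.
have fb := on_square_boundary s0 fd.
have V1 : on_sides s (diffable (fun z => (z - a)^-1)).
  by have := boundary_subV 1 h; under eq_fun do rewrite expr1.
have V n : on_sides s (diffable (fun z => z^-1 ^+ n)).
  have := @boundary_subV s 0 n; rewrite cmod0 => /(_ s0).
  by under eq_fun do rewrite subr0.
have W n : on_sides s (diffable (fun z => f z * z^-1 ^+ n.+1)).
  by apply: boundaryM.
rewrite (@eq_oint _ s _ (fun z => \sum_(n < m) (a ^+ n * (f z * z^-1 ^+ n.+1)) +
   f z * (a ^+ m * (z^-1 ^+ m * (z - a)^-1))))//; last first.
  move=> z /andP[zs _]; rewrite {1}(@geom_expansion a z m); last 2 first.
  - by rewrite -cmod_gt0 (lt_le_trans s0).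
  - exact: boundary_sub_neq0 h zs.
  by rewrite mulrDr mulr_sumr; congr (_ + _); apply: eq_bigr => n _; rewrite mulrCA.
rewrite ointD; last 2 first.
- have B n : on_sides s (diffable (fun z => a ^+ n * (f z * z^-1 ^+ n.+1))).
    by apply: boundaryM => //; exact: boundaryC.
  by split => t tt; apply: (@diffable_sum _ (fun n z => a ^+ n * (f z * z^-1 ^+ n.+1))) => n _;
    case: (B n) => [b1 b2 b3 b4]; auto.
- by apply: boundaryM => //; apply: boundaryM; [exact: boundaryC|exact: boundaryM].
congr (_ + _); rewrite (@oint_sum _ _ (fun n z => a ^+ n * (f z * z^-1 ^+ n.+1))); last first.
  by move=> n _; apply: boundaryM => //; exact: boundaryC.
by apply: eq_bigr => n _; rewrite ointZ// mulrC.
Qed.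

(** In the geometric expansion of $1/(z-a)$ every term but the first integrates to 0 by [oint_powV],
    and the remainder tends to 0. *)
Lemma oint_kappa s a : cmod a < s -> oint s (fun z => (z - a)^-1) = kappa s.
Proof.
move=> h; have s0 : 0 < s by apply: le_lt_trans h; exact: cmod_ge0.
have d1 : on_square s (diffable (fun=> 1 : C)) by move=> *; exact: diffableC.
have [K [K0 HK]] := oint_remainder s0 d1.
apply/eqP; rewrite -subr_eq0; apply/eqP.
apply: (@le_cmod0 _ (K / (s - cmod a)) (cmod a / s)).
  by rewrite divr_ge0 ?cmod_ge0 ?(ltW s0)//= ltr_pdivrMr// mul1r.
move=> m; apply: le_trans (HK _ a m.+1 (lexx _) h).
rewrite le_eqVlt; apply/orP; left; apply/eqP; congr cmod.
have := oint_expand m.+1 h d1.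
rewrite (@eq_oint _ s (fun z => 1 * (z - a)^-1) (fun z => (z - a)^-1))//; last first.
  by move=> z _; rewrite mul1r.
move=> ->; rewrite big_ord_recl expr0 mulr1 big1 ?addr0; last first.
  move=> n _; rewrite (@eq_oint _ s _ (fun z => z^-1 ^+ n.+2))//; last by move=> z _; rewrite mul1r.
  by rewrite oint_powV// mul0r.
rewrite (@eq_oint _ s (fun z => 1 * z^-1 ^+ _) (fun z => z^-1))//; last by move=> z _; rewrite mul1r expr1.
by rewrite addrC addKr.
Qed.

Lemma seg_Re_ge (f : R -> C) (a b m : R) : a <= b -> rcont_on f a b ->
  (forall t, a <= t <= b -> m <= Re (f t)) -> m * (b - a) <= Re (seg f a b).
Proof.
move=> ab fab fm; have [i1 _] := rcont_integrable fab.
have -> : m * (b - a) = \int[@lebesgue_measure R]_(t in `[a, b]) m.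
  rewrite Rintegral_cst; last exact: measurable_itv.
  congr (_ * _); rewrite [X in fine X](@lebesgue_measure_itv R `[a, b])/= lte_fin.
  by case: ltP => [//|ba]; rewrite (@le_anti _ _ a b) ?ab// subrr.
apply: le_Rintegral => //.
by apply: continuous_compact_integrable; [exact: segment_compact|move=> ?; exact: cvg_cst].
Qed.

(** After multiplication by $-i$, the integrand on each side, tangent factor included, has real part
    $s/(t^2+s^2) \ge 1/(2s)$. Each side has length $2s$ and so contributes at least 1 to the real
    part. *)
Lemma kappa_neq0 s : 0 < s -> kappa s != 0.
Proof.
move=> s0; have ss : - s <= s by clear -s0; lra.
have s2 : 0 < 2 * s ^+ 2 by rewrite mulr_gt0// exprn_gt0.
have [b1 b2 b3 b4] : on_sides s (ccont (fun z : C => z^-1)).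
  apply: on_boundary_imp (boundary_cmod s0) => z /andP[zs _].
  apply: diffable_ccont; apply: (@diffable_inv _ id); last exact: diffable_id.
  by rewrite /= -cmod_gt0 (lt_le_trans s0).
have P (f : R -> C) (u : C) : rcont_on f (- s) s ->
    (forall t, - s <= t <= s -> Re (u * f t) = s / (t ^+ 2 + s ^+ 2)) ->
    1 <= Re (u * seg f (- s) s).
  move=> fc fu; rewrite -segZ//.
  have -> : 1 = s / (2 * s ^+ 2) * (s - - s) by field; rewrite gt_eqF.
  apply: seg_Re_ge => //.
    move=> t tt e e0; have k0 : 0 < 1 + cmod u by rewrite ltr_wpDr ?cmod_ge0.
    have [r r0 H] := fc t tt _ (divr_gt0 e0 k0).
    exists r => // h /H; rewrite -mulrBr cmodM ler_pdivlMr// => Hh.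
    by apply: le_trans Hh; rewrite mulrC ler_wpM2l ?cmod_ge0// lerDr.
  move=> t tt; rewrite fu// ler_pM2l// lef_pV2 ?posrE//; last first.
    by rewrite ltr_wpDl ?sqr_ge0// exprn_gt0.
  rewrite mulr_natl mulr2n lerD2r -(real_normK (num_real t)) lerXn2r ?nnegrE ?(ltW s0)//.
  by rewrite ler_norml.
have ns2 t : s ^+ 2 + t ^+ 2 = t ^+ 2 + s ^+ 2 by rewrite addrC.
apply/eqP => k0; have : 0 < Re ((- 'i) * kappa s); last by rewrite k0 mulr0 ltxx.
have p1 := P _ (- 'i) (fun t tt => ccont_hline (b1 t tt)).
have p2 := P _ 1 (fun t tt => ccont_vline (b4 t tt)).
have p3 := P _ 'i (fun t tt => ccont_hline (b2 t tt)).
have p4 := P _ (-1) (fun t tt => ccont_vline (b3 t tt)).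
have -> : - 'i * kappa s = - 'i * seg (fun t => (t +i* (- s))^-1) (- s) s
   + 1 * seg (fun t => (s +i* t)^-1) (- s) s + 'i * seg (fun t => (t +i* s)^-1) (- s) s
   + (-1) * seg (fun t => ((- s) +i* t)^-1) (- s) s.
  rewrite /kappa /oint /rect; have := sqr_i R.
  move: (seg _ _ _) (seg _ _ _) (seg _ _ _) (seg _ _ _) => a b c d.
  rewrite expr2 => ii; rewrite !mulrBr mulrDr !mulrA !mulNr ii; ring.
rewrite !cReD.
apply: (@lt_le_trans _ _ (1 + 1 + 1 + 1)) => //; rewrite !lerD//.
- by apply: p1 => t _; rewrite /= sqrrN; ring.
- by apply: p2 => t _; rewrite /= ns2; ring.
- by apply: p3 => t _; rewrite /=; ring.
- by apply: p4 => t _; rewrite /= sqrrN ns2; ring.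
Qed.

(** The coefficients are the Cauchy integrals and do not depend on [r]; the convergence is geometric
    of ratio $r/s$, uniformly on $|a| \le r$. *)
Theorem power_expansion f s : 0 < s -> on_square s (diffable f) ->
  exists c : nat -> C, forall r : R, 0 <= r < s -> exists K th : R, [/\ 0 <= th < 1, 0 <= K &
    forall m a, cmod a <= r -> cmod (f a - \sum_(n < m) c n * a ^+ n) <= K * th ^+ m].
Proof.
move=> s0 fd; have [K [K0 HK]] := oint_remainder s0 fd.
exists (fun n => (kappa s)^-1 * oint s (fun z => f z * z^-1 ^+ n.+1)) => r /andP[r0 rs].
exists (cmod (kappa s)^-1 * (K / (s - r))), (r / s); split.
- by rewrite divr_ge0 ?(ltW s0)//= ltr_pdivrMr// mul1r.
- by rewrite mulr_ge0 ?cmod_ge0// divr_ge0// ltW// subr_gt0.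
move=> m a ar; have h : cmod a < s by exact: le_lt_trans rs.
have := cauchy_formula h fd; rewrite (oint_kappa h) (oint_expand m h fd) => /esym E.
have k0 := kappa_neq0 s0.
rewrite (_ : f a - _ = (kappa s)^-1 * oint s (fun z => f z * (a ^+ m * (z^-1 ^+ m * (z - a)^-1)))).
  by rewrite cmodM -mulrA ler_wpM2l ?cmod_ge0// HK.
set S := \sum_(n < m) _ in E; set T := oint _ _ in E *.
have -> : T = f a * kappa s - S by rewrite E addrC addKr.
rewrite mulrBr mulrCA mulVf// mulr1; congr (_ - _).
by rewrite mulr_sumr; apply: eq_bigr => n _; rewrite mulrA.
Qed.

End CauchyExpansion.

(** * Expansion of log|g| *)

Section LogExpansion.
Variable R : realType.
Local Notation C := R[i].
Implicit Types (f g : C -> C) (z w a : C).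

Lemma oint_kernel_lin (s : R) g a b p p' q (u v : C) : cmod a < s -> cmod b < s ->
  on_sides s (diffable g) ->
  oint s (fun z => g z * (z - b)^-1 ^+ p) + u * oint s (fun z => g z * (z - a)^-1 ^+ p')
    + v * oint s (fun z => g z * (z - a)^-1 ^+ q)
  = oint s (fun z => g z * ((z - b)^-1 ^+ p + u * (z - a)^-1 ^+ p' + v * (z - a)^-1 ^+ q)).
Proof.
move=> ha hb gb; have B a' n : cmod a' < s ->
    on_sides s (diffable (fun z => g z * (z - a')^-1 ^+ n)).
  by move=> h; apply: boundaryM => //; exact: boundary_subV.
have BC (c : C) f : on_sides s (diffable f) ->
    on_sides s (diffable (fun z => c * f z)).
  by move=> fb; apply: boundaryM => //; exact: boundaryC.
have BD f f' : on_sides s (diffable f) ->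
   on_sides s (diffable f') ->
   on_sides s (diffable (fun z => f z + f' z)).
  by move=> F F'; apply: on_boundary_imp (on_boundary_and F F') => z []; exact: diffableD.
have s0 : 0 < s by apply: le_lt_trans ha; exact: cmod_ge0.
rewrite -!ointZ; [|exact: B|exact: B].
rewrite -ointD; [|exact: B|by apply: BC; exact: B].
rewrite -ointD; [|apply: BD; [exact: B|apply: BC; exact: B]|by apply: BC; exact: B].
by apply: eq_oint => // z _; ring.
Qed.

(** The second-order Taylor remainder of $1/(w-h)$ in $h$; the next lemma does the same for
    $1/(w-h)^2$. The coefficients $-1$ and $-h$ are spelled out to fit [oint_kernel_lin]. *)
Lemma kernel1 w (h : C) (d : R) : 0 < d -> d <= cmod w -> cmod h <= d / 2 ->
  cmod ((w - h)^-1 + (- 1) * w^-1 + (- h) * w^-1 ^+ 2) <= 2 / d ^+ 3 * cmod h ^+ 2.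
Proof.
move=> d0 dw hd; have wh : d / 2 <= cmod (w - h).
  by apply: le_trans (cmod_dist _ _); clear -dw hd; lra.
have d2 : 0 < d / 2 by rewrite divr_gt0.
have w0 : w != 0 by rewrite -cmod_gt0 (lt_le_trans d0).
have wh0 : w - h != 0 by rewrite -cmod_gt0 (lt_le_trans d2).
have -> : (w - h)^-1 + (- 1) * w^-1 + (- h) * w^-1 ^+ 2 = (w^-1 ^+ 2 * (w - h)^-1) * h ^+ 2.
  by field; rewrite w0 wh0.
rewrite cmodM cmodX ler_wpM2r ?sqr_ge0// cmodM cmodX !cmodV.
have -> : 2 / d ^+ 3 = d^-1 ^+ 2 * (d / 2)^-1 by field; rewrite gt_eqF.
have dp : 0 < cmod w by exact: lt_le_trans dw.
have dhp : 0 < cmod (w - h) by exact: lt_le_trans wh.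
apply: ler_pM; rewrite ?sqr_ge0 ?invr_ge0 ?cmod_ge0//; last by rewrite lef_pV2 ?posrE.
by rewrite lerXn2r ?nnegrE ?invr_ge0 ?cmod_ge0 ?(ltW d0)// lef_pV2 ?posrE.
Qed.

Lemma kernel2 w (h : C) (d : R) : 0 < d -> d <= cmod w -> cmod h <= d / 2 ->
  cmod ((w - h)^-1 ^+ 2 + (- 1) * w^-1 ^+ 2 + (- (2 * h)) * w^-1 ^+ 3) <= 16 / d ^+ 4 * cmod h ^+ 2.
Proof.
move=> d0 dw hd; have wh : d / 2 <= cmod (w - h).
  by apply: le_trans (cmod_dist _ _); clear -dw hd; lra.
have d2 : 0 < d / 2 by rewrite divr_gt0.
have w0 : w != 0 by rewrite -cmod_gt0 (lt_le_trans d0).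
have wh0 : w - h != 0 by rewrite -cmod_gt0 (lt_le_trans d2).
have -> : (w - h)^-1 ^+ 2 + (- 1) * w^-1 ^+ 2 + (- (2 * h)) * w^-1 ^+ 3 =
    ((3 + (-2) * (h * w^-1)) * (w^-1 ^+ 2 * (w - h)^-1 ^+ 2)) * h ^+ 2.
  by field; rewrite w0 wh0.
rewrite cmodM cmodX ler_wpM2r ?sqr_ge0// cmodM.
have -> : 16 / d ^+ 4 = 4 * (d^-1 ^+ 2 * (d / 2)^-1 ^+ 2) by field; rewrite gt_eqF.
have dp : 0 < cmod w by exact: lt_le_trans dw.
have dhp : 0 < cmod (w - h) by exact: lt_le_trans wh.
apply: ler_pM; rewrite ?cmod_ge0//.
  have n3 : cmod (3 : C) = 3 by rewrite -(rmorph_nat (real_complex R) 3) cmodR ger0_norm.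
  have n2 : cmod (-2 : C) = 2 by rewrite cmodN -(rmorph_nat (real_complex R) 2) cmodR ger0_norm.
  apply: (le_trans (cmodD _ _)); rewrite !cmodM n3 n2 cmodV.
  have : cmod h / cmod w <= 2^-1 by rewrite ler_pdivrMr//; clear -hd dw d0; lra.
  by clear; lra.
rewrite cmodM !cmodX !cmodV.
apply: ler_pM; rewrite ?sqr_ge0 ?invr_ge0 ?cmod_ge0//.
  by rewrite lerXn2r ?nnegrE ?invr_ge0 ?cmod_ge0 ?(ltW d0)// lef_pV2 ?posrE.
by rewrite lerXn2r ?nnegrE ?invr_ge0 ?cmod_ge0 ?(ltW d2)// lef_pV2 ?posrE.
Qed.

(** Differentiation under the integral sign: a quadratic bound on the Taylor remainder of the
    kernel, uniform on the contour, passes to the integral. It serves with $t = p = 1$ and $t = p =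
    2$. *)
Lemma cderiv_cauchy_kernel G a (p : nat) (t K : R) (k := fun n b => oint 1 (fun z => G z * (z - b)^-1 ^+ n)) :
  cmod a < 1 -> on_boundary (- 1) 1 (- 1) 1 (diffable G) ->
  (forall w h, 1 - cmod a <= cmod w -> cmod h <= (1 - cmod a) / 2 ->
    cmod ((w - h)^-1 ^+ p + (- 1) * w^-1 ^+ p + (- (t%:C * h)) * w^-1 ^+ p.+1) <= K * cmod h ^+ 2) ->
  cderiv (k p) a (t%:C * k p.+1 a).
Proof.
move=> a1 gb HK; have [M [M0 HM]] := boundary_bounded ltr01 gb.
have d0 : 0 < 1 - cmod a by rewrite subr_gt0.
apply: (@cderiv_quad _ _ _ _ (16 * (M * K)) ((1 - cmod a) / 2)); first by rewrite divr_gt0.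
move=> h hh; have ah : cmod (a + h) < 1 by apply: (le_lt_trans (cmodD _ _)); clear -hh d0; lra.
have E (x y z : C) : x - y - t%:C * z * h = x + (-1) * y + (- (t%:C * h)) * z by ring.
rewrite E /k (oint_kernel_lin _ _ _ _ _ a1 ah gb).
rewrite (_ : _ * cmod h ^+ 2 = 16 * (M * (K * cmod h ^+ 2)) * 1); last by ring.
apply: oint_bound => //.
  apply: boundaryM => //; have B1 := boundary_subV p ah; have B2 := boundary_subV p a1.
  have B3 := boundary_subV p.+1 a1; have Bc c := @boundaryC R 1 c.
  have B := on_boundary_and B1 (on_boundary_and (boundaryM (Bc (-1)) B2) (boundaryM (Bc (- (t%:C * h))) B3)).
  by apply: on_boundary_imp B => z [b1 [b2 b3]]; apply: diffableD => //; exact: diffableD.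
apply: on_boundary_imp (on_boundary_and HM (boundary_cmod ltr01)) => z [gz /andP[z1 _]].
rewrite cmodM; apply: ler_pM; rewrite ?cmod_ge0// opprD addrA; apply: HK; last exact: ltW.
by apply: le_trans (cmod_dist _ _); rewrite lerB.
Qed.

(** By Cauchy's formula $g(z_0 + a)$ is a constant multiple of [k 1 a]. Differentiating the integral
    once identifies [dg] with the same multiple of [k 2], by uniqueness of derivatives;
    differentiating again gives the claim. *)
Lemma diffable_derivative g dg : (forall z, cderiv g z (dg z)) -> forall z, diffable dg z.
Proof.
move=> Hg z0; pose G w := g (z0 + w).
have dG w : cderiv G w (dg (z0 + w)).
  apply: (cderiv_eq (@cderiv_chain _ g (fun w => z0 + w) w (0 + 1) _ _ (Hg _))); last by ring.
  by apply: cderivD; [exact: cderivC|exact: cderiv_id].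
have Gs : on_square 1 (diffable G) by move=> x y _ _; eexists; exact: dG.
have gb := on_square_boundary ltr01 Gs.
have k0 := @kappa_neq0 R 1 ltr01.
pose k p a := oint 1 (fun z => G z * (z - a)^-1 ^+ p).
have k1 a : cmod a < 1 -> cderiv (k 1%N) a (k 2%N a).
  move=> a1; have d0 : 0 < 1 - cmod a by rewrite subr_gt0.
  apply: (cderiv_eq (@cderiv_cauchy_kernel G a 1 1 _ a1 gb _)); last by rewrite mul1r.
  by move=> w h wd hd; rewrite expr1 mul1r; exact: kernel1 d0 wd hd.
have k2 : cderiv (k 2%N) 0 (2%:C * k 3%N 0).
  have z1 : cmod (0 : C) < 1 by rewrite cmod0.
  apply: (cderiv_cauchy_kernel (K := 16 / 1 ^+ 4) z1 gb) => w h.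
  by rewrite cmod0 subr0 rmorph_nat => wd hd; exact: kernel2.
have Gk a : cmod a < 1 -> G a = (kappa 1)^-1 * k 1%N a.
  move=> a1; have := cauchy_formula a1 Gs; rewrite oint_kappa// => E.
  by rewrite -[LHS](mulfK k0) -E mulrC.
have dk a : cmod a < 1 -> dg (z0 + a) = (kappa 1)^-1 * k 2%N a.
  move=> a1; apply: (cderiv_unique (dG a)).
  have d0 : 0 < 1 - cmod a by rewrite subr_gt0.
  apply: (@cderiv_near _ (fun a => (kappa 1)^-1 * k 1%N a) _ _ _ _ d0).
    by move=> h hh; rewrite Gk// (le_lt_trans (cmodD _ _))//; clear -hh; lra.
  by apply: (cderiv_eq (cderivM (cderivC _ _) (k1 a a1))); rewrite mul0r add0r.
have K : diffable (fun a => (kappa 1)^-1 * k 2%N a) 0.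
  by apply: diffableM; [exact: diffableC|exists (2%:C * k 3%N 0)].
have {K} [d' Hd] : diffable (fun a => dg (z0 + a)) 0.
  case: K => d' Hd; exists d'; apply: cderiv_near ltr01 _ Hd => h.
  by rewrite add0r => /dk ->.
exists d' => e /Hd[r r0 H]; exists r => // h /H.
by rewrite add0r addr0.
Qed.

Definition logmod z : R := 2^-1 * ln (Re z ^+ 2 + Im z ^+ 2).

Lemma logmodE z : logmod z = ln (cmod z).
Proof.
have [->|z0] := eqVneq z 0.
  by rewrite /logmod cmod0/= expr0n/= addr0 ln0// mulr0.
rewrite /logmod -cmod_sqr lnXn ?cmod_gt0//.
by move: (ln _) => l; field.
Qed.

Lemma is_derive_logmod (F : R -> C) (t : R) (d : C) : F t != 0 -> rderiv F t d ->
  is_derive t 1 (fun s => logmod (F s)) (Re (d / F t)).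
Proof.
move=> F0 Fd; have [dR dI] := (rderiv_Re Fd, rderiv_Im Fd).
have n0 : 0 < Re (F t) ^+ 2 + Im (F t) ^+ 2 by rewrite -cmod_sqr exprn_gt0// cmod_gt0.
have dn : is_derive t 1 (fun s => Re (F s) ^+ 2 + Im (F s) ^+ 2)
    (2 * Re (F t) * Re d + 2 * Im (F t) * Im d).
  have := is_deriveD (@is_deriveX _ _ _ 2 _ _ _ dR) (@is_deriveX _ _ _ 2 _ _ _ dI).
  by rewrite /GRing.scale/= !expr1.
have dl := @is_derive1_comp _ (@ln R) _ t _ _ (is_derive1_ln n0) dn.
have D : is_derive t 1 (fun s => logmod (F s)) _ := is_deriveZ (2^-1) dl.
apply: (is_derive_eq D); rewrite /GRing.scale/=.
rewrite cReM; case: (F t) n0 => x y /= n0; field; exact: lt0r_neq0.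
Qed.

(* Harmonicity of [H] on the unit disc is used only in this form, as the real part
   of a power series converging uniformly on smaller discs. *)
Definition uexp (H : C -> R) (c : nat -> C) := forall r : R, 0 <= r < 1 ->
  forall e : R, 0 < e -> exists m0 : nat, forall m w, (m0 <= m)%N -> cmod w <= r ->
  `|H w - Re (\sum_(n < m) c n * w ^+ n)| <= e.

Definition hexp (h : C -> R) a (s : R) (c : nat -> C) :=
  uexp (fun w => h (a + s%:C * w)) c.

(* [log |g|] is the real part of the primitive of [g' / g] along radii. *)
Lemma log_expansion g a (rho : R) : 0 < rho -> (forall z, diffable g z) ->
  (forall w, cmod w <= 2 * rho -> g (a + w) != 0) ->
  exists c, hexp (fun z => logmod (g z)) a rho c.
Proof.
move=> rho0 /choice[dg Hg] gN0; have dgd := diffable_derivative Hg.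
pose T w := a + rho%:C * w.
have dT w : cderiv T w rho%:C.
  apply: (cderiv_eq (cderivD (cderivC a w) (cderivM (cderivC rho%:C w) (cderiv_id w)))).
  by ring.
have TN0 w : cmod w <= 2 -> g (T w) != 0.
  by move=> w2; apply: gN0; rewrite cmodM cmodR gtr0_norm// mulrC ler_wpM2r// ltW.
pose q w := rho%:C * dg (T w) * (g (T w))^-1.
(* The unit square is contained in $|w| \le 2$; this is why [g] is assumed nonzero up to the radius
   $2\rho$. *)
have qd : on_square 1 (diffable q).
  move=> x y /andP[x1 x2] /andP[y1 y2].
  have z2 : cmod (x +i* y) <= 2.
    by rewrite (le_trans (cmod_le_ReIm _))//= (_ : 2 = 1 + 1)// lerD// ler_norml; apply/andP.
  apply: diffableM.
    apply: diffableM; first exact: diffableC.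
    by apply: diffable_comp; [exists rho%:C; exact: dT|exact: dgd].
  apply: (@diffable_inv _ (fun w => g (T w))); first exact: TN0.
  by apply: diffable_comp; [exists rho%:C; exact: dT|eexists; exact: Hg].
have [b Hb] := power_expansion ltr01 qd.
(* Termwise primitive of the series of [q], with constant term $\log|g(a)|$. *)
exists (fun n => if n is k.+1 then b k / k.+1%:R else (logmod (g a))%:C).
move=> r r1 e e0; have [K [th [th1 K0 H]]] := Hb r r1.
have [m0 Hm0] : exists m0, forall m, (m0 <= m)%N -> K * th ^+ m <= e.
  have : (fun m => K * th ^+ m) @ \oo --> 0.
    by apply: cvg_geometric; rewrite ger0_norm; case/andP: th1.
  move/cvgrPdist_le => /(_ e e0)[m0 _ Hm]; exists m0 => m /Hm.
  by rewrite /= sub0r normrN; apply: le_trans; exact: ler_norm.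
exists m0.+1 => -[//|m] w mm wr; have {mm} mm : (m0 <= m)%N by [].
rewrite big_ord_recl/= expr0 mulr1 cReD/= opprD addrA.
pose P z : C := \sum_(n < m) b n / n.+1%:R * z ^+ n.+1.
pose p z : C := \sum_(n < m) b n * z ^+ n.
rewrite (_ : \sum_(i < m) _ = P w); last by apply: eq_bigr.
have dP z : cderiv P z (p z).
  rewrite /P /p; elim: m {mm P p} => [|m IH].
    by rewrite big_ord0; under [X in cderiv X]eq_fun do rewrite big_ord0; exact: cderivC.
  rewrite big_ord_recr/=; under [X in cderiv X]eq_fun do rewrite big_ord_recr/=.
  have dX n : cderiv (fun w : C => w ^+ n.+1) z (n.+1%:R * z ^+ n).
    elim: n => [|n IHn].
      under [X in cderiv X]eq_fun do rewrite expr1.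
      by rewrite expr0 mulr1; exact: cderiv_id.
    under [X in cderiv X]eq_fun do rewrite exprSr.
    apply: (cderiv_eq (cderivM IHn (cderiv_id z))).
    by rewrite -[in RHS]natr1 !exprSr mulr1; ring.
  apply: (cderiv_eq (cderivD IH (cderivM (cderivC _ _) (dX m)))); congr (_ + _).
  by rewrite mul0r add0r mulrA divfK// pnatr_eq0.
have r2 : r <= 2 by case/andP: r1 => _ r1; rewrite (le_trans (ltW r1))// ler1n.
(* The derivative of [psi] is the real part of $(q - p) w$, so the mean value theorem on $[0, 1]$
   turns the error of the partial sum [p] of [q] into the error for the logarithm. *)
pose psi (t : R) := logmod (g (T (0 + t%:C * w))) - Re (P (0 + t%:C * w)).
have cw (t : R) : 0 <= t <= 1 -> cmod (0 + t%:C * w) <= r.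
  move=> /andP[t0 t1]; rewrite add0r cmodM cmodR ger0_norm//.
  by apply: le_trans wr; rewrite ler_piMl// cmod_ge0.
have psid (t : R) : 0 <= t <= 1 ->
    is_derive t 1 psi (Re ((q (0 + t%:C * w) - p (0 + t%:C * w)) * w)).
  move=> tt; have G0 : g (T (0 + t%:C * w)) != 0 by apply: TN0; exact: le_trans (cw t tt) r2.
  have D1 : rderiv (fun t => g (T (0 + t%:C * w))) t (dg (T (0 + t%:C * w)) * rho%:C * w).
    exact: (@cderiv_comp _ (fun z => g (T z)) 0 w t _ (cderiv_chain (dT _) (Hg _))).
  have D2 : rderiv (fun t => P (0 + t%:C * w)) t (p (0 + t%:C * w) * w).
    exact: (@cderiv_comp _ P 0 w t).
  have D : is_derive t 1 psi _ := is_deriveB (is_derive_logmod G0 D1) (rderiv_Re D2).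
  apply: (is_derive_eq D); rewrite -cReB; congr Re; rewrite /q.
  by field.
have [||t tt] := @MVT_segment R psi (fun t => Re ((q (0 + t%:C * w) - p (0 + t%:C * w)) * w)) 0 1 ler01.
- by move=> t; rewrite in_itv/= => /andP[t0 t1]; apply: psid; rewrite !ltW.
- apply: continuous_in_subspaceT => t; rewrite inE/= in_itv/= => tt.
  apply: differentiable_continuous; apply/derivable1_diffP.
  by have [] := psid t tt.
rewrite subr0 mulr1 /psi !mul0r !add0r mul1r /T mulr0 addr0.
rewrite [P 0](_ : _ = 0); last by apply: big1 => n _; rewrite expr0n mulr0.
rewrite subr0 (_ : _ - _ - _ = logmod (g (a + rho%:C * w)) - logmod (g a) - Re (P w)); last by ring.
move=> ->; apply: (le_trans (Re_le_cmod _)); rewrite cmodM.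
move: tt; rewrite in_itv/= => tt; have := H m _ (cw t tt); rewrite add0r => Ht.
have w1 : cmod w <= 1 by case/andP: r1 => _ r1; exact: le_trans wr (ltW r1).
apply: le_trans (Hm0 _ mm); apply: le_trans Ht.
by rewrite ler_piMr ?cmod_ge0.
Qed.

End LogExpansion.

(** * Positive harmonic functions *)

Section PositiveHarmonic.
Variable R : realType.
Local Notation C := R[i].
Implicit Types (H : C -> R) (c : nat -> C) (z w : C).

(** [R[i]] is algebraically closed and $X^N - 1$ is separable, so there are $N$ distinct roots of
    unity, one of which is primitive. *)
Lemma prim_root_exists N : (0 < N)%N -> exists z : C, N.-primitive_root z.
Proof.
pose p : {poly C} := 'X^N - 1; have [r Dp] := closed_field_poly_normal p.
move=> N0; rewrite (monicP _) ?monicXnsubC // scale1r in Dp.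
have rn1 : all N.-unity_root r by apply/allP=> z; rewrite -root_prod_XsubC -Dp.
have sz_r : (N < (size r).+1)%N.
  by rewrite -(size_prod_XsubC r id) -Dp size_XnsubC.
have [|z] := hasP (cyclic.has_prim_root N0 rn1 _ sz_r); last by exists z.
by rewrite -separable_prod_XsubC -Dp separable_Xn_sub_1 // pnatr_eq0 -lt0n.
Qed.

Lemma sum_prim_root N (w : C) j : N.-primitive_root w -> ~~ (N %| j)%N ->
  \sum_(l < N) w ^+ (l * j) = 0.
Proof.
move=> pw Nj; have w1 : w ^+ j != 1 by rewrite -(prim_order_dvd pw).
apply: (mulfI (_ : w ^+ j - 1 != 0)); first by rewrite subr_eq0.
rewrite mulr0; under eq_bigr do rewrite mulnC exprM.
by rewrite -subrX1 -exprM mulnC exprM (prim_expr_order pw) expr1n subrr.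
Qed.

Lemma cmod_prim_root N (w : C) : N.-primitive_root w -> cmod w = 1.
Proof.
move=> pw; have N0 := prim_order_gt0 pw.
have : cmod w ^+ N = 1 by rewrite -cmodX (prim_expr_order pw) cmod1.
by move=> /eqP; rewrite pexpr_eq1 ?cmod_ge0// => /eqP.
Qed.

Lemma conjc_unit z : cmod z = 1 -> z^* = z^-1.
Proof.
move=> z1; have z0 : z != 0 by rewrite -cmod_gt0 z1.
apply: (mulfI z0); rewrite mulfV//; have := cmod_sqr z; rewrite z1 expr1n.
case: z z1 z0 => x y /= _ _ E; apply/eqP; rewrite eq_complex/=; apply/andP; split; apply/eqP; last by ring.
by rewrite E; ring.
Qed.

(* The right-hand side is a limit of averages of [H >= 0] over the N-th roots of unity,
   against the weight [1 + Re (eta om^(l (n+1))) >= 0]. *)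
Lemma uexp_average H c (r : R) (eta : C) n : uexp H c -> (forall w, cmod w < 1 -> 0 <= H w) ->
  0 <= r < 1 -> cmod eta = 1 ->
  0 <= Re (c 0%N) + Re (c n.+1 * r%:C ^+ n.+1 * conjc eta) / 2.
Proof.
move=> Hc H0 r01 eta1; have [r0 r1] := andP r01.
apply/ler_addgt0Pl => e' e'0; pose e := - e'; rewrite -lerBlDl sub0r -/e.
have e0 : e < 0 by rewrite oppr_lt0.
have [|m0 Hm] := Hc r r01 (- e / 2); first by rewrite divr_gt0// oppr_gt0.
(* This choice prevents aliasing: for $k < m$, [N] divides $k$ only if $k = 0$, never divides $k + n
   + 1$, and divides $k + N - (n+1) = k + m$ only if $k = n + 1$. Also $m > n + 1$, so the
   coefficient of index $n + 1$ occurs in the partial sum. *)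
pose m := (m0 + n.+2)%N; pose N := (m + n.+1)%N.
have [om pom] : exists z : C, N.-primitive_root z by apply: prim_root_exists; rewrite /N addnS.
have om1 := cmod_prim_root pom.
have oml l : cmod (om ^+ l) = 1 by rewrite cmodX om1 expr1n.
pose P w := \sum_(k < m) c k * w ^+ k.
pose W l := 1 + Re (eta * om ^+ (l * n.+1)).
have Wb l : 0 <= W l <= 2.
  have : `|Re (eta * om ^+ (l * n.+1))| <= 1.
    by rewrite (le_trans (Re_le_cmod _))// cmodM eta1 oml mulr1.
  by rewrite ler_norml /W => /andP[? ?]; apply/andP; split; lra.
have cw l : cmod (r%:C * om ^+ l) = r by rewrite cmodM oml mulr1 cmodR ger0_norm.
(* The partial sum has real part at least $e/2$, where $e < 0$, and the weight lies in $[0, 2]$; so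
   each term is at least $e$. *)
have lowT : e * N%:R <= \sum_(l < N) Re (P (r%:C * om ^+ l)) * W l.
  rewrite mulr_natr -[X in _ *+ X]card_ord -sumr_const ler_sum// => l _.
  have := Hm m (r%:C * om ^+ l) (leq_addr _ _); rewrite cw lexx => /(_ isT).
  rewrite ler_norml => /andP[_ h2].
  have hp := H0 (r%:C * om ^+ l); rewrite cw in hp; have {}hp := hp r1.
  have [w1 w2] := andP (Wb l).
  have pe : e / 2 <= Re (P (r%:C * om ^+ l)) by rewrite /P; lra.
  have := ler_wpM2r w1 pe; have : 0 <= 2 - W l by rewrite subr_ge0.
  move=> /(mulr_le0_ge0 (ltW e0)); clear; lra.
have E : (\sum_(l < N) Re (P (r%:C * om ^+ l)) * W l) =
    N%:R * (Re (c 0%N) + Re (c n.+1 * r%:C ^+ n.+1 * conjc eta) / 2).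
  have WE l : (W l)%:C = 1 + (eta * om ^+ (l * n.+1) + conjc eta * om ^+ (l * (N - n.+1))) / 2.
    have -> : om ^+ (l * (N - n.+1)) = (om ^+ (l * n.+1))^-1.
      have om0 : om ^+ (l * n.+1) != 0 by rewrite -cmod_gt0 oml.
      apply: (mulfI om0); rewrite mulfV// -exprD -mulnDr subnKC; last by rewrite /N leq_addl.
      by rewrite mulnC exprM (prim_expr_order pom) expr1n.
    rewrite -conjc_unit; last exact: oml.
    by rewrite -rmorphM -ReJ_add -rmorphD.
  transitivity (Re (\sum_(l < N) P (r%:C * om ^+ l) * (W l)%:C)).
    by rewrite cRe_sum; apply: eq_bigr => l _; rewrite mulrC -cReZ mulrC.
  have -> : \sum_(l < N) P (r%:C * om ^+ l) * (W l)%:C =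
     \sum_(k < m) c k * r%:C ^+ k * \sum_(l < N) om ^+ (l * k) * (W l)%:C.
    under [RHS]eq_bigr do rewrite mulr_sumr.
    rewrite exchange_big/=; apply: eq_bigr => l _; rewrite /P mulr_suml; apply: eq_bigr => k _.
    by rewrite exprMn -exprM !mulrA.
  have inner (k : nat) : (k < m)%N -> \sum_(l < N) om ^+ (l * k) * (W l)%:C =
      (k == 0%N)%:R * N%:R + (k == n.+1)%:R * (conjc eta / 2 * N%:R).
    move=> km; under eq_bigr do rewrite WE.
    transitivity (\sum_(l < N) om ^+ (l * k) + eta / 2 * (\sum_(l < N) om ^+ (l * (k + n.+1)))
       + conjc eta / 2 * \sum_(l < N) om ^+ (l * (k + (N - n.+1)))).
      rewrite !mulr_sumr -!big_split/=; apply: eq_bigr => l _.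
      by rewrite !mulnDr !exprD; ring.
    rewrite (sum_prim_root (j := k + n.+1) pom); last first.
      by rewrite gtnNdvd// ?addnS// /N -addnS ltn_add2r.
    rewrite mulr0 addr0; congr (_ + _).
      have [->|k0] := eqVneq k 0%N.
        by under eq_bigr do rewrite muln0 expr0; rewrite sumr_const card_ord mul1r.
      rewrite mul0r (sum_prim_root pom)// gtnNdvd ?lt0n//.
      by rewrite (leq_trans km)// /N leq_addr.
    have [->|kn] := eqVneq k n.+1.
      rewrite subnKC; last by rewrite /N leq_addl.
      rewrite mul1r; congr (_ * _); under eq_bigr do rewrite mulnC exprM (prim_expr_order pom) expr1n.
      by rewrite sumr_const card_ord.
    rewrite mul0r (sum_prim_root pom) ?mulr0//.
    have -> : (k + (N - n.+1) = k + m)%N by rewrite /N addnK.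
    apply/negP => /dvdnP[[|[|q]]].
    - by rewrite /m; lia.
    - by rewrite /N; move: kn => /eqP; lia.
    - by rewrite /N /m; move: km; rewrite /m; nia.
  transitivity (Re (\sum_(k < m) c k * r%:C ^+ k * ((k == 0%N :> nat)%:R * N%:R +
    (k == n.+1 :> nat)%:R * (conjc eta / 2 * N%:R)))).
    by congr Re; apply: eq_bigr => k _; rewrite inner.
  have m0' : (0 < m)%N by rewrite /m addnS.
  have nm : (n.+1 < m)%N by rewrite /m !addnS !ltnS leq_addl.
  under eq_bigr do rewrite mulrDr.
  rewrite big_split/= (bigD1 (Ordinal m0'))//= big1 ?addr0; last first.
    by move=> k; rewrite -val_eqE/= => /negPf ->; rewrite mul0r mulr0.
  rewrite (bigD1 (Ordinal nm))//= big1 ?addr0; last first.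
    by move=> k; rewrite -val_eqE/= => /negPf ->; rewrite mul0r mulr0.
  rewrite eqxx !mul1r expr0 mulr1 -(rmorph_nat (real_complex R) N)/=.
  rewrite cReD mulrC cReZ mulrDr; congr (_ + _).
  rewrite [X in Re X](_ : _ = (N%:R / 2)%:C * (c n.+1 * r%:C ^+ n.+1 * conjc eta)).
    by rewrite cReZ; ring.
  have -> : (2 : C) = (2 : R)%:C by rewrite rmorph_nat.
  by rewrite rmorphM fmorphV/=; ring.
rewrite E in lowT; have N0 : 0 < N%:R :> R by rewrite ltr0n (prim_order_gt0 pom).
by move: lowT; rewrite mulrC ler_pM2l.
Qed.

(** Caratheodory's inequality: in [uexp_average], $\eta$ is chosen to rotate $c_{n+1}$ onto the
    negative real axis, and then $r$ tends to 1 along $1 - 1/(k+1)$. *)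
Lemma uexp_coef H c n : uexp H c -> (forall w, cmod w < 1 -> 0 <= H w) ->
  cmod (c n.+1) <= 2 * Re (c 0%N).
Proof.
move=> Hc H0; have [c0|cn0] := eqVneq (c n.+1) 0.
  have h01 : 0 <= (0 : R) < 1 by rewrite lexx ltr01.
  have := uexp_average n Hc H0 h01 (cmod1 R).
  by rewrite c0 cmod0 !mul0r addr0 => h; rewrite mulr_ge0.
have k0 : 0 < cmod (c n.+1) by rewrite cmod_gt0.
pose eta := - c n.+1 * ((cmod (c n.+1))^-1)%:C.
have eta1 : cmod eta = 1.
  by rewrite cmodM cmodN cmodR normfV gtr0_norm// mulfV// gt_eqF.
have key r : 0 <= r < 1 -> cmod (c n.+1) * r ^+ n.+1 <= 2 * Re (c 0%N).
  move=> r01; have := uexp_average n Hc H0 r01 eta1.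
  have -> : c n.+1 * r%:C ^+ n.+1 * conjc eta = (- (cmod (c n.+1) * r ^+ n.+1))%:C.
    rewrite conjc_unit// /eta invfM fmorphV invrK invrN rmorphN rmorphM rmorphXn/=.
    by field.
  by rewrite /=; lra.
have C : (fun k : nat => cmod (c n.+1) * (1 - k.+1%:R^-1) ^+ n.+1) @ \oo --> cmod (c n.+1) * (1 - 0) ^+ n.+1.
  apply: cvgM; first exact: cvg_cst.
  have X (u : nat -> R) (l : R) j : u @ \oo --> l -> (fun k => u k ^+ j) @ \oo --> l ^+ j.
    move=> ul; elim: j => [|j IH]; first by under eq_fun do rewrite expr0; rewrite expr0; exact: cvg_cst.
    by under eq_fun do rewrite exprS; rewrite exprS; exact: cvgM.
  apply: X; apply: cvgB; first exact: cvg_cst.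
  exact: cvg_harmonic.
rewrite subr0 expr1n mulr1 in C.
rewrite -(cvg_lim (@Rhausdorff R) C); apply: limr_le; first by apply/cvg_ex; eexists; exact: C.
apply: nearW => k; apply: key; rewrite subr_ge0 ltrBlDr ltrDl invr_gt0 ltr0n andbT.
by rewrite invf_le1// ler1n.
Qed.

Lemma geom_sum_le (r : R) m : 0 <= r < 1 -> \sum_(n < m) r ^+ n <= (1 - r)^-1.
Proof.
move=> /andP[r0 r1]; have d : 0 < 1 - r by rewrite subr_gt0.
rewrite -[leRHS]mul1r ler_pdivlMr// mulrC -opprB mulNr -subrX1 opprB lerBlDr lerDl.
exact: exprn_ge0.
Qed.

Lemma uexp_at0 H c : uexp H c -> H 0 = Re (c 0%N).
Proof.
move=> Hc; apply/eqP; rewrite -subr_eq0 -normr_le0; apply/ler_addgt0Pr => e e0; rewrite add0r.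
have [|m0 Hm] := Hc 0 _ e e0; first by rewrite lexx ltr01.
have := Hm m0.+1 0 (leqnSn _); rewrite cmod0 lexx big_ord_recl expr0 mulr1 big1 ?addr0.
  by apply.
by move=> n _; rewrite expr0n mulr0.
Qed.

(** Since $\mathrm{Re}\, c_0 = H(0)$, [uexp_coef] dominates the tail by $2H(0)$ times a geometric
    tail. *)
Lemma uexp_tail H c (r : R) m w : uexp H c -> (forall w, cmod w < 1 -> 0 <= H w) ->
  0 <= r < 1 -> cmod w <= r ->
  `|H w - Re (\sum_(n < m.+1) c n * w ^+ n)| <= 2 * H 0 * (r ^+ m.+1 / (1 - r)).
Proof.
move=> Hc H0 r01 wr; have [r0 r1] := andP r01.
apply/ler_addgt0Pr => e e0; have [m0 Hm] := Hc r r01 e e0.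
pose k := (m.+1 + m0)%N; have {}Hm := Hm k w (leq_addl _ _) wr.
have -> : H w - Re (\sum_(n < m.+1) c n * w ^+ n) =
   (H w - Re (\sum_(n < k) c n * w ^+ n)) + Re (\sum_(n < m0) c (m.+1 + n)%N * w ^+ (m.+1 + n)).
  by rewrite /k big_split_ord/= cReD opprD addrA subrK.
rewrite (le_trans (ler_normD _ _))// addrC lerD// (le_trans (Re_le_cmod _))//.
rewrite (le_trans (cmod_sum _ _ _))//.
have p0 : 0 <= 2 * H 0 by rewrite mulr_ge0// H0// cmod0.
apply: (@le_trans _ _ (\sum_(n < m0) (2 * H 0 * r ^+ m.+1) * r ^+ n)).
  apply: ler_sum => n _; rewrite addSn cmodM cmodX -mulrA -exprD -addSn.
  apply: ler_pM; rewrite ?cmod_ge0 ?exprn_ge0 ?cmod_ge0//.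
    by rewrite (uexp_at0 Hc); exact: uexp_coef Hc H0.
  by rewrite lerXn2r ?nnegrE ?cmod_ge0.
by rewrite -mulr_sumr mulrA ler_wpM2l ?mulr_ge0 ?exprn_ge0 ?geom_sum_le// H0// cmod0.
Qed.

(** The tail bound with only the constant term kept; $2r/(1-r)$ is Harnack's upper ratio
    $(1+r)/(1-r)$ minus 1. *)
Lemma harnack H c (r : R) w : uexp H c -> (forall w, cmod w < 1 -> 0 <= H w) ->
  0 <= r < 1 -> cmod w <= r -> `|H w - H 0| <= 2 * H 0 * (r / (1 - r)).
Proof.
move=> Hc H0 r01 wr; have := uexp_tail 0 Hc H0 r01 wr.
by rewrite big_ord_recl big_ord0 addr0 expr0 mulr1 expr1 -(uexp_at0 Hc).
Qed.

End PositiveHarmonic.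

(** * Limits along ultrafilters *)

Section Ultrafilter.
Variable R : realType.
Local Notation C := R[i].
Variables (U : set_system nat).
Hypothesis UU : UltraFilter U.
#[local] Existing Instance UU.

Lemma ultra_const (T : finType) (f : nat -> T) : exists c, U [set m | f m = c].
Proof.
apply: contrapT => /forallNP H.
have : \forall m \near U, forall c, f m <> c.
  apply: filter_forall => c; have [/H//|] := in_ultra_setVsetC [set m | f m = c] UU.
  by apply: filterS => m.
by move=> /filter_ex[m /(_ (f m))]; apply.
Qed.

Lemma ultra_lim (x : nat -> R) (B : R) : U [set m | `|x m| <= B] ->
  exists l, forall e : R, 0 < e -> U [set m | `|x m - l| <= e].
Proof.
move=> xB; have [|l [_ cl]] := @segment_compact R (- B) B (x @ U).
  by rewrite /fmap/= ; apply: filterS xB => m /= h; rewrite in_itv/= -ler_norml.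
exists l => e e0; have [//|H] := in_ultra_setVsetC [set m | `|x m - l| <= e] UU.
have [] := cl (~` [set y | `|y - l| <= e]) (ball l e) H (nbhsx_ballx l e e0).
by move=> y [/= ny ly]; case: ny; rewrite distrC ltW.
Qed.

Lemma ultra_clim (x : nat -> C) (B : R) : U [set m | cmod (x m) <= B] ->
  exists l, forall e : R, 0 < e -> U [set m | cmod (x m - l) <= e].
Proof.
move=> xB; have [a Ha] : exists l : R, forall e : R, 0 < e -> U [set m | `|Re (x m) - l| <= e].
  by apply: (@ultra_lim (fun m => Re (x m)) B);
    apply: filterS xB => m /= h; exact: le_trans (Re_le_cmod _) h.
have [b Hb] : exists l : R, forall e : R, 0 < e -> U [set m | `|Im (x m) - l| <= e].
  by apply: (@ultra_lim (fun m => Im (x m)) B);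
    apply: filterS xB => m /= h; exact: le_trans (Im_le_cmod _) h.
exists (a +i* b) => e e0; have e2 : 0 < e / 2 by rewrite divr_gt0.
apply: filterS (filterI (Ha _ e2) (Hb _ e2)) => m [/= h1 h2].
by rewrite /= (le_trans (cmod_le_ReIm _))// cReB cImB/= (splitr e) lerD.
Qed.

Hypothesis Uoo : forall k, U [set m | (k <= m)%N].

Lemma ultra_inv (e : R) : 0 < e -> U [set m | m.+1%:R^-1 <= e :> R].
Proof.
move=> e0; have [k _ Hk] := near_infty_natSinv_lt (PosNum e0).
by apply: filterS (Uoo k) => m /= km; apply: ltW; exact: Hk.
Qed.

Lemma ultra_infinite (A : set nat) k : U A -> exists m, (k <= m)%N /\ A m.
Proof.
move=> UA; have H : U ([set m | (k <= m)%N] `&` A).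
  by apply: filterI => //; exact: Uoo.
by have [m [? ?]] := filter_ex H; exists m.
Qed.

Lemma ultra_many (A : set nat) : U A -> forall N, exists s : seq nat,
  [/\ uniq s, size s = N & forall m, m \in s -> A m].
Proof.
move=> UA; elim=> [|N [s [us sN sA]]]; first by exists [::].
have [m [hm Am]] := ultra_infinite (\max_(i <- s) i).+1 UA.
exists (m :: s); split => //=; last 2 first.
- by rewrite sN.
- by move=> k; rewrite inE => /orP[/eqP->//|]; exact: sA.
rewrite us andbT; apply/negP => ms; move: hm; rewrite ltnNge; apply/negP; rewrite negbK.
by rewrite (big_rem m)//= leq_maxl.
Qed.

(* The real part vanishes where a polynomial in [1/(p+1)] does; this one has infinitely many
   roots, and its value at ['i] is a nonzero multiple of [conjc d]. *)
Lemma Re_powers_zero (d : C) n (A : set nat) : U A ->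
  (forall p, A p -> Re (d * (1 +i* p.+1%:R^-1) ^+ n.+1) = 0) -> d = 0.
Proof.
move=> UA H; pose Q : {poly C} := d *: (1 + 'i *: 'X) ^+ n.+1 + (conjc d) *: (1 - 'i *: 'X) ^+ n.+1.
have Qr p : A p -> root Q (p.+1%:R^-1)%:C.
  move=> Ap; rewrite /root /Q !hornerE.
  have -> : 1 + 'i * (p.+1%:R^-1)%:C = 1 +i* p.+1%:R^-1 :> C.
    by apply/eqP; rewrite eq_complex/= !(mul0r, mulr0, mul1r, subr0, addr0, add0r) !eqxx.
  have -> : 1 - 'i * (p.+1%:R^-1)%:C = conjc (1 +i* p.+1%:R^-1) :> C.
    by apply/eqP; rewrite eq_complex/= !(mul0r, mulr0, mul1r, subr0, addr0, add0r, oppr0) !eqxx.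
  rewrite -rmorphXn -rmorphM/=; have := ReJ_add (d * (1 +i* p.+1%:R^-1) ^+ n.+1).
  rewrite H// => /eqP; rewrite eq_sym mulf_eq0 invr_eq0 pnatr_eq0 orbF.
  by [].
have Q0 : Q = 0.
  apply/eqP; apply: contraT => Qn0.
  have [s [us sN sA]] := ultra_many UA (size Q).
  have := @max_poly_roots _ Q (map (fun p : nat => (p.+1%:R^-1 : R)%:C) s) Qn0.
  rewrite size_map sN ltnn => ->//.
    by apply/allP => _ /mapP[p ps ->]; exact/Qr/sA.
  rewrite map_inj_uniq// => p p' /complexI /invr_inj/eqP.
  by rewrite eqr_nat eqSS => /eqP.
have : Q.['i] = 0 by rewrite Q0 horner0.
rewrite /Q !hornerE -expr2 sqr_i subrr expr0n/= mulr0 add0r opprK => /eqP.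
rewrite mulf_eq0 conjc_eq0 => /orP[/eqP//|]; rewrite expf_eq0/=.
by rewrite (_ : 1 + 1 = 2%:R)// pnatr_eq0.
Qed.

(* Letting [k] tend to infinity isolates the lowest coefficient along the ray of slope
   [1/(p+1)]; varying [p] then kills it. *)
Lemma double_ultra_identity (d : nat -> C) (B : R) (S : set nat) (S' : nat -> set nat)
  (w := fun p k : nat => (k.+1%:R^-1)%:C * ((8^-1)%:C * (1 +i* p.+1%:R^-1)) : C) :
  U S -> (forall p, S p -> U (S' p)) ->
  (forall p k N, S p -> S' p k ->
    `|Re (\sum_(n < N.+1) d n * w p k ^+ n)| <= B * (k.+1%:R^-1) ^+ N.+1) ->
  Re (d 0%N) = 0 /\ forall n, d n.+1 = 0.
Proof.
move=> US US' H.
have key N p : (forall n, (n < N)%N -> Re (d 0%N) = 0 /\ (n = 0%N \/ d n = 0)) -> S p ->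
    Re (d N * ((8^-1)%:C * (1 +i* p.+1%:R^-1)) ^+ N) = 0.
  move=> IH Sp; set X := Re _.
  apply/eqP; rewrite -normr_le0; apply/ler_addgt0Pr => e e0; rewrite add0r.
  have B0 : 0 < `|B| + 1 by rewrite ltr_wpDl.
  have UI : U ([set k | k.+1%:R^-1 <= e / (`|B| + 1)] `&` S' p).
    by apply: filterI; [exact/ultra_inv/divr_gt0|exact: US'].
  have [k [/= ke Sk]] := filter_ex UI.
  have := H p k N Sp Sk; rewrite big_ord_recr/= cReD.
  have -> : Re (\sum_(i < N) d i * w p k ^+ i) = 0.
    rewrite cRe_sum; apply: big1 => -[[|n] nN] _ /=; first by rewrite expr0 mulr1; case: (IH _ nN).
    by have [_ []//->] := IH _ nN; rewrite mul0r.
  have k0 : 0 < k.+1%:R^-1 :> R by rewrite invr_gt0 ltr0n.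
  rewrite add0r /w exprMn mulrCA -rmorphXn cReZ -/X normrM ger0_norm ?exprn_ge0 ?(ltW k0)//.
  rewrite [leRHS](_ : _ = k.+1%:R^-1 ^+ N * (B * k.+1%:R^-1)); last by rewrite exprS; ring.
  rewrite ler_pM2l ?exprn_gt0// => h; apply: (le_trans h); rewrite ler_pdivlMr// in ke.
  apply: le_trans ke; rewrite mulrC ler_wpM2l ?(ltW k0)//.
  by rewrite (le_trans (ler_norm _))// lerDl.
have d0 : Re (d 0%N) = 0.
  have [p Sp] := filter_ex US.
  by have := key 0%N p _ Sp; rewrite expr0 mulr1; apply.
split=> // n; elim/ltn_ind: n => n IH.
have e8 : ((8^-1 : R)%:C : C) ^+ n.+1 != 0.
  by rewrite expf_neq0// -cmod_gt0 cmodR normr_gt0 invr_eq0 pnatr_eq0.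
apply: (mulfI e8); rewrite mulr0; apply: (@Re_powers_zero _ n S US) => p Sp.
rewrite mulrAC -exprMn mulrC; apply: key => // -[|k]; first by split => //; left.
by rewrite ltnS => kn; split => //; right; exact: IH.
Qed.

End Ultrafilter.

(** * Families of harmonic functions with many minimizers *)

Section CompactFamily.
Variable R : realType.
Local Notation C := R[i].

Definition near_min (q : nat) (F : 'I_q -> C -> R) (e : R) (w : C) : {set 'I_q} :=
  [set j | [forall i, F j w <= F i w + e]].

Lemma near_minP q (F : 'I_q -> C -> R) e w j :
  reflect (forall i, F j w <= F i w + e) (j \in near_min F e w).
Proof. by rewrite inE; exact: forallP. Qed.

(** The imaginary part of $c_0$ is invisible in [H]. Setting it to 0 makes all coefficients bounded
    in terms of $H(0)$ when $H \ge 0$, so that they have limits. *)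
Lemma uexp_real0 (H : C -> R) c : uexp H c -> uexp H (fun n => if n is 0%N then (Re (c 0%N))%:C else c n).
Proof.
move=> Hc r r01 e e0; have [m0 Hm] := Hc r r01 e e0.
exists m0.+1 => -[//|m] w mm wr; apply: le_trans (Hm m.+1 w (ltnW mm) wr).
by rewrite !big_ord_recl !cReD !expr0 !mulr1.
Qed.

Lemma Re_psum_close (a b : nat -> C) N (e : R) w : cmod w <= 1 ->
  (forall n, (n < N)%N -> cmod (a n - b n) <= e) ->
  `|Re (\sum_(n < N) a n * w ^+ n) - Re (\sum_(n < N) b n * w ^+ n)| <= N%:R * e.
Proof.
move=> w1 H; rewrite -cReB (le_trans (Re_le_cmod _))// -sumrB (le_trans (cmod_sum _ _ _))//.
rewrite mulr_natl -[X in _ *+ X]card_ord -sumr_const ler_sum// => n _.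
rewrite -mulrBl cmodM cmodX -[leRHS]mulr1 ler_pM ?cmod_ge0 ?exprn_ge0 ?cmod_ge0 ?H//.
by rewrite exprn_ile1 ?cmod_ge0.
Qed.

(** The value of [F j] at [w] is at most $K + 1$, and Harnack with $r = 1/4$ bounds it below by a
    third of the value at 0. *)
Lemma near_min_at0 q (F : 'I_q -> C -> R) (c : 'I_q -> nat -> C) (K e : R) w j :
  (forall j, uexp (F j) (c j)) -> (forall j w, cmod w < 1 -> 0 <= F j w) ->
  (exists i, forall w, cmod w < 1 -> F i w <= K) -> e <= 1 ->
  cmod w <= 4^-1 -> j \in near_min F e w -> F j 0 <= 3 * (K + 1).
Proof.
move=> Fc F0 [i Hi] e1 w4 /near_minP/(_ i) h.
have w1 : cmod w < 1 by apply: (le_lt_trans w4); rewrite invf_lt1// ltr1n.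
have q4 : 0 <= (4^-1 : R) < 1 by rewrite invr_ge0 invf_lt1// ler0n ltr1n.
have := harnack (Fc j) (F0 j) q4 w4; rewrite ler_norml => /andP[h1 _].
have h2 := Hi w w1; have h3 : (4^-1 : R) / (1 - 4^-1) = 3^-1 by field.
rewrite h3 in h1; have := F0 j w w1; lra.
Qed.

(* If not, take limits of the coefficients of counterexamples with [eps] tending to 0, along
   an ultrafilter. The near-minimizers at the points [w p k] stabilize to a set [I] whose
   members all have the same limit, and at every point [I] meets the near-minimizers
   because both have more than half of the elements. *)
Lemma compact_family (n q : nat) (K : R) : (2 * n < q)%N -> 0 <= K ->
  exists2 eps : R, 0 < eps & forall (F : 'I_q -> C -> R) (c : 'I_q -> nat -> C),
    (forall j, uexp (F j) (c j)) -> (forall j w, cmod w < 1 -> 0 <= F j w) ->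
    (exists i, forall w, cmod w < 1 -> F i w <= K) ->
    (forall w, cmod w < 1 -> (#|~: near_min F eps w| <= n)%N) ->
    exists j, forall w, cmod w <= 2^-1 -> forall i, F j w - F i w <= 2^-1.
Proof.
move=> nq K0; apply: contrapT => /forall2NP H.
pose ep (m : nat) : R := m.+1%:R^-1.
have ep0 m : 0 < ep m by rewrite invr_gt0.
have ep1 m : ep m <= 1 by rewrite invf_le1// ler1n.
have {H} H m : exists Fc : ('I_q -> C -> R) * ('I_q -> nat -> C),
   [/\ forall j, uexp (Fc.1 j) (Fc.2 j) /\ (Re (Fc.2 j 0%N))%:C = Fc.2 j 0%N,
    forall j w, cmod w < 1 -> 0 <= Fc.1 j w,
    exists i, forall w, cmod w < 1 -> Fc.1 i w <= K,
    forall w, cmod w < 1 -> (#|~: near_min Fc.1 (ep m) w| <= n)%N &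
    forall j, exists w i, cmod w <= 2^-1 /\ 2^-1 < Fc.1 j w - Fc.1 i w].
  have [/(_ (ep0 m))//|/existsNP[F /existsNP[c]]] := H (ep m).
  move=> /not_implyP[Fc /not_implyP[F0 /not_implyP[FK /not_implyP[Ft /forallNP Fw]]]].
  exists (F, fun j n => if n is 0%N then (Re (c j 0%N))%:C else c j n); split => //=.
    by move=> j; split => //; apply: uexp_real0; exact: Fc.
  move=> j; have /existsNP[w /not_implyP[w2 /existsNP[i /negP]]] := Fw j.
  by rewrite -ltNge => Fi; exists w, i.
have {H} [Fc H] := choice H; pose F m := (Fc m).1; pose c m := (Fc m).2.
have Fu m j : uexp (F m j) (c m j) by have [/(_ j)[]] := H m.
have cr m j : (Re (c m j 0%N))%:C = c m j 0%N by have [/(_ j)[]] := H m.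
have F0 m j w : cmod w < 1 -> 0 <= F m j w by have [_ h _ _ _] := H m; exact: h.
have FK m : exists i, forall w, cmod w < 1 -> F m i w <= K by have [_ _ h _ _] := H m.
have Ft m w : cmod w < 1 -> (#|~: near_min (F m) (ep m) w| <= n)%N.
  by have [_ _ _ h _] := H m; exact: h.
have Fw m j : exists w i, cmod w <= 2^-1 /\ 2^-1 < F m j w - F m i w.
  by have [_ _ _ _ h] := H m; exact: h.
clear H.
have [U [UU Uoo]] := ultraFilterLemma (eventually_filter : ProperFilter (\oo : set_system nat)).
have {}Uoo k : U [set m | (k <= m)%N] by apply: Uoo; exact: nbhs_infty_ge.
pose L := 3 * (K + 1); have L0 : 0 <= L by rewrite /L; lra.
(* For fixed [p] these points tend to 0 along the ray of slope $1/(p+1)$; the factor $1/8$ keeps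
   them in $|w| \le 1/4$, as [near_min_at0] requires. *)
pose w (p k : nat) : C := (k.+1%:R^-1)%:C * ((8^-1)%:C * (1 +i* p.+1%:R^-1)).
have t01 (k : nat) : 0 < k.+1%:R^-1 :> R /\ k.+1%:R^-1 <= 1 :> R.
  by rewrite invr_gt0 ltr0n invf_le1// ler1n.
have w4 p k : cmod (w p k) <= k.+1%:R^-1 * 4^-1.
  have [k0 k1] := t01 k; rewrite /w; have := t01 p; move: (p.+1%:R^-1) => s [p0 p1].
  rewrite !cmodM !cmodR ger0_norm ?(ltW k0)// ler_wpM2l ?(ltW k0)//.
  have := cmod_le_ReIm (1 +i* s : C); rewrite /= normr1 (ger0_norm (ltW p0)).
  rewrite ger0_norm ?invr_ge0//; move: (cmod _) p0 p1 => x; clear; lra.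
have w4' p k : cmod (w p k) <= 4^-1.
  by apply: le_trans (w4 p k) _; have [k0 k1] := t01 k; rewrite ler_piMl.
have w1 p k : cmod (w p k) < 1 by apply: le_lt_trans (w4' p k) _; rewrite invf_lt1// ltr1n.
pose T m p k := near_min (F m) (ep m) (w p k).
(* The near-minimizers are stabilized in [m] for fixed [p] and [k], then in [k], then in [p]. A
   single pair [(p1, k1)] with limit [I] then yields the cardinality bound for [I] and the bound at
   0 for its members. *)
have [T1 HT1] := choice (fun pk : nat * nat => ultra_const UU (fun m => T m pk.1 pk.2)).
have [T2 HT2] := choice (fun p => ultra_const UU (fun k => T1 (p, k))).
have [I HI] := ultra_const UU T2.
have [p1 [k1 UI]] : exists p k, U [set m | T m p k = I].
  have [p /= Hp] := filter_ex HI; have [k /= Hk] := filter_ex (HT2 p).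
  by exists p, k; have := HT1 (p, k); rewrite Hk Hp.
have cardI : (#|~: I| <= n)%N.
  by have [m /= <-] := filter_ex UI; exact: Ft.
have bdI : U [set m | forall j, j \in I -> F m j 0 <= L].
  apply: filterS UI => m /= TI j; rewrite -TI => jT.
  exact: (near_min_at0 (Fu m) (F0 m) (FK m) (ep1 m) (w4' p1 k1) jT).
clearbody L.
have cb m j k : F m j 0 <= L -> cmod (c m j k) <= 2 * L.
  move=> FL; rewrite (uexp_at0 (Fu m j)) in FL.
  case: k => [|k].
    rewrite -(cr m j) cmodR ger0_norm; last by rewrite -(uexp_at0 (Fu m j)) F0// cmod0.
    by apply: le_trans FL _; move: L0; clear; lra.
  apply: le_trans (uexp_coef k (Fu m j) (F0 m j)) _.
  by rewrite ler_pM2l.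
have galim (jk : 'I_q * nat) : exists l : C, jk.1 \in I ->
    forall e : R, 0 < e -> U [set m | cmod (c m jk.1 jk.2 - l) <= e].
  case: jk => j k /=.
  (* Outside [I] the coefficients may be unbounded, and 0 is a dummy value. *)
  have [jI|jI] := boolP (j \in I); last by exists 0.
  have [|l Hl] := @ultra_clim R U UU (fun m => c m j k) (2 * L); last by exists l.
  by apply: filterS bdI => m /= /(_ j jI); exact: cb.
have [ga Hga] := choice galim.
have cga N (e : R) : 0 < e -> U [set m | forall j, j \in I -> forall k, (k < N)%N ->
    cmod (c m j k - ga (j, k)) <= e].
  move=> e0; have : \forall m \near U, forall jk : 'I_q * 'I_N, jk.1 \in I ->
     cmod (c m jk.1 jk.2 - ga (jk.1, val jk.2)) <= e.
    apply: filter_forall => -[j k] /=.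
    have [jI|jI] := boolP (j \in I); last by apply: filterE.
    by apply: filterS (Hga (j, val k) jI e e0) => m.
  by apply: filterS => m h j jI k kN; exact: (h (j, Ordinal kN)).
have tail m j N (r : R) z : F m j 0 <= L -> 0 <= r <= 2^-1 -> cmod z <= r ->
    `|F m j z - Re (\sum_(k < N.+1) c m j k * z ^+ k)| <= 4 * L * r ^+ N.+1.
  move=> FL /andP[r0 r2] zr; have r1 : 0 <= r < 1.
    by rewrite r0 (le_lt_trans r2)// invf_lt1// ltr1n.
  apply: le_trans (uexp_tail N (Fu m j) (F0 m j) r1 zr) _.
  rewrite mulrCA (_ : 4 * L * r ^+ N.+1 = r ^+ N.+1 * (2 * L * 2)); last by ring.
  have p0 : 0 <= F m j 0 by rewrite F0// cmod0.
  rewrite ler_wpM2l ?exprn_ge0//; apply: ler_pM; rewrite ?mulr_ge0 ?invr_ge0//.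
  - by rewrite subr_ge0 ltW//; case/andP: r1.
  - by rewrite ler_pM2l.
  - by rewrite -[leRHS]invrK lef_pV2 ?posrE ?invr_gt0//; [move: r2; clear; lra|rewrite subr_gt0; case/andP: r1].
have gaE i j k : i \in I -> j \in I -> ga (i, k) = ga (j, k).
  move=> iI jI; pose d k := ga (i, k) - ga (j, k).
  have [d0 dS] : Re (d 0%N) = 0 /\ forall n, d n.+1 = 0.
    (* Two tails of at most $4L/(k+1)^{N+1}$ each give the constant $8L$. The gap between the two
       near-minimizers and the two coefficient errors are each at most $e/3$ for a suitable [m]. *)
    apply: (@double_ultra_identity R U UU Uoo d (8 * L) [set p | T2 p = I] (fun p => [set k | T1 (p, k) = I])).
    - exact: HI.
    - by move=> p /= <-; exact: HT2.
    move=> p k' N /= _ TI; rewrite -/(w p k').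
    have [k0 k1'] := t01 k'.
    apply/ler_addgt0Pr => e e0; pose e' := e / (3 * N.+1%:R).
    have e'0 : 0 < e' by rewrite divr_gt0// mulr_gt0.
    have e30 : 0 < e / 3 by rewrite divr_gt0.
    have V : U ([set m | T m p k' = I] `&` ([set m | ep m <= e / 3] `&`
       ([set m | forall j, j \in I -> F m j 0 <= L] `&`
        [set m | forall j, j \in I -> forall k, (k < N.+1)%N -> cmod (c m j k - ga (j, k)) <= e']))).
      apply: filterI; first by have := HT1 (p, k'); rewrite TI.
      apply: filterI; first exact: ultra_inv.
      by apply: filterI => //; exact: cga.
    have [m [/= TmI [epm [mL mc]]]] := filter_ex V.
    have wle1 : cmod (w p k') <= 1 by exact: ltW.
    have rr : 0 <= (k'.+1%:R^-1 * 4^-1 : R) <= 2^-1.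
      by move: k0 k1'; move: (k'.+1%:R^-1) => s; clear => *; apply/andP; split; lra.
    have ti := tail m i N _ _ (mL i iI) rr (w4 p k').
    have tj := tail m j N _ _ (mL j jI) rr (w4 p k').
    have ci := Re_psum_close wle1 (mc i iI).
    have cj := Re_psum_close wle1 (mc j jI).
    have Fij : `|F m i (w p k') - F m j (w p k')| <= e / 3.
      have /near_minP/(_ j) h1 : i \in T m p k' by rewrite TmI.
      have /near_minP/(_ i) h2 : j \in T m p k' by rewrite TmI.
      by rewrite ler_norml; move: h1 h2 epm; clear;
        set a := F m i _; set b := F m j _ => *; apply/andP; split; lra.
    have -> : Re (\sum_(n0 < N.+1) d n0 * w p k' ^+ n0) =
        Re (\sum_(n0 < N.+1) ga (i, n0 : nat) * w p k' ^+ n0) -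
          Re (\sum_(n0 < N.+1) ga (j, n0 : nat) * w p k' ^+ n0).
      rewrite -cReB -sumrB; congr Re; apply: eq_bigr => n0 _; rewrite /d; ring.
    have Ne : N.+1%:R * e' = e / 3 by rewrite /e'; field; rewrite nat1r pnatr_eq0.
    rewrite Ne in ci cj.
    have tle : 4 * L * (k'.+1%:R^-1 * 4^-1) ^+ N.+1 <= 4 * L * k'.+1%:R^-1 ^+ N.+1.
      rewrite ler_wpM2l ?mulr_ge0// lerXn2r ?nnegrE ?mulr_ge0 ?invr_ge0// .
      by rewrite ler_piMr// invf_le1// ler1n.
    have {}ti := le_trans ti tle; have {}tj := le_trans tj tle.
    move: ti tj ci cj Fij; clear.
    move: (Re _) (Re _) (Re _) (Re _) (F m i _) (F m j _) (k'.+1%:R^-1 ^+ _) => a b x y z t u.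
    rewrite !ler_norml => /andP[? ?] /andP[? ?] /andP[? ?] /andP[? ?] /andP[? ?].
    by apply/andP; split; lra.
  (* For the constant terms only the real parts have been compared; the limits are real because of
     the normalization by [uexp_real0]. *)
  have Im0 j' : j' \in I -> Im (ga (j', 0%N)) = 0.
    move=> j'I; apply/eqP; rewrite -normr_le0; apply/ler_addgt0Pr => e e0; rewrite add0r.
    have [m /= hm] := filter_ex (Hga (j', 0%N) j'I e e0).
    by apply: le_trans hm; apply: le_trans (Im_le_cmod _); rewrite cImB -cr/= sub0r normrN.
  case: k => [|k]; last by apply/eqP; rewrite -subr_eq0; apply/eqP; exact: dS.
  apply/eqP; rewrite eq_complex !Im0// eqxx andbT -subr_eq0 -cReB.
  by apply/eqP.
have [i0 i0I] : exists i0, i0 \in I.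
  apply/set0Pn; apply/eqP => I0; move: cardI; rewrite I0 finset.setC0 cardsT card_ord leqNgt.
  by rewrite (leq_ltn_trans _ nq)// leq_pmull.
(* Two tails and two coefficient errors of $1/32$ each, plus a gap [ep m] of at most $1/8$, add up
   to $1/4$, below the value $1/2$ that a counterexample exceeds. *)
have [N HN] : exists N, 4 * L * 2^-1 ^+ N.+1 <= 32^-1.
  have C : (fun N => (4 * L * 2^-1) * 2^-1 ^+ N) @ \oo --> 0.
    by apply: cvg_geometric; rewrite ger0_norm ?invr_ge0// invf_lt1// ltr1n.
  have /cvgrPdist_le/(_ 32^-1) := C; rewrite invr_gt0 ltr0n => /(_ isT)[N _ /(_ N)] /=.
  rewrite leqnn => /(_ isT); rewrite sub0r normrN => h; exists N.
  by rewrite exprS mulrA; apply: le_trans h; exact: ler_norm.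
pose e' : R := 32^-1 / N.+1%:R.
have e'0 : 0 < e' by rewrite divr_gt0// invr_gt0.
have V : U ([set m | ep m <= 8^-1] `&` ([set m | forall j, j \in I -> F m j 0 <= L] `&`
        [set m | forall j, j \in I -> forall k, (k < N.+1)%N -> cmod (c m j k - ga (j, k)) <= e'])).
  apply: filterI; first by apply: ultra_inv => //; rewrite invr_gt0.
  by apply: filterI => //; exact: cga.
have [m [/= epm [mL mc]]] := filter_ex V.
have [z [i [z2 zi]]] := Fw m i0.
have z1 : cmod z <= 1 by apply: le_trans z2 _; rewrite invf_le1// ler1n.
have zl1 : cmod z < 1 by apply: le_lt_trans z2 _; rewrite invf_lt1// ltr1n.
have [j /andP[jT jI]] : exists j, (j \in near_min (F m) (ep m) z) && (j \in I).
  have Tc := Ft m z zl1; have : near_min (F m) (ep m) z :&: I != finset.set0.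
    apply/eqP => E; have : (q <= n + n)%N.
      rewrite -{1}(card_ord q) -cardsT -finset.setC0 -E finset.setCI.
      apply: leq_trans (leq_add Tc cardI); rewrite cardsU; exact: leq_subr.
    by rewrite addnn -mul2n leqNgt nq.
  by move/set0Pn => [j]; rewrite finset.inE; exists j.
have r2 : 0 <= (2^-1 : R) <= 2^-1 by rewrite invr_ge0 lexx ler0n.
have ti := le_trans (tail m i0 N _ _ (mL i0 i0I) r2 z2) HN.
have tj := le_trans (tail m j N _ _ (mL j jI) r2 z2) HN.
have ci := Re_psum_close z1 (mc i0 i0I).
have cj := Re_psum_close z1 (mc j jI).
have Ne : N.+1%:R * e' = 32^-1 by rewrite /e'; field; rewrite nat1r pnatr_eq0.
rewrite Ne in ci cj.
have gE : \sum_(n0 < N.+1) ga (i0, n0 : nat) * z ^+ n0 = \sum_(n0 < N.+1) ga (j, n0 : nat) * z ^+ n0.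
  by apply: eq_bigr => n0 _; rewrite (gaE i0 j).
rewrite gE in ci; have {jT} /near_minP/(_ i) jT := jT.
move: ti tj ci cj jT zi epm; clear.
move: (Re _) (Re _) (Re _) (F m i0 _) (F m j _) (F m i _) (ep m) => a b x y z' t u.
rewrite !ler_norml => /andP[? ?] /andP[? ?] /andP[? ?] /andP[? ?].
lra.
Qed.

End CompactFamily.

(** * Rescaling to an extremal disc *)

Section UniformNearMinimizer.
Variable R : realType.
Local Notation C := R[i].

Lemma uexp_lin (H H' : C -> R) c c' (x y k : R) : uexp H c -> uexp H' c' ->
  uexp (fun w => x * H w + y * H' w + k)
    (fun n => x%:C * c n + y%:C * c' n + (if n is 0%N then k%:C else 0)).
Proof.
move=> Hc Hc' r r01 e e0.
have K0 : 0 < `|x| + `|y| + 1 by rewrite ltr_wpDl// addr_ge0.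
have e1 : 0 < e / (`|x| + `|y| + 1) by rewrite divr_gt0.
have [m1 H1] := Hc r r01 _ e1; have [m2 H2] := Hc' r r01 _ e1.
exists (maxn m1 m2).+1 => -[//|m] w mm wr.
have {}H1 := H1 m.+1 w (leq_trans (leq_maxl _ _) (ltnW mm)) wr.
have {}H2 := H2 m.+1 w (leq_trans (leq_maxr _ _) (ltnW mm)) wr.
have -> : Re (\sum_(n < m.+1) (x%:C * c n + y%:C * c' n + (if n : nat is 0%N then k%:C else 0)) * w ^+ n)
   = x * Re (\sum_(n < m.+1) c n * w ^+ n) + y * Re (\sum_(n < m.+1) c' n * w ^+ n) + k.
  have kE : Re (\sum_(n < m.+1) (if n : nat is 0%N then k%:C else 0) * w ^+ n) = k.
    by rewrite big_ord_recl expr0 mulr1 big1 ?addr0// => n _; rewrite mul0r.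
  rewrite -[X in _ = _ + X]kE -!cReZ -!cReD !mulr_sumr -!big_split/=; congr Re; apply: eq_bigr => n _.
  by rewrite !mulrDl !mulrA.
set a := Re _ in H1 *; set b := Re _ in H2 *.
have -> : x * H w + y * H' w + k - (x * a + y * b + k) = x * (H w - a) + y * (H' w - b) by ring.
apply: (le_trans (ler_normD _ _)); rewrite !normrM.
apply: (le_trans (lerD (ler_wpM2l (normr_ge0 x) H1) (ler_wpM2l (normr_ge0 y) H2))).
rewrite -mulrDl mulrCA ler_piMr ?(ltW e0)// ler_pdivrMr// mul1r lerDl//.
Qed.

Lemma uexp_bounded (H : C -> R) c (r : R) : uexp H c -> 0 <= r < 1 ->
  exists B, forall w, cmod w <= r -> `|H w| <= B.
Proof.
move=> Hc r01; have [m Hm] := Hc r r01 1 ltr01; have [_ r1] := andP r01.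
exists (1 + \sum_(n < m) cmod (c n)) => w wr.
rewrite -[H w](subrK (Re (\sum_(n < m) c n * w ^+ n))) (le_trans (ler_normD _ _))//.
rewrite lerD ?Hm// (le_trans (Re_le_cmod _))// (le_trans (cmod_sum _ _ _))//.
apply: ler_sum => n _; rewrite cmodM cmodX ler_piMr ?cmod_ge0//.
by rewrite exprn_ile1 ?cmod_ge0// (le_trans wr)// ltW.
Qed.

Section Selection.
Variables (q : nat) (F : 'I_q -> C -> R).
Hypothesis Fexp : forall j b s, 0 < s -> cmod b + 2 * s <= 1 -> exists c, hexp (F j) b s c.

Definition good_disc (b : C) (rho S : R) :=
  exists j, forall z, cmod (z - b) <= rho -> forall i, F j z - F i z <= S.

Lemma good_disc_le b rho S S' : S <= S' -> good_disc b rho S -> good_disc b rho S'.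
Proof. by move=> SS [j H]; exists j => z zb i; exact: le_trans (H z zb i) SS. Qed.

(** If [j] is the index of the good disc, $F_{j_0} - F_j + S$ is nonnegative there and at most
    $(K+1)S$ at the centre, hence at most $3(K+1)S$ on the half disc by Harnack. Adding $F_j - F_i
    \le S$ cancels the extra $S$. *)
Lemma good_disc_step (a b : C) (rho S K : R) (j0 : 'I_q) : 0 < rho -> 0 <= S ->
  cmod b + 2 * rho <= 1 -> good_disc b rho S -> (forall i, F j0 b - F i b <= K * S) ->
  forall z, cmod (z - b) <= rho / 2 -> forall i, F j0 z - F i z <= (3 * K + 3) * S.
Proof.
move=> rho0 S0 br [j Hj] Kb z zb i.
have [c0 Hc0] := Fexp j0 rho0 br; have [c1 Hc1] := Fexp j rho0 br.
have Hc := uexp_lin 1 (- 1) S Hc0 Hc1.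
have H0 w : cmod w < 1 -> 0 <= 1 * F j0 (b + rho%:C * w) + -1 * F j (b + rho%:C * w) + S.
  move=> w1; have := Hj (b + rho%:C * w) _ j0; rewrite addrC addKr cmodM cmodR gtr0_norm//.
  by rewrite ler_piMr ?(ltW rho0)// ?(ltW w1)// => /(_ isT); lra.
have rC : rho%:C != 0 :> C by rewrite -cmod_gt0 cmodR normr_gt0 gt_eqF.
pose w := (z - b) / rho%:C.
have zE : b + rho%:C * w = z by rewrite /w mulrC divfK// addrC subrK.
have w2 : cmod w <= 2^-1.
  by rewrite cmodM cmodV cmodR gtr0_norm// ler_pdivrMr// mulrC.
have h01 : 0 <= (2^-1 : R) < 1 by rewrite invr_ge0 invf_lt1// ler0n ltr1n.
have := harnack Hc H0 h01 w2; rewrite zE mulr0 addr0.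
rewrite (_ : 2^-1 / (1 - 2^-1) = 1 :> R); last by field.
rewrite ler_norml => /andP[_].
have := Kb j; have : F j z - F i z <= S.
  by apply: Hj; apply: (le_trans zb); rewrite ler_pdivrMr// ler_pMr// ler1n.
by lra.
Qed.

(** The iterates of $K \mapsto 3K + 3$ from [good_disc_step], starting from 0 at a point where [j0]
    is an exact minimizer. *)
Fixpoint chain_const (k : nat) : R := if k is k'.+1 then 3 * chain_const k' + 3 else 0.

(** [good_disc_step] is applied along the segment from [a] to [z]. Six steps suffice: each has
    length at most $2r/6$, below the half radius $3r/8$. *)
Lemma good_disc_chain (a : C) (r S : R) (j0 : 'I_q) : 0 < r -> 0 <= S ->
  (forall b, cmod (b - a) <= 2 * r -> cmod b + 2 * (3 * r / 4) <= 1 /\ good_disc b (3 * r / 4) S) ->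
  (forall i, F j0 a <= F i a) ->
  forall z, cmod (z - a) <= 2 * r -> forall i, F j0 z - F i z <= chain_const 6 * S.
Proof.
move=> r0 S0 Hb Ha z za.
pose b (k : nat) : C := a + (k%:R / 6)%:C * (z - a).
have ba k : (k <= 6)%N -> cmod (b k - a) <= 2 * r.
  move=> k6; rewrite /b addrC addKr cmodM cmodR ger0_norm ?divr_ge0//.
  by apply: le_trans za; rewrite ler_piMl ?cmod_ge0// ler_pdivrMr// mul1r (ler_nat R _ 6).
have bS k : cmod (b k.+1 - b k) <= 3 * r / 4 / 2.
  have -> : b k.+1 - b k = (6^-1)%:C * (z - a).
    rewrite /b opprD addrACA subrr add0r -mulrBl; congr (_ * _).
    by rewrite -rmorphB/= -mulrBl -natrB// subSnn mul1r.
  rewrite cmodM cmodR ger0_norm ?invr_ge0//; move: za; lra.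
have key k : (k <= 6)%N -> forall i, F j0 (b k) - F i (b k) <= chain_const k * S.
  elim: k => [_|k IH k6] i.
    by rewrite /b mul0r mul0r addr0 mul0r subr_le0.
  have [b1 b2] := Hb (b k) (ba k (ltnW k6)).
  have p0 : 0 < 3 * r / 4 by rewrite divr_gt0// mulr_gt0.
  exact: (good_disc_step a p0 S0 b1 b2 (IH (ltnW k6)) (bS k)).
have -> : z = b 6%N by rewrite /b divff ?pnatr_eq0// mul1r addrC subrK.
exact: key.
Qed.

(* On discs of radius proportional to the distance to the circle [|b| = 1/4], halve the bound
   as long as possible; the bound [S] of the last step holds near [a], while [S / 2] fails there. *)
Lemma selection (A : R) : (0 < q)%N -> 0 < A -> ~ good_disc 0 (32^-1) A ->
  exists a r S, [/\ cmod a + 8 * r = 4^-1, 0 < r, A <= S, ~ good_disc a r (S / 2) &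
    exists j0, forall z, cmod (z - a) <= 2 * r -> forall i, F j0 z - F i z <= chain_const 6 * S].
Proof.
move=> q0 A0 NA.
(* At $b = 0$ this is $1/32$, the radius in the conclusion about [A]. *)
pose d (b : C) := (4^-1 - cmod b) / 8.
pose Q (S : R) := forall b, cmod b < 4^-1 -> good_disc b (d b) S.
have [B HB] : exists B, forall j z, cmod z <= 4^-1 -> `|F j z| <= B.
  have Bj j : exists B : R, forall z, cmod z <= 4^-1 -> `|F j z| <= B.
    have [||c Hc] := Fexp j (b := 0) (s := 2^-1); first by rewrite invr_gt0.
      by rewrite cmod0 add0r divff.
    have [|B HB] := uexp_bounded Hc (r := 2^-1); first by rewrite invr_ge0 invf_lt1// ler0n ltr1n.
    exists B => z z4; have := HB ((2 : R)%:C * z); rewrite add0r mulrA -rmorphM mulVf// mul1r.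
    by apply; rewrite cmodM cmodR ger0_norm//; move: z4; lra.
  have [B HB] := choice Bj.
  exists (\sum_j `|B j|) => j z /HB/le_trans; apply.
  by rewrite (bigD1 j)//= (le_trans (ler_norm _))// lerDl sumr_ge0.
have B0 : 0 <= B.
  by apply: le_trans (HB (Ordinal q0) 0 _); rewrite ?cmod0 ?invr_ge0.
pose S0 := 2 * B + 1; have S00 : 0 < S0 by rewrite /S0; lra.
have Q0 : Q S0.
  move=> b b4; exists (Ordinal q0) => z zb i.
  have z4 : cmod z <= 4^-1.
    have := cmodD (z - b) b; rewrite subrK; move: zb; rewrite /d; move: b4; lra.
  have := HB (Ordinal q0) z z4; have := HB i z z4; rewrite !ler_norml /S0 => /andP[? ?] /andP[? ?].
  lra.
pose S k := S0 * 2^-1 ^+ k.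
have Sp k : 0 < S k by rewrite mulr_gt0// exprn_gt0// invr_gt0.
(* Halving cannot succeed for ever: [Q] at a value below [A] would make the disc of radius $1/32$
   good for [A]. *)
have [k [Qk NQ]] : exists k, Q (S k) /\ ~ Q (S k.+1).
  apply: contrapT => /forallNP H.
  have QQ k : Q (S k).
    elim: k => [|k IH]; first by rewrite /S expr0 mulr1.
    by apply: contrapT => NQ; apply: (H k).
  have [k Hk] : exists k, S k <= A.
    have C : (fun k => S0 * 2^-1 ^+ k) @ \oo --> 0.
      by apply: cvg_geometric; rewrite ger0_norm ?invr_ge0// invf_lt1// ltr1n.
    have /cvgrPdist_le/(_ A A0) := C; move=> [k _ /(_ k)] /=.
    rewrite leqnn => /(_ isT); rewrite sub0r normrN => h; exists k.
    by apply: le_trans h; exact: ler_norm.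
  apply: NA; apply: good_disc_le Hk _; have := QQ k 0.
  rewrite /d cmod0 subr0 invr_gt0 ltr0n => /(_ isT).
  by rewrite -invfM (_ : 4 * 8 = 32 :> R)//; ring.
have [a /not_implyP[a4 Na]] : exists a, ~ (cmod a < 4^-1 -> good_disc a (d a) (S k.+1)).
  by apply/existsNP.
have da : 0 < d a by rewrite divr_gt0// subr_gt0.
have adE : cmod a = 4^-1 - 8 * d a by rewrite /d; field.
exists a, (d a), (S k); split => //.
- by rewrite adE; ring.
- rewrite leNgt; apply/negP => SA; apply: NA.
  apply: good_disc_le (ltW SA) _; have := Qk 0.
  rewrite /d cmod0 subr0 invr_gt0 ltr0n => /(_ isT).
  by rewrite -invfM (_ : 4 * 8 = 32 :> R)//; ring.
- by have -> : S k / 2 = S k.+1 by rewrite /S exprSr mulrA.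
have [j0 Hj0] : exists j0, forall i, F j0 a <= F i a.
  case: (arg_minP (fun j => F j a) (i0 := Ordinal q0) (P := xpredT)) => // j _ Hj.
  by exists j => i; exact: Hj.
exists j0; apply: good_disc_chain => //; first exact: ltW.
(* With $r = d(a)$, moving by at most $2r$ leaves a distance of at least $8r - 2r$ to the circle, so
   $d(b) \ge 6r/8 = 3r/4$. *)
move=> b ba; have cb : cmod b <= cmod a + 2 * d a.
  by have := cmodD (b - a) a; rewrite subrK; move: ba; lra.
split; first by move: cb; rewrite adE; lra.
have [|j Hj] := Qk b; first by move: cb; rewrite adE; lra.
exists j => z zb i; apply: Hj; apply: (le_trans zb).
have -> : d b = (4^-1 - cmod b) / 8 by [].
by move: cb; rewrite adE; lra.
Qed.

End Selection.

(* Subtracting [F j0] and dividing by [S] in the disc given by [selection] normalizes the family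
   for [compact_family]; the gap [C0 / S] becomes smaller than [eps] if [A] is large. *)
Lemma uniform_near_minimizer (n q : nat) (C0 : R) : (2 * n < q)%N -> 0 <= C0 ->
  exists A : R, forall F : 'I_q -> C -> R,
    (forall j b s, 0 < s -> cmod b + 2 * s <= 1 -> exists c, hexp (F j) b s c) ->
    (forall z, cmod z <= 1 -> (#|~: near_min F C0 z| <= n)%N) ->
    good_disc F 0 (32^-1) A.
Proof.
move=> nq C00; have q0 : (0 < q)%N by exact: leq_ltn_trans nq.
have K0 : 0 <= chain_const 6 by rewrite /=; lra.
have [eps eps0 Heps] := compact_family nq K0.
have A0 : 0 < C0 / eps + 1 by rewrite ltr_wpDl// divr_ge0// ltW.
exists (C0 / eps + 1) => F Fexp Ft; apply: contrapT => NA.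
have [a [r [S [ar r0 AS NaS [j0 Hj0]]]]] := selection Fexp q0 A0 NA.
have S0 : 0 < S by exact: lt_le_trans AS.
(* The disc of radius $2r$ becomes the unit disc, and index [j0] becomes the constant function
   [chain_const 6], which is the bound [K] given to [compact_family]. *)
pose f j w := S^-1 * F j (a + (2 * r)%:C * w) + (- S^-1) * F j0 (a + (2 * r)%:C * w) + chain_const 6.
have r20 : 0 < 2 * r by rewrite mulr_gt0.
have a8 : cmod a = 4^-1 - 8 * r by rewrite -ar addrK.
have a2r : cmod a + 2 * (2 * r) <= 1 by rewrite a8; clear -r0; lra.
have [c Hc] := choice (fun j => Fexp j a (2 * r) r20 a2r).
have win w : cmod w < 1 -> cmod (a + (2 * r)%:C * w - a) <= 2 * r.
  by move=> w1; rewrite addrC addKr cmodM cmodR gtr0_norm// ler_piMr// ltW.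
have [||||j Hj] := Heps f
  (fun j n => (S^-1)%:C * c j n + (- S^-1)%:C * c j0 n + (if n is 0%N then (chain_const 6)%:C else 0)).
- by move=> j; exact: (uexp_lin (S^-1) (- S^-1) (chain_const 6) (Hc j) (Hc j0)).
- move=> j w w1; have := Hj0 _ (win w w1) j; rewrite /f; move: (F j0 _) (F j _) (chain_const 6) => x y k.
  rewrite -ler_pdivrMr// mulrC; move: (S^-1) => s; clear; lra.
- exists j0 => w w1; rewrite /f mulNr subrr add0r//.
- move=> w w1; have z1 : cmod (a + (2 * r)%:C * w) <= 1.
    apply: (le_trans (cmodD _ _)); rewrite cmodM cmodR gtr0_norm//.
    apply: (@le_trans _ _ (cmod a + 2 * r)); first by rewrite lerD2l ler_piMr ?ltW.
    by rewrite a8; clear -r0; lra.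
  apply: leq_trans (Ft _ z1); apply: subset_leq_card; rewrite finset.setCS.
  apply/fintype.subsetP => j /near_minP H; apply/near_minP => i.
  suff : S^-1 * F j (a + (2 * r)%:C * w) <= S^-1 * F i (a + (2 * r)%:C * w) + eps.
    by rewrite /f; move: (S^-1) (F j _) (F i _) (F j0 _) (chain_const 6); clear => *; lra.
  have e : C0 <= eps * S.
    by rewrite mulrC -ler_pdivrMr//; apply: le_trans AS; rewrite lerDl.
  rewrite -(ler_pM2l S0) mulrDr !mulrA mulfV ?gt_eqF// !mul1r.
  by apply: (le_trans (H i)); rewrite lerD2l mulrC.
(* The radius $1/2$ and the bound $1/2$ of [compact_family] scale back to the radius [r] and the
   bound $S/2$. *)
apply: NaS; exists j => z za i.
have rC : (2 * r)%:C != 0 :> C by rewrite -cmod_gt0 cmodR normr_gt0 gt_eqF.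
have := Hj ((z - a) / (2 * r)%:C); rewrite cmodM cmodV cmodR gtr0_norm//.
rewrite ler_pdivrMr// mulrA mulVf// mul1r za => /(_ isT i).
have zE : a + (2 * r)%:C * ((z - a) / (2 * r)%:C) = z by rewrite mulrC divfK// addrC subrK.
rewrite /f zE; move: (F j z) (F i z) (F j0 z) => x y u h.
have {}h : S^-1 * (x - y) <= 2^-1 by move: h; move: (S^-1) (chain_const 6); clear => *; lra.
by rewrite mulrC ler_pdivrMr// mulrC in h.
Qed.

End UniformNearMinimizer.

(** * Smooth functions and bumps *)

Section SmoothFunctions.
Variable R : realType.
Implicit Types (f g b : R -> R) (x : R).

Fixpoint Ck (k : nat) f : Prop := (forall x, {for x, continuous f}) /\
  if k is k'.+1 then exists f', (forall x, is_derive x 1 f (f' x)) /\ Ck k' f' else True.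

Definition smooth f := forall k, Ck k f.

Lemma is_derive_continuous f x (d : R) : is_derive x 1 f d -> {for x, continuous f}.
Proof.
by move=> [fd _]; apply: differentiable_continuous; apply/derivable1_diffP.
Qed.

Lemma Ck_pred k f : Ck k.+1 f -> Ck k f.
Proof.
elim: k f => [|k IH] f [fc [f' [fd f'k]]]; first by split.
by split => //; exists f'; split => //; exact: IH.
Qed.

Lemma CkC k (c : R) : Ck k (fun=> c).
Proof.
have cc (a : R) x : {for x, continuous (fun=> a : R)} by exact: cvg_cst.
elim: k c => [|k IH] c; split => //; exists (fun=> 0); split => // x.
exact: is_derive_cst.
Qed.

Lemma CkD k f g : Ck k f -> Ck k g -> Ck k (fun x => f x + g x).
Proof.
have c (h h' : R -> R) : (forall x, {for x, continuous h}) -> (forall x, {for x, continuous h'}) ->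
    forall x, {for x, continuous (fun y : R => h y + h' y : R)}.
  by move=> hc hc' x; apply: cvgD; [exact: hc|exact: hc'].
elim: k f g => [|k IH] f g [fc fk] [gc gk]; first by split => //; exact: c.
split; first exact: c.
case: (fk) => f' [fd f'k]; case: (gk) => g' [gd g'k].
exists (fun x => f' x + g' x); split; last exact: IH.
by move=> x; exact: is_deriveD.
Qed.

Lemma CkM k f g : Ck k f -> Ck k g -> Ck k (fun x => f x * g x).
Proof.
have c (h h' : R -> R) : (forall x, {for x, continuous h}) -> (forall x, {for x, continuous h'}) ->
    forall x, {for x, continuous (fun y : R => h y * h' y : R)}.
  by move=> hc hc' x; apply: cvgM; [exact: hc|exact: hc'].
elim: k f g => [|k IH] f g [fc fk] [gc gk]; first by split => //; exact: c.
split; first exact: c.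
case: (fk) => f' [fd f'k]; case: (gk) => g' [gd g'k].
exists (fun x => f x * g' x + g x * f' x); split.
  by move=> x; exact: is_deriveM.
have fk' : Ck k f by apply: Ck_pred; split => //; exists f'.
have gk' : Ck k g by apply: Ck_pred; split => //; exists g'.
by apply: CkD; exact: IH.
Qed.

Lemma is_derive_affine f (u v d x : R) : is_derive (u * x + v) 1 f d ->
  is_derive x 1 (fun x => f (u * x + v)) (u * d).
Proof.
move=> fd; have D : is_derive x 1 (fun x : R => u * x + v) u.
  have := is_deriveD (is_deriveZ u (is_derive_id x (1 : R))) (is_derive_cst v x (1 : R)).
  by move=> /is_derive_eq; apply; rewrite /GRing.scale/= mulr1 addr0.
by rewrite mulrC; exact: (@is_derive1_comp _ f).
Qed.

Lemma Ck_affine k f (u v : R) : Ck k f -> Ck k (fun x => f (u * x + v)).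
Proof.
elim: k f => [|k IH] f [fc fk]; split => //.
- move=> x; apply: (@continuous_comp _ _ _ (fun x : R => u * x + v) f); last exact: fc.
  by apply: cvgD; [apply: cvgM; [exact: cvg_cst|exact: cvg_id]|exact: cvg_cst].
- move=> x; apply: (@continuous_comp _ _ _ (fun x : R => u * x + v) f); last exact: fc.
  by apply: cvgD; [apply: cvgM; [exact: cvg_cst|exact: cvg_id]|exact: cvg_cst].
have [f' [fd f'k]] := fk; exists (fun x => u * f' (u * x + v)); split.
  by move=> x; exact: is_derive_affine.
by apply: CkM; [exact: CkC|exact: IH].
Qed.

(* The functions [p(1/x) exp(-1/x)], extended by 0 for [x <= 0], are stable under derivation. *)
Definition flat (p : {poly R}) (x : R) := if 0 < x then p.[x^-1] * expR (- x^-1) else 0.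

(** The exponential series gives $t^{n+1} \le (n+1)!\, e^t$. It is used with $t = 1/x$ to
    differentiate [flat] at 0. *)
Lemma poly_expR_bound (p : {poly R}) : exists K, 0 <= K /\ forall t, 1 <= t -> `|p.[t]| * expR (- t) <= K / t.
Proof.
pose n := size p; pose A := \sum_(i < n) `|p`_i|.
have A0 : 0 <= A by exact: sumr_ge0.
exists (A * n.+1`!%:R); split; first by rewrite mulr_ge0.
move=> t t1; have t0 : 0 < t by exact: lt_le_trans t1.
have H1 : `|p.[t]| <= A * t ^+ n.
  rewrite horner_coef /A mulr_suml (le_trans (ler_norm_sum _ _ _))// ler_sum// => i _.
  rewrite normrM ler_wpM2l// normrX ger0_norm ?(ltW t0)//.
  by rewrite ler_weXn2l// ltnW.
have H2 := expR_ge1Dxn n (ltW t0).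
have H3 : t ^+ n.+1 <= n.+1`!%:R * expR t.
  rewrite mulrC -ler_pdivrMr ?ltr0n ?fact_gt0//; apply: le_trans H2.
  by rewrite lerDr.
rewrite expRN ler_pdivlMr// mulrAC ler_pdivrMr ?expR_gt0//.
apply: (le_trans (ler_wpM2r (ltW t0) H1)).
by rewrite -mulrA -exprSr -mulrA ler_wpM2l.
Qed.

Lemma is_derive_Rinv x : x != 0 -> is_derive x 1 (fun y : R => y^-1) (- x ^- 2).
Proof.
move=> x0; apply: DeriveDef; first exact/derivable1_diffP/differentiable_Rinv.
by rewrite deriveE ?diff_Rinv//; [rewrite /GRing.scale/= mulr1|exact: differentiable_Rinv].
Qed.

Lemma flat_derive p x : is_derive x 1 (flat p) (flat ('X^2 * (p - p^`())) x).
Proof.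
have [x0|x0|->] := ltgtP x 0.
- rewrite {2}/flat ifF; last by apply/negbTE; rewrite -leNgt ltW.
  apply: (@near_eq_is_derive _ _ _ (fun=> 0)).
  near=> y; rewrite /flat ltNge (_ : y <= 0)//; apply: ltW; near: y; exact: lt_nbhsl.
- rewrite {2}/flat x0.
  have dV := is_derive_Rinv (lt0r_neq0 x0).
  have d1 := @is_derive1_comp _ (horner p) _ x _ _ (is_derive_poly _ _) dV.
  have d2 := @is_derive1_comp _ expR (fun y => - y^-1) x _ _ (is_derive_expR _) (is_deriveN dV).
  have D : is_derive x 1 (fun y => p.[y^-1] * expR (- y^-1)) _ := is_deriveM d1 d2.
  have D' : is_derive x 1 (fun y => p.[y^-1] * expR (- y^-1)) (('X^2 * (p - p^`())).[x^-1] * expR (- x^-1)).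
    apply: (is_derive_eq D); rewrite /GRing.scale/= !(hornerM, hornerXn, hornerD, hornerN) -exprVn.
    by rewrite !hornerX; ring.
  apply: (near_eq_is_derive _ D').
  near=> y; rewrite /flat (_ : 0 < y)//; near: y; exact: lt_nbhsr.
(* The additional factor ['X] improves the bound on [flat p h] from $O(h)$ to $O(h^2)$, so the
   derivative at 0 vanishes. *)
rewrite {2}/flat ltxx; have [K [K0 HK]] := poly_expR_bound ('X * p).
have : rderiv (fun t => (flat p t)%:C) 0 0.
  move=> e e0; have K1 : 0 < K + 1 by rewrite ltr_wpDl.
  exists (Num.min 1 (e / (K + 1))) => [|h]; first by rewrite lt_min ltr01 divr_gt0.
  rewrite lt_min => /andP[h1 h2]; rewrite add0r mul0r subr0 {2}/flat ltxx subr0 cmodR /flat.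
  case: ltP => h0; last by rewrite normr0 mulr_ge0// ltW.
  rewrite gtr0_norm// in h1 h2 *.
  have t1 : 1 <= h^-1 by rewrite -invr1 lef_pV2 ?posrE// ltW.
  have := HK _ t1; rewrite hornerM hornerX normrM (gtr0_norm (_ : 0 < h^-1)) ?invr_gt0//.
  rewrite invrK -mulrA ler_pdivrMl// mulrCA normrM (gtr0_norm (expR_gt0 _)) => H.
  apply: (le_trans H); rewrite mulrA ler_wpM2r ?(ltW h0)//.
  rewrite ltr_pdivlMr// in h2; apply: le_trans (ltW h2); rewrite mulrC.
  by rewrite ler_wpM2l ?(ltW h0)// lerDl.
by move=> /rderiv_Re.
Unshelve. all: by end_near. Qed.

Lemma Ck_flat k p : Ck k (flat p).
Proof.
have c q x : {for x, continuous (flat q)} by exact: is_derive_continuous (flat_derive q x).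
elim: k p => [|k IH] p; split => //.
by exists (flat ('X^2 * (p - p^`()))); split => // x; exact: flat_derive.
Qed.

(** It vanishes for $|x| \ge 1$. For $|x| \le 1/2$ both factors are at least $e^{-2}$, and $e^4$
    raises their product to at least 1. *)
Definition bump (x : R) := expR 4 * (flat 1 (1 * x + 1) * flat 1 (- 1 * x + 1)).

Lemma smooth_bump : smooth bump.
Proof.
by move=> k; apply: CkM; [exact: CkC|apply: CkM; apply: Ck_affine; exact: Ck_flat].
Qed.

Lemma flat1_ge0 x : 0 <= flat 1 x.
Proof. by rewrite /flat; case: ifP => // _; rewrite hornerC mul1r expR_ge0. Qed.

Lemma bump_ge0 x : 0 <= bump x.
Proof. by rewrite /bump !mulr_ge0 ?expR_ge0 ?flat1_ge0. Qed.

Lemma bump_out x : 1 <= `|x| -> bump x = 0.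
Proof.
rewrite ler_normr /bump /flat => /orP[h|h].
  rewrite [X in _ * (_ * X)]ifF ?mulr0//; apply/negbTE; rewrite -leNgt; lra.
rewrite [X in _ * (X * _)]ifF ?mul0r ?mulr0//; apply/negbTE; rewrite -leNgt; lra.
Qed.

Lemma bump_in x : `|x| <= 2^-1 -> 1 <= bump x.
Proof.
rewrite ler_norml => /andP[h1 h2].
have F y : 2^-1 <= y -> expR (- 2) <= flat 1 y.
  move=> y2; have y0 : 0 < y by apply: lt_le_trans y2; rewrite invr_gt0.
  rewrite /flat y0 hornerC mul1r ler_expR lerN2 -[leRHS]invrK lef_pV2 ?posrE// invr_gt0//.
have e1 : 2^-1 <= 1 * x + 1 by lra.
have e2 : 2^-1 <= - 1 * x + 1 by lra.
have := ler_pM (expR_ge0 _) (expR_ge0 _) (F _ e1) (F _ e2).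
rewrite -expRD (_ : -2 - 2 = - 4); last by lra.
by rewrite expRN => h; rewrite /bump -ler_pdivrMl ?expR_gt0// mulr1.
Qed.

Lemma derive_out f f' (r : R) : (forall x, r < `|x| -> f x = 0) -> (forall x, is_derive x 1 f (f' x)) ->
  forall x, r < `|x| -> f' x = 0.
Proof.
move=> f0 fd x rx; have fx := fd x.
have D : is_derive x 1 f 0.
  apply: (@near_eq_is_derive _ _ _ (fun=> 0)).
  have cn : {for x, continuous (fun y : R => `|y|)} by exact: norm_continuous.
  near=> y; rewrite f0//; near: y.
  exact: (cn [set z | r < z] (lt_nbhsr rx)).
by rewrite -(@derive_val _ _ _ _ _ _ _ fx) (@derive_val _ _ _ _ _ _ _ D).
Unshelve. all: by end_near. Qed.

Lemma bounded_of_support f (r : R) : (forall x, {for x, continuous f}) ->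
  (forall x, r < `|x| -> f x = 0) -> exists M, 0 <= M /\ forall x, `|f x| <= M.
Proof.
move=> fc f0; have cw : {within `[- r, r], continuous f}.
  by apply: continuous_in_subspaceT => x _; exact: fc.
have [M [_ HM]] := compact_bounded (continuous_compact cw (@segment_compact R (- r) r)).
exists (`|M| + 1); split; first by rewrite addr_ge0.
move=> x; have [rx|xr] := ltP r `|x|; first by rewrite f0// normr0 addr_ge0.
apply: HM; first by rewrite (le_lt_trans (ler_norm _))// ltrDl.
by exists x => //=; rewrite in_itv/= -ler_norml.
Qed.

Lemma bump_derivatives : exists b1 b2 : R -> R, exists M, [/\ 0 <= M,
  forall x, is_derive x 1 bump (b1 x), forall x, is_derive x 1 b1 (b2 x),
  forall x, {for x, continuous b2} &
  forall x, [/\ `|bump x| <= M, `|b2 x| <= M & 1 < `|x| -> [/\ bump x = 0, b1 x = 0 & b2 x = 0]]].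
Proof.
have [bc [b1 [d1 [b1c [b2 [d2 [b2c _]]]]]]] := smooth_bump 2.
have o1 x : 1 < `|x| -> b1 x = 0 by apply: derive_out d1 x => y /ltW; exact: bump_out.
have o2 x : 1 < `|x| -> b2 x = 0 by apply: derive_out d2 x; exact: o1.
have [M1 [M10 H1]] := bounded_of_support bc (fun x h => bump_out (ltW h)).
have [M2 [M20 H2]] := bounded_of_support b2c o2.
exists b1, b2, (M1 + M2); split => //; first by rewrite addr_ge0.
move=> x; split.
- by rewrite (le_trans (H1 x))// lerDl.
- by rewrite (le_trans (H2 x))// lerDr.
- by move=> x1; split; [exact: bump_out (ltW x1)|exact: o1|exact: o2].
Qed.

End SmoothFunctions.

(** * Product test functions and integration on the plane *)

Section PlaneFunctions.
Variable R : realType.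
Implicit Types (phi : R * R -> R) (f g : R -> R) (x : R).

Lemma is_derive_line phi (p v : R * R) (c : R -> R * R) (s d : R) :
  (forall h, c (h *: 1 + s) = h *: v + p) -> is_derive s 1 (fun t => phi (c t)) d ->
  derivable phi p v /\ 'D_v phi p = d.
Proof.
move=> cE [fd fe]; have cs : c s = p by have := cE 0; rewrite !scale0r !add0r.
have E : (fun h : R => h^-1 *: (phi (h *: v + p) - phi p)) =
         (fun h : R => h^-1 *: (phi (c (h *: 1 + s)) - phi (c s))).
  by apply/funext => h; rewrite cE cs.
by split; [rewrite /derivable E|rewrite /derive E].
Qed.

Lemma dx_prod f g f' : (forall x, is_derive x 1 f (f' x)) ->
  (forall p, derivable (fun p : R * R => f p.1 * g p.2) p (1, 0)) /\
  dx (fun p => f p.1 * g p.2) = (fun p => f' p.1 * g p.2).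
Proof.
move=> fd; have D (p : R * R) : is_derive p.1 1 (fun t : R => f t * g p.2) (f' p.1 * g p.2).
  have X := is_deriveM (fd p.1) (is_derive_cst (g p.2) p.1 (1 : R)).
  by apply: (is_derive_eq X); rewrite /GRing.scale/= mulr0 add0r mulrC.
have E (p : R * R) (h : R) : (h *: 1 + p.1, p.2) = h *: (1, 0) + p by congr (_, _); rewrite /= scaler0 add0r.
have H (p : R * R) := @is_derive_line (fun p => f p.1 * g p.2) p (1, 0) (fun t => (t, p.2)) _ _ (E p) (D p).
by split=> [p|]; [|apply/funext => p]; have [] := H p.
Qed.

Lemma dy_prod f g g' : (forall x, is_derive x 1 g (g' x)) ->
  (forall p, derivable (fun p : R * R => f p.1 * g p.2) p (0, 1)) /\
  dy (fun p => f p.1 * g p.2) = (fun p => f p.1 * g' p.2).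
Proof.
move=> gd; have D (p : R * R) : is_derive p.2 1 (fun t : R => f p.1 * g t) (f p.1 * g' p.2).
  have X := is_deriveM (is_derive_cst (f p.1) p.2 (1 : R)) (gd p.2).
  by apply: (is_derive_eq X); rewrite /GRing.scale/= mulr0 addr0.
have E (p : R * R) (h : R) : (p.1, h *: 1 + p.2) = h *: (0, 1) + p by congr (_, _); rewrite /= scaler0 add0r.
have H (p : R * R) := @is_derive_line (fun p => f p.1 * g p.2) p (0, 1) (fun t => (p.1, t)) _ _ (E p) (D p).
by split=> [p|]; [|apply/funext => p]; have [] := H p.
Qed.

Lemma continuous_prod f g : (forall x, {for x, continuous f}) -> (forall x, {for x, continuous g}) ->
  continuous (fun p : R * R => f p.1 * g p.2).
Proof.
move=> fc gc p; apply: cvgM.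
  by apply: (@continuous_comp _ _ _ fst f); [exact: cvg_fst|exact: fc].
by apply: (@continuous_comp _ _ _ snd g); [exact: cvg_snd|exact: gc].
Qed.

Lemma class_C_prod k f g : Ck k f -> Ck k g -> class_C k (fun p => f p.1 * g p.2).
Proof.
elim: k f g => [|k IH] f g [fc fk] [gc gk]; first by split => //; exact: continuous_prod.
split; first exact: continuous_prod.
case: (fk) => f' [fd f'k]; case: (gk) => g' [gd g'k].
have fk' : Ck k f by apply: Ck_pred; split => //; exists f'.
have gk' : Ck k g by apply: Ck_pred; split => //; exists g'.
have [dx1 dx2] := dx_prod g fd; have [dy1 dy2] := dy_prod f gd.
by rewrite dx2 dy2; split => //; exact: IH.
Qed.

(** An open set is the countable union of the rational boxes that it contains; the other boxes are
    replaced by [set0]. *)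
Lemma open_measurable_plane (U : set (R * R)) : open U -> measurable U.
Proof.
move=> oU; pose box (a : (rat * rat) * (rat * rat)) : set (R * R) :=
  `]ratr a.1.1, ratr a.1.2[%classic `*` `]ratr a.2.1, ratr a.2.2[%classic.
pose F a := if `[< box a `<=` U >] then box a else set0.
rewrite (_ : U = \bigcup_a F a).
  apply: countable_bigcupT_measurable; first exact: countableP.
  by move=> a; rewrite /F; case: ifP => // _; apply: measurableX; exact: measurable_itv.
apply/seteqP; split => [[x y] Uxy|p [a _]]; last by rewrite /F; case: asboolP => // + /=; apply.
have /nbhs_ballP[e /= e0 He] : nbhs (x, y) U by exact: open_nbhs_nbhs.
have lt1 (z : R) : z - e < z by rewrite ltrBlDr ltrDl.
have lt2 (z : R) : z < z + e by rewrite ltrDl.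
have [a1 +] := rat_in_itvoo (lt1 x); rewrite in_itv/= => /andP[a11 a12].
have [a2 +] := rat_in_itvoo (lt2 x); rewrite in_itv/= => /andP[a21 a22].
have [b1 +] := rat_in_itvoo (lt1 y); rewrite in_itv/= => /andP[b11 b12].
have [b2 +] := rat_in_itvoo (lt2 y); rewrite in_itv/= => /andP[b21 b22].
exists ((a1, a2), (b1, b2)) => //; rewrite /F; case: asboolP => [_|[]].
  by split; rewrite /= in_itv/=; apply/andP.
move=> [x' y'] [/=]; rewrite !in_itv/= => /andP[? ?] /andP[? ?]; apply: He; split => /=;
  rewrite /ball/= ltr_norml; apply/andP; split; lra.
Qed.

Lemma continuous_measurable_plane phi : continuous phi -> measurable_fun setT phi.
Proof.
move=> cphi _; apply: (measurability _ (measurable_realfun.RGenOInfty.measurableE R)) => //.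
move=> _ [_ [a ->] <-]; rewrite setTI; apply: open_measurable_plane.
by apply: open_comp; [move=> p _; exact: cphi|exact: interval_open].
Qed.

Definition square (x0 y0 s : R) : set (R * R) := `[x0 - s, x0 + s]%classic `*` `[y0 - s, y0 + s]%classic.

Lemma squareP x0 y0 s (p : R * R) : square x0 y0 s p <-> `|p.1 - x0| <= s /\ `|p.2 - y0| <= s.
Proof.
by rewrite /square /= !in_itv/= -!ler_distl.
Qed.

Lemma compact_square x0 y0 s : compact (square x0 y0 s).
Proof. by apply: compact_setX; exact: segment_compact. Qed.

Lemma measurable_square x0 y0 s : measurable (square x0 y0 s).
Proof. by apply: measurableX; exact: measurable_itv. Qed.

Lemma test_function_prod x0 y0 s f g : smooth f -> smooth g ->
  (forall p, ~ square x0 y0 s p -> f p.1 * g p.2 = 0) ->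
  test_function (fun p : R * R => f p.1 * g p.2).
Proof.
move=> fs gs out; split; first by move=> k; apply: class_C_prod.
apply: (@subclosed_compact _ _ (square x0 y0 s)); [exact: closed_closure|exact: compact_square|].
have -> : square x0 y0 s = closure (square x0 y0 s).
  by apply/closure_id; apply: compact_closed; [exact: norm_hausdorff|exact: compact_square].
apply: closureS => p /= pn; apply: contrapT => /out E.
by rewrite E eqxx in pn.
Qed.

Local Notation leb := (@lebesgue_measure R).
Local Notation leb2 := (leb \x leb)%E.

Lemma leb2_square x0 y0 s : 0 < s -> leb2 (square x0 y0 s) = ((2 * s) ^+ 2)%:E.
Proof.
move=> s0; rewrite /square product_measure1E; [|exact: measurable_itv|exact: measurable_itv].
rewrite [X in (X * _)%E](@lebesgue_measure_itv R `[_, _]) [X in (_ * X)%E](@lebesgue_measure_itv R `[_, _])/=.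
rewrite !lte_fin !ifT; [|lra|lra].
by rewrite -!EFinB -EFinM; congr (_%:E); ring.
Qed.

Lemma compact_support_integrable x0 y0 s phi : 0 < s -> continuous phi ->
  (forall p, ~ square x0 y0 s p -> phi p = 0) -> leb2.-integrable setT (EFin \o phi).
Proof.
move=> s0 cphi out; have -> : EFin \o phi = (EFin \o phi) \_ (square x0 y0 s).
  apply/funext => p; rewrite /patch; case: ifPn => // pn; rewrite /= out//.
  by move=> h; case/negP: pn; rewrite inE.
have [H _] := @integrable_mkcond _ _ _ leb2 (square x0 y0 s) (EFin \o phi) (@measurable_square x0 y0 s).
apply: H.
apply: measurable_bounded_integrable.
- exact: measurable_square.
- by rewrite [X in (X < _)%E](leb2_square x0 y0 s0) ltry.
- by apply: (measurable_funS measurableT) => //; exact: continuous_measurable_plane.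
- have [M [_ HM]] := compact_bounded (continuous_compact (continuous_subspaceT cphi) (@compact_square x0 y0 s)).
  by exists M; split; rewrite ?num_real// => N MN p pQ; apply: HM => //; exists p.
Qed.

Lemma integral_derive0 (w w' : R -> R) (a b : R) : a < b ->
  (forall x, is_derive x 1 w (w' x)) -> (forall x, {for x, continuous w'}) ->
  w a = 0 -> w b = 0 -> (forall x, ~ a <= x <= b -> w' x = 0) ->
  (\int[leb]_x (w' x)%:E = 0)%E.
Proof.
move=> ab wd wc wa wb out.
have -> : (fun x => (w' x)%:E) = (fun x => (w' x)%:E) \_ `[a, b].
  apply/funext => x; rewrite /patch; case: ifPn => // xn; rewrite out//.
  by move=> h; case/negP: xn; rewrite inE/= in_itv.
rewrite -integral_mkcond (@continuous_FTC2 _ _ w)//.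
- by rewrite wa wb sube0.
- by apply: continuous_in_subspaceT => x _; exact: wc.
- have cont t : {for t, continuous w} by exact: is_derive_continuous (wd t).
  split.
  + by move=> x _; have [] := wd x.
  + by apply: cvg_at_right_filter; apply: cont.
  + by apply: cvg_at_left_filter; apply: cont.
- by move=> x _; rewrite derive1E; exact: (@derive_val _ _ _ _ _ _ _ (wd x)).
Qed.

End PlaneFunctions.

(** * Local bounds for the Riesz measure *)

Section RieszLocal.
Variable R : realType.
Local Notation C := R[i].
Local Notation leb := (@lebesgue_measure R).
Local Notation leb2 := (leb \x leb)%E.

Lemma ccont_plane (f : C -> C) : (forall z, ccont f z) ->
  continuous (fun p : R * R => Re (f (p.1 +i* p.2))) /\
  continuous (fun p : R * R => Im (f (p.1 +i* p.2))).
Proof.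
move=> fc.
have H (p : R * R) (e : R) : 0 < e -> \forall t \near p, cmod (f (t.1 +i* t.2) - f (p.1 +i* p.2)) <= e.
  move=> e0; have [r r0 Hr] := fc (p.1 +i* p.2) e e0.
  near=> t; have h : cmod ((t.1 - p.1) +i* (t.2 - p.2)) < r.
    have : ball p (r / 2) t by near: t; apply: nbhsx_ballx; rewrite divr_gt0.
    case=> /=; rewrite /ball/= distrC => h1; rewrite distrC => h2.
    by rewrite (le_lt_trans (cmod_le_ReIm _))//= (splitr r) ltrD.
  have := Hr _ h; rewrite (_ : p.1 +i* p.2 + _ = t.1 +i* t.2)//.
  by apply/eqP; rewrite eq_complex/= !(addrC _ (_ - _)) !subrK !eqxx.
split=> p; apply/cvgrPdist_le => e e0; near=> t.
- rewrite distrC -cReB (le_trans (Re_le_cmod _))//; near: t; exact: H.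
- rewrite distrC -cImB (le_trans (Im_le_cmod _))//; near: t; exact: H.
Unshelve. all: by end_near. Qed.

Lemma cderiv_horner (p : {poly C}) z : cderiv (horner p) z p^`().[z].
Proof.
elim/poly_ind: p => [|p c IH].
  rewrite deriv0 horner0 (_ : horner 0 = fun=> 0); first exact: cderivC.
  by apply/funext => w; rewrite horner0.
rewrite derivMXaddC hornerD hornerMX (_ : horner _ = fun w => p.[w] * w + c); last first.
  by apply/funext => w; rewrite hornerMXaddC.
have H := cderivD (cderivM IH (cderiv_id z)) (cderivC c z).
by apply: (cderiv_eq H); rewrite mulr1 addr0 addrC.
Qed.

(** Real parts of polynomials are the harmonic functions compared with [u]: they are smooth on the
    whole plane, and truncated expansions of $\log|g|$ have this form. *)
Definition reP (p : {poly C}) (q : R * R) : R := Re p.[q.1 +i* q.2].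

Lemma continuous_reP p : continuous (reP p).
Proof. by have [] := ccont_plane (fun z => cderiv_ccont (cderiv_horner p z)). Qed.

Lemma reP_derive_x p (x y : R) : is_derive x 1 (fun t => reP p (t, y)) (reP p^`() (x, y)).
Proof. exact: rderiv_Re (cderiv_hline (cderiv_horner p (x +i* y))). Qed.

Lemma reP_derive_y p (x y : R) : is_derive y 1 (fun t => reP p (x, t)) (reP ('i *: p^`()) (x, y)).
Proof.
have -> : reP ('i *: p^`()) (x, y) = Re (p^`().[x +i* y] * 'i) by rewrite /reP hornerZ mulrC.
exact: rderiv_Re (cderiv_vline (cderiv_horner p (x +i* y))).
Qed.

Lemma continuous_line (phi : R * R -> R) (y : R) : continuous phi ->
  (forall x : R, {for x, continuous (fun t => phi (t, y))}) /\
  (forall x : R, {for x, continuous (fun t => phi (y, t))}).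
Proof.
move=> cphi; split=> x.
  apply: (@continuous_comp _ _ _ (fun t : R => (t, y)) phi); last exact: cphi.
  exact: (@cvg_pair _ _ _ (nbhs x) (nbhs x) (nbhs y) _ _ _ (fun t => t) (fun=> y) cvg_id (cvg_cst _)).
apply: (@continuous_comp _ _ _ (fun t : R => (y, t)) phi); last exact: cphi.
exact: (@cvg_pair _ _ _ (nbhs x) (nbhs y) (nbhs x) _ _ _ (fun=> y) (fun t => t) (cvg_cst _) cvg_id).
Qed.

(** The integrand is the derivative of $(v b' - v' b)c$, which vanishes at $x_0 \pm 2s$, outside the
    support of [b]. *)
Lemma integral_by_parts0 (v v1 v2 b b1 b2 : R -> R) (c x0 s : R) : 0 < s ->
  (forall x : R, is_derive x 1 v (v1 x)) -> (forall x : R, is_derive x 1 v1 (v2 x)) ->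
  (forall x : R, {for x, continuous v2}) ->
  (forall x : R, is_derive x 1 b (b1 x)) -> (forall x : R, is_derive x 1 b1 (b2 x)) ->
  (forall x : R, {for x, continuous b2}) ->
  (forall x : R, s < `|x - x0| -> [/\ b x = 0, b1 x = 0 & b2 x = 0]) ->
  (\int[leb]_x ((v x * b2 x - v2 x * b x) * c)%:E = 0)%E.
Proof.
move=> s0 vd v1d v2c bd b1d b2c out.
have s2 : s < 2 * s by rewrite ltr_pMl// ltr1n.
have oa : s < `|x0 - 2 * s - x0| by rewrite addrC addKr normrN ger0_norm ?mulr_ge0// ltW.
have ob : s < `|x0 + 2 * s - x0| by rewrite addrC addKr ger0_norm ?mulr_ge0// ltW.
apply: (@integral_derive0 _ (fun x => (v x * b1 x - v1 x * b x) * c) _ (x0 - 2 * s) (x0 + 2 * s)).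
- lra.
- move=> x; have D1 := is_deriveM (vd x) (b1d x); have D2 := is_deriveM (v1d x) (bd x).
  have D : is_derive x 1 (fun x => (v x * b1 x - v1 x * b x) * c) _ :=
    is_deriveM (is_deriveB D1 D2) (is_derive_cst c x (1 : R)).
  by apply: (is_derive_eq D); rewrite /GRing.scale/=; ring.
- have vc x := is_derive_continuous (vd x); have bc x := is_derive_continuous (bd x).
  move=> x; apply: cvgM; last exact: cvg_cst.
  by apply: cvgB; apply: cvgM; [exact: vc|exact: b2c|exact: v2c|exact: bc].
- by have [-> -> _] := out _ oa; ring.
- by have [-> -> _] := out _ ob; ring.
- move=> x xn; have [|-> _ ->] := out x; last by ring.
  rewrite ltNge; apply/negP => h; apply: xn; rewrite ler_norml in h; case/andP: h => *.
  by apply/andP; split; lra.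
Qed.

(** For a cut-off $\varphi$ at scale $s$, the mass is at most $\int \varphi\,d\mu = \frac1{2\pi}\int
    (u - \mathrm{Re}\,P)\Delta\varphi$, as $\mathrm{Re}\,P$ is harmonic. Since $|\Delta\varphi| \le
    2M^2/s^2$ on a square of area $4s^2$, the constant does not depend on $s$; this makes the final
    bound uniform over all annuli. *)
Lemma riesz_local : exists K0 : R, 0 <= K0 /\
  forall (u : R * R -> R) (mu : {measure set (R * R)%type -> \bar R}) (x0 y0 s A : R) (P : {poly C}),
  riesz_measure u mu -> continuous u -> 0 < s -> 0 <= A ->
  (forall p, square x0 y0 s p -> `|u p - reP P p| <= A) ->
  (mu (square x0 y0 (s / 2)) <= (K0 * A)%:E)%E.
Proof.
have [b1 [b2 [M [M0 d1 d2 b2c bM]]]] := bump_derivatives R.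
exists ((2 * pi)^-1 * (8 * M ^+ 2)); split.
  by rewrite mulr_ge0 ?mulr_ge0 ?invr_ge0 ?sqr_ge0// mulr_ge0// pi_ge0.
move=> u mu x0 y0 s A P [_ Hmu] uc s0 A0 uP.
pose B (c x : R) := bump (s^-1 * x + - c / s).
pose B1 (c x : R) := s^-1 * b1 (s^-1 * x + - c / s).
pose B2 (c x : R) := s^-1 * (s^-1 * b2 (s^-1 * x + - c / s)).
have s1 : 0 < s^-1 by rewrite invr_gt0.
have sc c x : `|s^-1 * x + - c / s| = `|x - c| / s.
  by rewrite mulrC -mulrDl normrM (gtr0_norm s1).
have Bd (c x : R) : is_derive x 1 (B c) (B1 c x) by exact: is_derive_affine.
have B1d (c x : R) : is_derive x 1 (B1 c) (B2 c x).
  have D := is_deriveZ (s^-1) (is_derive_affine (d2 (s^-1 * x + - c / s))).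
  exact: D.
have B2c (c x : R) : {for x, continuous (B2 c)}.
  apply: cvgM; first exact: cvg_cst.
  apply: cvgM; first exact: cvg_cst.
  apply: (@continuous_comp _ _ _ (fun x : R => s^-1 * x + - c / s) b2); last exact: b2c.
  by apply: cvgD; [apply: cvgM; [exact: cvg_cst|exact: cvg_id]|exact: cvg_cst].
have Bc (c x : R) : {for x, continuous (B c)} by exact: is_derive_continuous (Bd c x).
have Bout (c x : R) : s < `|x - c| -> [/\ B c x = 0, B1 c x = 0 & B2 c x = 0].
  move=> h; have [_ _ H] := bM (s^-1 * x + - c / s).
  have [] := H; first by rewrite sc ltr_pdivlMr// mul1r.
  by rewrite /B /B1 /B2 => -> -> ->; rewrite !mulr0.
have Bsm c : smooth (B c) by move=> k; apply: Ck_affine; exact: smooth_bump.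
have BM c x : `|B c x| <= M by have [] := bM (s^-1 * x + - c / s).
have B2M c x : `|B2 c x| <= M / s ^+ 2.
  have [_ H _] := bM (s^-1 * x + - c / s); rewrite /B2 !normrM (gtr0_norm s1).
  rewrite (_ : M / s ^+ 2 = s^-1 * (s^-1 * M)); last by field; rewrite gt_eqF.
  by rewrite ler_pM2l// ler_pM2l.
have Bin c x : `|x - c| <= s / 2 -> 1 <= B c x.
  by move=> h; apply: bump_in; rewrite sc ler_pdivrMr// mulrC.
have B0 c x : 0 <= B c x by exact: bump_ge0.
clearbody B B1 B2.
pose phi (p : R * R) := B x0 p.1 * B y0 p.2.
have sqn p : ~ square x0 y0 s p -> s < `|p.1 - x0| \/ s < `|p.2 - y0|.
  move=> np; have [h1|h1] := ltP s `|p.1 - x0|; first by left.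
  have [h2|h2] := ltP s `|p.2 - y0|; first by right.
  by exfalso; apply: np; apply/squareP.
have phi0 p : ~ square x0 y0 s p -> phi p = 0.
  by move=> /sqn[] /Bout[h _ _]; rewrite /phi h ?mul0r ?mulr0.
have lapE p : laplacian phi p = B2 x0 p.1 * B y0 p.2 + B x0 p.1 * B2 y0 p.2.
  rewrite /laplacian /phi (dx_prod (B y0) (Bd x0)).2 (dx_prod (B y0) (B1d x0)).2.
  by rewrite (dy_prod (B x0) (Bd y0)).2 (dy_prod (B x0) (B1d y0)).2.
pose lap (p : R * R) := B2 x0 p.1 * B y0 p.2 + B x0 p.1 * B2 y0 p.2.
have lapc : continuous lap.
  have c1 := continuous_prod (B2c x0) (Bc y0); have c2 := continuous_prod (Bc x0) (B2c y0).
  by move=> p; apply: cvgD; [exact: c1|exact: c2].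
have lap0 p : ~ square x0 y0 s p -> lap p = 0.
  by move=> /sqn[] /Bout[h _ h']; rewrite /lap h h' ?mul0r ?mulr0 addr0.
have lapM p : `|lap p| <= 2 * M ^+ 2 / s ^+ 2.
  rewrite (le_trans (ler_normD _ _))// !normrM.
  rewrite (_ : 2 * M ^+ 2 / s ^+ 2 = M / s ^+ 2 * M + M * (M / s ^+ 2)); last by ring.
  by apply: lerD; apply: ler_pM; rewrite ?BM ?B2M ?normr_ge0.
have tphi : test_function phi by exact: test_function_prod (Bsm x0) (Bsm y0) phi0.
have := Hmu phi tphi; rewrite (_ : (fun p => ((2 * pi)^-1 * (u p * laplacian phi p))%:E) =
  (fun p => ((2 * pi)^-1 * (u p * lap p))%:E)); last by apply/funext => p; rewrite lapE.
(* The two terms in $P''$ cancel, so [A1] and [A2] add up to [reP P] times [lap]. [A1] integrates to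
   0 along horizontal lines and [A2] along vertical ones. *)
pose A1 (p : R * R) := (reP P p * B2 x0 p.1 - reP P^`()^`() p * B x0 p.1) * B y0 p.2.
pose A2 (p : R * R) := (reP P p * B2 y0 p.2 + reP P^`()^`() p * B y0 p.2) * B x0 p.1.
have cfst (f : R -> R) : (forall x : R, {for x, continuous f}) -> continuous (fun p : R * R => f p.1).
  by move=> fc p; apply: (@continuous_comp _ _ _ fst f); [exact: cvg_fst|exact: fc].
have csnd (f : R -> R) : (forall x : R, {for x, continuous f}) -> continuous (fun p : R * R => f p.2).
  by move=> fc p; apply: (@continuous_comp _ _ _ snd f); [exact: cvg_snd|exact: fc].
have A1c : continuous A1.
  move=> p; apply: cvgM; last exact: csnd.
  by apply: cvgB; apply: cvgM; [exact: continuous_reP|exact: cfst|exact: continuous_reP|exact: cfst].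
have A2c : continuous A2.
  move=> p; apply: cvgM; last exact: cfst.
  by apply: cvgD; apply: cvgM; [exact: continuous_reP|exact: csnd|exact: continuous_reP|exact: csnd].
have A10 p : ~ square x0 y0 s p -> A1 p = 0.
  by move=> /sqn[] /Bout[h _ h']; rewrite /A1 h ?h' ?mulr0// subrr mul0r.
have A20 p : ~ square x0 y0 s p -> A2 p = 0.
  by move=> /sqn[] /Bout[h _ h']; rewrite /A2 h ?h' ?mulr0// addr0 mul0r.
have A1i := compact_support_integrable s0 A1c A10.
have A2i := compact_support_integrable s0 A2c A20.
have I1 : (\int[leb2]_p (A1 p)%:E = 0)%E.
  rewrite -(integral21_prod_meas1 A1i) (eq_integral (fun=> 0%E)) ?integral0// => y _.
  rewrite /fubini_G; apply: (@integral_by_parts0 (fun x => reP P (x, y))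
    (fun x => reP P^`() (x, y)) (fun x => reP P^`()^`() (x, y)) (B x0) (B1 x0) (B2 x0) (B y0 y) x0 s) => //.
  - by move=> x; exact: reP_derive_x.
  - by move=> x; exact: reP_derive_x.
  - by have [] := continuous_line y (continuous_reP (p := P^`()^`())).
  - by move=> x; exact: Bout.
have I2 : (\int[leb2]_p (A2 p)%:E = 0)%E.
  rewrite -(integral12_prod_meas1 A2i) (eq_integral (fun=> 0%E)) ?integral0// => x _.
  rewrite /fubini_F; have := @integral_by_parts0 (fun y => reP P (x, y))
    (fun y => reP ('i *: P^`()) (x, y)) (fun y => - reP P^`()^`() (x, y)) (B y0) (B1 y0) (B2 y0) (B x0 x) y0 s s0.
  move=> H; rewrite -[RHS]H//.
  - by apply: eq_integral => y _; rewrite /A2/= mulNr opprK.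
  - by move=> y; exact: reP_derive_y.
  - move=> y; apply: (is_derive_eq (reP_derive_y _ _ _)).
    by rewrite /reP derivZ scalerA -expr2 sqr_i scaleN1r hornerN cReN.
  - move=> y; apply: cvgN.
    by have [_ h] := continuous_line x (continuous_reP (p := P^`()^`())); exact: h.
  - by move=> y; exact: Bout.
pose k := (2 * pi)^-1 : R.
have k0 : 0 <= k by rewrite invr_ge0 mulr_ge0 ?pi_ge0.
pose g p := k * ((u p - reP P p) * lap p).
have gc : continuous g.
  move=> p; apply: cvgM; first exact: cvg_cst.
  apply: cvgM; last exact: lapc.
  by apply: cvgB; [exact: uc|exact: continuous_reP].
have g0 p : ~ square x0 y0 s p -> g p = 0 by move=> /lap0 h; rewrite /g h !mulr0.
have gi := compact_support_integrable s0 gc g0.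
have kA (a : R * R -> R) : leb2.-integrable setT (EFin \o a) ->
    leb2.-integrable setT (fun p => (k%:E * (a p)%:E)%E).
  by move=> ai; apply: integrableZl.
have -> : (\int[leb2]_p (k * (u p * lap p))%:E = \int[leb2]_p (g p)%:E)%E.
  have E p : (k * (u p * lap p))%:E = ((g p)%:E + (k%:E * (A1 p)%:E + k%:E * (A2 p)%:E))%E.
    by rewrite -!EFinM -!EFinD; congr (_%:E); rewrite /g /A1 /A2 /lap; ring.
  under eq_integral do rewrite E.
  rewrite integralD//; last by apply: integrableD => //; exact: kA.
  rewrite integralD//; [|exact: kA|exact: kA].
  by rewrite !integralZl// I1 I2 !mule0 !adde0.
move=> Ephi.
have Q2 : (mu (square x0 y0 (s / 2)) <= \int[mu]_p (phi p)%:E)%E.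
  have phic : continuous phi by exact: continuous_prod (Bc x0) (Bc y0).
  have mQ : measurable (square x0 y0 (s / 2)) by exact: measurable_square.
  rewrite -[X in (mu X <= _)%E]setIT -integral_indic//.
  apply: ge0_le_integral => //.
  - by apply/measurable_realfun.measurable_EFinP; exact: measurable_realfun.measurable_indic.
  - by apply/measurable_realfun.measurable_EFinP; exact: continuous_measurable_plane.
  move=> p _; rewrite lee_fin indicE; case: (boolP (p \in _)) => [|_].
    rewrite inE => /squareP[h1 h2]; rewrite /phi -[leLHS]mulr1.
    by apply: ler_pM => //; exact: Bin.
  by rewrite mulr_ge0.
apply: (le_trans Q2); rewrite Ephi.
pose cst0 : R := k * (A * (2 * M ^+ 2 / s ^+ 2)).
have -> : ((2 * pi)^-1 * (8 * M ^+ 2) * A)%:E = (\int[leb2]_(p in square x0 y0 s) (cst0%:E))%E.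
  rewrite integral_cst; last exact: measurable_square.
  rewrite [X in (_ * X)%E](leb2_square x0 y0 s0) -EFinM; congr (_%:E).
  by rewrite /cst0 -/k; field; rewrite gt_eqF.
have -> : (\int[leb2]_p (g p)%:E = \int[leb2]_(p in square x0 y0 s) (g p)%:E)%E.
  rewrite [RHS]integral_mkcond; apply: eq_integral => p _; rewrite /patch.
  by case: ifPn => // pn; rewrite g0// => h; case/negP: pn; rewrite inE.
have mQ := @measurable_square R x0 y0 s.
apply: le_integral => //.
- by apply: (integrableS measurableT) gi.
- apply: measurable_bounded_integrable => //.
  + by rewrite [X in (X < _)%E](leb2_square x0 y0 s0) ltry.
  + by exists cst0; split; rewrite ?num_real// => N hN p _; apply: (le_trans _ (ltW hN));
    rewrite ger0_norm// /cst0 mulr_ge0// mulr_ge0// divr_ge0 ?sqr_ge0// mulr_ge0 ?sqr_ge0.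
- move=> p; rewrite inE => pQ; rewrite lee_fin /g /cst0 ler_wpM2l//.
  rewrite (le_trans (ler_norm _))// normrM ler_pM//.
  exact: uP.
Qed.

End RieszLocal.

(** * Linear forms on the cone over M *)

Section ProjectiveCompactness.
Variables (R : realType) (N : nat).
Local Notation C := R[i].
Local Notation vec := 'rV[C]_N.+1.
Implicit Types (v : vec) (p : projspace R N).

Definition linform (l : 'I_N.+1 -> C) v : C := \sum_i l i * v 0 i.

Definition vnorm v : R := Num.sqrt (\sum_i cmod (v 0 i) ^+ 2).

Lemma vnorm_ge0 v : 0 <= vnorm v. Proof. exact: sqrtr_ge0. Qed.

Lemma sumsq_ge0 v : 0 <= \sum_i cmod (v 0 i) ^+ 2.
Proof. by apply: sumr_ge0 => i _; exact: sqr_ge0. Qed.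

Lemma cmod_le_vnorm v i : cmod (v 0 i) <= vnorm v.
Proof.
rewrite -[cmod _]ger0_norm ?cmod_ge0// -sqrtr_sqr ler_wsqrtr// (bigD1 i)//= lerDl.
by apply: sumr_ge0 => j _; exact: sqr_ge0.
Qed.

Lemma vnorm_gt0 v : v != 0 -> 0 < vnorm v.
Proof.
move=> v0; rewrite lt_def vnorm_ge0 andbT; apply: contra v0 => /eqP n0.
apply/eqP/rowP => i; rewrite mxE; apply/eqP; rewrite -cmod_eq0 eq_le cmod_ge0 andbT.
by rewrite -n0 cmod_le_vnorm.
Qed.

Lemma vnormZ (a : C) v : vnorm (a *: v) = cmod a * vnorm v.
Proof.
rewrite /vnorm -[cmod a]ger0_norm ?cmod_ge0// -sqrtr_sqr -sqrtrM ?sqr_ge0//.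
by congr Num.sqrt; rewrite mulr_sumr; apply: eq_bigr => i _; rewrite mxE cmodM exprMn.
Qed.

Lemma linformZ l (a : C) v : linform l (a *: v) = a * linform l v.
Proof. by rewrite /linform mulr_sumr; apply: eq_bigr => i _; rewrite mxE mulrCA. Qed.

Lemma linform_le l v : cmod (linform l v) <= (\sum_i cmod (l i)) * vnorm v.
Proof.
rewrite mulr_suml (le_trans (cmod_sum _ _ _))// ler_sum// => i _.
by rewrite cmodM ler_wpM2l ?cmod_ge0// cmod_le_vnorm.
Qed.

Lemma homog_coordsZ p v (a : C) : a != 0 -> homog_coords p v -> homog_coords p (a *: v).
Proof.
move=> a0 [v0 pv]; split; first by rewrite scaler_eq0 negb_or a0.
rewrite pv; apply/eqP; rewrite eqEsubv -!memvE; apply/andP; split; apply/vlineP.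
  by exists a^-1; rewrite scalerA mulVf// scale1r.
by exists a.
Qed.

Lemma homog_coords_exists v : v != 0 -> exists p, homog_coords p v.
Proof.
move=> v0; have d1 : \dim <[v]>%VS == 1%N by rewrite dim_vline v0.
by exists (exist _ <[v]>%VS d1).
Qed.

(** The complement of [W] is a line spanned by some [e]. The form is a coordinate, nonzero on [e],
    of the projection onto that line along [W]. *)
Lemma hyperplane_linform (H : set (projspace R N)) : hyperplane H ->
  exists l, forall p v, homog_coords p v -> (H p <-> linform l v = 0).
Proof.
move=> [W [dW ->]]; have dC : \dim W^C = 1%N.
  by rewrite dimv_compl dimvf dW dim_matrix; lia.
have C0 : (W^C != 0)%VS by rewrite -dimv_eq0 dC.
pose e := vpick W^C; have e0 : e != 0 by rewrite /e vpick0.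
have eE : (W^C = <[e]>)%VS.
  apply/eqP; rewrite eq_sym eqEdim -memvE memv_pick dC dim_vline e0.
  by [].
have [k ek] : exists k, e 0 k != 0.
  by apply/existsP; rewrite -negb_forall;
    apply: contra e0 => /forallP h; apply/eqP/rowP => i; rewrite mxE; apply/eqP.
have cap1 := capv_compl W; have cap2 : (W^C :&: W = 0)%VS by rewrite capvC.
pose f := daddv_pi W^C W; have fW v : (v \in W) = (f v 0 k == 0).
  have dec : f v + daddv_pi W W^C v = v.
    by apply: daddv_pi_add => //; rewrite addvC addv_complf memvf.
  apply/idP/eqP => [vW|fv].
    move: dec; rewrite (daddv_pi_id cap1 vW) => /(congr1 (fun x => x - v)); rewrite addrK subrr => ->.
    by rewrite mxE.
  have : f v \in (<[e]>)%VS by rewrite -eE memv_pi.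
  case/vlineP => a fa; move: fv dec; rewrite fa mxE => /eqP.
  rewrite mulf_eq0 (negPf ek) orbF => /eqP ->; rewrite scale0r add0r => <-.
  exact: memv_pi.
exists (fun i => f (delta_mx 0 i) 0 k) => p v [v0 pv] /=; rewrite pv -memvE fW.
have -> : linform (fun i => f (delta_mx 0 i) 0 k) v = f v 0 k.
  rewrite {2}(row_sum_delta v) linear_sum summxE; apply: eq_bigr => i _.
  by rewrite linearZ mxE mulrC.
by split => /eqP.
Qed.

Section UltraContinuity.
Variables (U : set_system nat) (UU : UltraFilter U).

Definition ulim (x : nat -> C) (l : C) := forall e : R, 0 < e -> U [set m | cmod (x m - l) <= e].

Lemma ulimC (c : C) : ulim (fun=> c) c.
Proof. by move=> e e0; apply: filterE => m /=; rewrite subrr cmod0 ltW. Qed.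

Lemma ulimD x y l k : ulim x l -> ulim y k -> ulim (fun m => x m + y m) (l + k).
Proof.
move=> xl yk e e0; have e2 : 0 < e / 2 by rewrite divr_gt0.
apply: filterS (filterI (xl _ e2) (yk _ e2)) => m [/= h1 h2].
by rewrite opprD addrACA (le_trans (cmodD _ _))// (splitr e) lerD.
Qed.

Lemma ulimM x y l k : ulim x l -> ulim y k -> ulim (fun m => x m * y m) (l * k).
Proof.
move=> xl yk e e0; pose K := 1 + cmod l + cmod k.
have K0 : 0 < K by rewrite /K -addrA ltr_wpDr// addr_ge0 ?cmod_ge0.
pose e' := Num.min 1 (e / K).
have e'0 : 0 < e' by rewrite lt_min ltr01 divr_gt0.
have e'1 : e' <= 1 by rewrite ge_min lexx.
have e'e : e' * K <= e by rewrite -ler_pdivlMr// ge_min lexx orbT.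
apply: filterS (filterI (xl _ e'0) (yk _ e'0)) => m [/= h1 h2].
have -> : x m * y m - l * k = (x m - l) * (y m - k) + l * (y m - k) + (x m - l) * k by ring.
apply: le_trans e'e; rewrite (le_trans (cmodD _ _))// (le_trans (lerD (cmodD _ _) (lexx _)))//.
rewrite !cmodM /K !mulrDr mulr1 (mulrC e' (cmod l)); apply: lerD; last by rewrite ler_wpM2r ?cmod_ge0.
apply: lerD; last by rewrite ler_wpM2l ?cmod_ge0.
by rewrite -[leRHS]mulr1 ler_pM ?cmod_ge0// (le_trans h2).
Qed.

Lemma ulim_big (op : C -> C -> C) (idx : C) (I : Type) (r : seq I) (x : I -> nat -> C) (l : I -> C) :
  (forall x y l k, ulim x l -> ulim y k -> ulim (fun m => op (x m) (y m)) (op l k)) ->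
  (forall i, ulim (x i) (l i)) ->
  ulim (fun m => \big[op/idx]_(i <- r) x i m) (\big[op/idx]_(i <- r) l i).
Proof.
move=> Hop H; elim: r => [|i r IH].
  by rewrite big_nil; under [X in ulim X]eq_fun do rewrite big_nil; exact: ulimC.
by rewrite big_cons; under [X in ulim X]eq_fun do rewrite big_cons; exact: Hop.
Qed.

Lemma ulimX x l n : ulim x l -> ulim (fun m => x m ^+ n) (l ^+ n).
Proof.
move=> H; elim: n => [|n IH].
  by rewrite expr0; under [X in ulim X]eq_fun do rewrite expr0; exact: ulimC.
by rewrite exprS; under [X in ulim X]eq_fun do rewrite exprS; exact: ulimM.
Qed.

Lemma ulim_eq0 x l : ulim x l -> (forall m, x m = 0) -> l = 0.
Proof.
move=> xl x0; apply/eqP; rewrite -cmod_eq0 eq_le cmod_ge0 andbT.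
apply/ler_addgt0Pr => e /xl /filter_ex[m /=]; rewrite x0 sub0r cmodN add0r.
by [].
Qed.

Lemma ulim_meval (P : mpoly.mpoly N.+1 C) (x : nat -> 'I_N.+1 -> C) (l : 'I_N.+1 -> C) :
  (forall i, ulim (fun m => x m i) (l i)) ->
  ulim (fun m => mpoly.meval (x m) P) (mpoly.meval l P).
Proof.
move=> H; rewrite mpoly.mevalE; under [X in ulim X]eq_fun do rewrite mpoly.mevalE.
apply: ulim_big => [|m]; [exact: ulimD|apply: ulimM; first exact: ulimC].
by apply: ulim_big => [|i]; [exact: ulimM|exact: ulimX].
Qed.

End UltraContinuity.

(* Otherwise normalized counterexamples converge, along an ultrafilter, to a point of [M] common
   to [n.+1] of the divisors. *)
Lemma cone_lower_bound (M : set (projspace R N)) (n q : nat) (D : 'I_q -> set (projspace R N))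
    (l : 'I_q -> 'I_N.+1 -> C) :
  projective_variety M ->
  (forall j p v, homog_coords p v -> M p -> (D j p <-> linform (l j) v = 0)) ->
  (forall I : {set 'I_q}, #|I| = n.+1 -> \bigcap_(j in [set j | j \in I]) D j = set0) ->
  exists2 c : R, 0 < c & forall (I : {set 'I_q}) p v, #|I| = n.+1 -> homog_coords p v -> M p ->
    exists2 j, j \in I & c * vnorm v <= cmod (linform (l j) v).
Proof.
move=> [S [_ MS]] Dl DI; apply: contrapT => /forall2NP H.
have ex m : exists Iv : {set 'I_q} * vec, [/\ #|Iv.1| = n.+1, vnorm Iv.2 = 1,
    exists p, homog_coords p Iv.2 /\ M p & forall j, j \in Iv.1 -> cmod (linform (l j) Iv.2) <= m.+1%:R^-1].
  have [|/existsNP[I /existsNP[p /existsNP[v]]]] := H m.+1%:R^-1; first by rewrite invr_gt0 ltr0n.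
  move=> /not_implyP[cI /not_implyP[pv /not_implyP[Mp NE]]].
  have n0 : 0 < vnorm v by apply: vnorm_gt0; case: pv.
  pose a : C := ((vnorm v)^-1)%:C.
  have am : cmod a = (vnorm v)^-1 by rewrite cmodR gtr0_norm// invr_gt0.
  have a0 : a != 0 by rewrite -cmod_gt0 am invr_gt0.
  exists (I, a *: v); split => //=.
  - by rewrite vnormZ am mulVf// gt_eqF.
  - by exists p; split => //; exact: homog_coordsZ.
  move=> j jI; rewrite linformZ cmodM am ler_pdivrMl// mulrC leNgt; apply/negP => h.
  by apply: NE; exists j => //; exact: ltW.
have [Iv Hex] := choice ex.
have [U [UU Uoo]] := ultraFilterLemma (eventually_filter : ProperFilter (\oo : set_system nat)).
have {}Uoo k : U [set m | (k <= m)%N] by apply: Uoo; exact: nbhs_infty_ge.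
have [I UI] := ultra_const UU (fun m => (Iv m).1).
have xlim i : exists x : C, ulim U (fun m => (Iv m).2 0 i) x.
  apply: (@ultra_clim R U UU _ 1); apply: filterE => m /=.
  by have [_ <- _ _] := Hex m; exact: cmod_le_vnorm.
have [x Hx] := choice xlim.
pose v : vec := \row_i x i.
have vi i : v 0 i = x i by rewrite mxE.
have v0 : v != 0.
  (* The approximating vectors have norm 1, whereas coordinates all of modulus at most $e =
     1/(2(N+1)) \le 1$ would give a squared norm of at most $(N+1)e = 1/2$. *)
  apply/eqP => v0; have x0 i : x i = 0 by rewrite -vi v0 mxE.
  pose e : R := (2 * N.+1%:R)^-1.
  have e0 : 0 < e by rewrite invr_gt0 mulr_gt0.
  have e1 : e <= 1 by rewrite invf_le1 ?mulr_gt0// -natrM ler1n muln_gt0.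
  have UA : U [set m | forall i, cmod ((Iv m).2 0 i) <= e].
    by apply: filter_forall => i; apply: filterS (Hx i e e0) => m /=; rewrite x0 subr0.
  have [m /= Hm] := filter_ex UA; have [_ n1 _ _] := Hex m.
  have : vnorm (Iv m).2 ^+ 2 <= 2^-1.
    rewrite sqr_sqrtr ?sumsq_ge0//.
    apply: (@le_trans _ _ (\sum_(i < N.+1) e)).
      apply: ler_sum => i _; rewrite expr2 -[leRHS]mulr1 ler_pM ?cmod_ge0//.
      by rewrite (le_trans (Hm i)).
    rewrite sumr_const card_ord -[e *+ _]mulr_natr /e invfM -mulrA mulVf ?mulr1 ?pnatr_eq0 ?lexx //.
  by rewrite n1 expr1n; apply/negP; rewrite -ltNge invf_lt1// ltr1n.
have [p pv] := homog_coords_exists v0.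
(* Polynomial equations pass to the limit. [zero_locus] quantifies over all coordinate vectors [w]
   of [p], so the approximating vectors are rescaled by the factor [a] relating [w] to [v]. *)
have Mp : M p.
  rewrite MS => P SP w pw; have [a wa] : exists a : C, w = a *: v.
    by have [_ E1] := pw; have [_ E2] := pv; apply/vlineP; rewrite -E2 E1 memv_line.
  have a0 : a != 0 by apply: contraNneq (_ : w != 0) => [a0|]; [rewrite wa a0 scale0r|case: pw].
  have := @ulim_meval U UU P (fun m i => (a *: (Iv m).2) 0 i) (fun i => w 0 i).
  move=> HP; apply: (ulim_eq0 UU (HP _)) => [i|m].
    rewrite wa mxE vi; under [X in ulim _ X]eq_fun do rewrite mxE.
    by apply: ulimM => //; exact: ulimC.
  have [_ _ [pm [hpm Mpm]] _] := Hex m; rewrite MS in Mpm.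
  exact: (Mpm P SP _ (homog_coordsZ a0 hpm)).
have cI : #|I| = n.+1 by have [m /= <-] := filter_ex UI; have [] := Hex m.
have : set0 p.
  rewrite -(DI I cI) => j /= jI; rewrite (Dl j p v pv Mp).
  have L : ulim U (fun m => linform (l j) (Iv m).2) (linform (l j) v).
    apply: ulim_big => [|i]; [exact: ulimD|rewrite vi; apply: ulimM => //; exact: ulimC].
  apply/eqP; rewrite -cmod_eq0 eq_le cmod_ge0 andbT; apply/ler_addgt0Pr => e e0.
  have e2 : 0 < e / 2 by rewrite divr_gt0.
  have V : U ([set m | (Iv m).1 = I] `&` ([set m | m.+1%:R^-1 <= e / 2] `&`
      [set m | cmod (linform (l j) (Iv m).2 - linform (l j) v) <= e / 2])).
    by apply: filterI => //; apply: filterI; [exact: ultra_inv|exact: L].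
  have [m [/= Im [me mL]]] := filter_ex V; have [_ _ _ /(_ j)] := Hex m.
  rewrite Im => /(_ jI) h; rewrite add0r (splitr e).
  rewrite -(subrK (linform (l j) (Iv m).2) (linform (l j) v)) (le_trans (cmodD _ _))//.
  by rewrite lerD// ?(le_trans h)// cmodBC.
by [].
Qed.

End ProjectiveCompactness.

(** * The mass of a disc *)

Lemma continuous_bigsum (R : realType) (T : topologicalType) (I : Type) (r : seq I)
    (h : I -> T -> R) :
  (forall i, continuous (h i)) -> continuous (fun t => \sum_(i <- r) h i t).
Proof.
move=> hc; elim: r => [|i r IH].
  by rewrite (_ : (fun t => _) = cst 0); [move=> t; exact: cvg_cst|apply/funext => t; rewrite big_nil].
rewrite (_ : (fun t => _) = h i \+ (fun t => \sum_(j <- r) h j t)).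
  by move=> t; exact: (cvgD (hc i t) (IH t)).
by apply/funext => t; rewrite big_cons.
Qed.

Section DiscMass.
Variables (R : realType) (N : nat).
Local Notation C := R[i].
Variable F : C -> 'rV[C]_N.+1.
Hypothesis Fd : forall i z, diffable (fun w => F w 0 i) z.
Hypothesis F0 : forall z, F z != 0.

Lemma log_normE (p : R * R) : log_norm F p = ln (vnorm (F (p.1 +i* p.2))).
Proof.
have v0 := vnorm_gt0 (F0 (p.1 +i* p.2)).
have -> : log_norm F p = 2^-1 * ln (vnorm (F (p.1 +i* p.2)) ^+ 2).
  by rewrite sqr_sqrtr ?sumsq_ge0//; congr (_ * ln _); apply: eq_bigr => j _; rewrite cmod_sqr.
by rewrite lnXn// -[X in _ * X]mulr_natl mulrA mulVf ?mul1r ?pnatr_eq0.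
Qed.

Lemma continuous_log_norm : continuous (log_norm F).
Proof.
have c2 j : continuous (fun p : R * R =>
    Re (F (p.1 +i* p.2) 0 j) ^+ 2 + Im (F (p.1 +i* p.2) 0 j) ^+ 2).
  have [c1 c2] := ccont_plane (fun z => diffable_ccont (Fd j z)).
  move=> p; under eq_fun do rewrite !expr2.
  exact: (cvgD (cvgM (c1 p) (c1 p)) (cvgM (c2 p) (c2 p))).
move=> p; apply: cvgM; first exact: cvg_cst.
apply: (@continuous_comp _ _ _
  (fun p : R * R => \sum_j (Re (F (p.1 +i* p.2) 0 j) ^+ 2 + Im (F (p.1 +i* p.2) 0 j) ^+ 2)) (@ln R)).
  exact: (continuous_bigsum c2).
apply: continuous_ln.
have v0 := vnorm_gt0 (F0 (p.1 +i* p.2)).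
rewrite (_ : \sum_j _ = vnorm (F (p.1 +i* p.2)) ^+ 2) ?exprn_gt0//.
by rewrite sqr_sqrtr ?sumsq_ge0//; apply: eq_bigr => j _; rewrite cmod_sqr.
Qed.

Lemma diffable_linform (l : 'I_N.+1 -> C) z : diffable (fun w => linform l (F w)) z.
Proof.
rewrite /linform; elim: (index_enum _) => [|i r IH].
  by under eq_fun do rewrite big_nil; exact: diffableC.
under eq_fun do rewrite big_cons.
by apply: diffableD => //; apply: diffableM; [exact: diffableC|exact: Fd].
Qed.

(** [K] precedes [z0] and [rho]: every estimate is made on the unit disc after the substitution $z =
    z_0 + \rho w$. *)
Lemma disc_mass (mu : {measure set (R * R)%type -> \bar R}) (n q : nat)
    (l : 'I_q -> 'I_N.+1 -> C) (c : R) :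
  riesz_measure (log_norm F) mu -> (2 * n < q)%N -> 0 < c ->
  (forall (I : {set 'I_q}) z, (n < #|I|)%N ->
    exists2 j, j \in I & c * vnorm (F z) <= cmod (linform (l j) (F z))) ->
  exists K : R, forall (z0 : C) (rho : R), 0 < rho ->
    (forall j z, cmod (z - z0) <= rho -> linform (l j) (F z) != 0) ->
    (mu (square (Re z0) (Im z0) (rho / 256)) <= K%:E)%E.
Proof.
move=> Hmu nq c0 Hc.
have [K0 [K00 HK]] := riesz_local R.
pose C1 : R := 1 + \sum_j \sum_i cmod (l j i).
have S0 : 0 <= \sum_j \sum_i cmod (l j i).
  by apply: sumr_ge0 => j _; apply: sumr_ge0 => i _; exact: cmod_ge0.
have C10 : 0 < C1 by rewrite ltr_pwDl.
have C1l j z : cmod (linform (l j) (F z)) <= C1 * vnorm (F z).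
  rewrite (le_trans (linform_le _ _))// ler_wpM2r ?vnorm_ge0// /C1 (bigD1 j)//= addrCA lerDl.
  by rewrite addr_ge0// sumr_ge0// => k _; apply: sumr_ge0 => i _; exact: cmod_ge0.
(* Every $\log|g_j|$ is at most $\ln C_1 + U$, and all but at most $n$ are at least $\ln c + U$; the
   latter indices are within this gap of the minimum of [G]. *)
pose C0 := `|ln C1 - ln c|.
have [A HA] := @uniform_near_minimizer R n q C0 nq (normr_ge0 _).
pose B := `|A| + `|ln c| + `|ln C1|.
have B0 : 0 <= B by rewrite !addr_ge0.
exists (K0 * (B + 1)) => z0 rho rho0 nz.
have rhoC : rho%:C != 0 :> C by rewrite -cmod_gt0 cmodR gtr0_norm.
pose G j w := - logmod (linform (l j) (F (z0 + rho%:C * w))).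
pose U w := ln (vnorm (F (z0 + rho%:C * w))).
have gt w j : cmod w <= 1 -> 0 < cmod (linform (l j) (F (z0 + rho%:C * w))).
  move=> w1; rewrite cmod_gt0 nz// addrAC subrr add0r cmodM cmodR gtr0_norm//.
  by rewrite -[leRHS]mulr1 ler_wpM2l// ltW.
have vt w : 0 < vnorm (F w) by exact: vnorm_gt0.
have up w j : cmod w <= 1 -> - G j w <= ln C1 + U w.
  move=> w1; rewrite opprK logmodE /U -lnM ?posrE //.
  by rewrite ler_ln ?posrE ?mulr_gt0 ?gt ?vt.
have lo w (I : {set 'I_q}) : cmod w <= 1 -> (n < #|I|)%N -> exists2 j, j \in I & ln c + U w <= - G j w.
  move=> w1 nI; have [j jI Hj] := Hc I (z0 + rho%:C * w) nI; exists j => //.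
  rewrite opprK logmodE /U -lnM ?posrE //.
  by rewrite ler_ln ?posrE ?mulr_gt0 ?gt ?vt.
have Gexp j b (s : R) : 0 < s -> cmod b + 2 * s <= 1 -> exists c, hexp (G j) b s c.
  move=> s0 bs.
  have [|z|w wr|e He] := @log_expansion R (fun z => linform (l j) (F z)) (z0 + rho%:C * b) (rho * s).
  - by rewrite mulr_gt0.
  - exact: diffable_linform.
  - apply: nz; rewrite (_ : _ - z0 = rho%:C * b + w); last by ring.
    rewrite (le_trans (cmodD _ _))// cmodM cmodR gtr0_norm//.
    apply: (@le_trans _ _ (rho * (cmod b + 2 * s))); first by rewrite mulrDr lerD2l mulrCA.
    by rewrite -[leRHS]mulr1 ler_wpM2l// ltW.
  exists (fun n => (-1)%:C * e n + 0%:C * e n + (if n is 0%N then 0%:C else 0)).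
  have := uexp_lin (-1) 0 0 He He; congr uexp; apply/funext => w.
  rewrite mulN1r mul0r !addr0; congr (- logmod (linform _ (F _))).
  by rewrite mulrDr addrA rmorphM /= mulrA.
have nm w : cmod w <= 1 -> (#|~: near_min G C0 w| <= n)%N.
  move=> w1; rewrite leqNgt; apply/negP => /(lo w _ w1)[j]; rewrite inE => /negP jn h.
  apply: jn; apply/near_minP => i; have := up w i w1; have := ler_norm (ln C1 - ln c).
  rewrite -/C0; lra.
have [j Hj] := HA G Gexp nm.
have GU w : cmod w <= 32^-1 -> `|U w + G j w| <= B.
  move=> w32; have w1 : cmod w <= 1 by rewrite (le_trans w32)// invf_le1 ?ler1n.
  have [|i _ hi] := lo w finset.setT w1; first by rewrite cardsT card_ord; lia.
  have h1 := up w j w1; have h2 : G j w - G i w <= A by apply: Hj; rewrite subr0.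
  have a1 := ler_norm A; have a2 := ler_norm (- ln c); have a3 := ler_norm (ln C1).
  have b1 := normr_ge0 A; have b2 := normr_ge0 (ln c); have b3 := normr_ge0 (ln C1).
  rewrite normrN in a2; rewrite ler_norml /B; apply/andP; split; lra.
have [|| e He] := Gexp j 0 2^-1; first by rewrite invr_gt0.
  by rewrite cmod0 add0r divff// pnatr_eq0.
have [|m Hm] := He 2^-1 _ 1 ltr01.
  by rewrite invr_ge0 ler0n/= invf_lt1// ltr1n.
(* The expansion of [G j] on the disc of radius $1/2$ has variable $2w$ and is truncated with error
   at most 1, whence $B + 1$; the sign is that of $G_j = -\log|g_j|$. The square of half-side
   $\rho/128$ corresponds to points with $|w| \le 1/64$. *)
pose P : {poly C} := - ((\poly_(k < m) e k) \Po ((2%:C / rho%:C) *: ('X - z0%:P))).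
have := HK (log_norm F) mu (Re z0) (Im z0) (rho / 128) (B + 1) P Hmu continuous_log_norm.
rewrite (_ : rho / 128 / 2 = rho / 256); last by rewrite -mulrA -invfM -natrM.
apply; [by rewrite divr_gt0|by rewrite addr_ge0|move=> p /squareP[px py]].
pose z := p.1 +i* p.2; pose w := (z - z0) / rho%:C.
have zw : z = z0 + rho%:C * w by rewrite /w mulrCA mulfV// mulr1 addrC subrK.
have w64 : cmod w <= 64^-1.
  rewrite cmodM cmodV cmodR gtr0_norm// ler_pdivrMr//.
  rewrite (le_trans (cmod_le_ReIm _))// cReB cImB/= (le_trans (lerD px py))//.
  lra.
have w32 : cmod w <= 32^-1 by rewrite (le_trans w64)// lef_pV2 ?posrE// ler_nat.
have := GU w w32; have := Hm m (2%:C * w) (leqnn m).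
rewrite cmodM cmodR ger0_norm// => /(_ _)/wrap[|h2 h1]; first lra.
rewrite log_normE -/z zw -/(U w) /reP -/z zw hornerN cReN horner_comp.
have -> : ((2%:C / rho%:C) *: ('X - z0%:P)).[z0 + rho%:C * w] = 2%:C * w.
  by rewrite hornerZ hornerXsubC [z0 + _]addrC addrK mulrA divfK.
rewrite horner_poly opprK; set Q := Re _ in h2 *.
have w2 : 0 + (2^-1)%:C * (2%:C * w) = w.
  by rewrite add0r mulrA -rmorphM/= mulVf ?pnatr_eq0// rmorph1 mul1r.
rewrite w2 in h2; have -> : U w + Q = (U w + G j w) - (G j w - Q) by ring.
by rewrite (le_trans (ler_normB _ _))// lerD.
Qed.

End DiscMass.

(** * Sectors *)

Section Sectors.
Variable R : realType.
Local Notation C := R[i].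

Lemma polar_form (z : C) : z != 0 -> exists r t : R,
  [/\ 0 < r, 0 <= t < 2 * pi & z = (r * cos t) +i* (r * sin t)].
Proof.
move=> z0; have r0 : 0 < cmod z by rewrite cmod_gt0.
have r1 : cmod z != 0 by rewrite gt_eqF.
pose x := Re z / cmod z; pose y := Im z / cmod z.
have zE : z = (cmod z * x) +i* (cmod z * y) by rewrite /x /y !(mulrC (cmod z)) !divfK//; case: z {z0 r0 r1 x y}.
have xy : x ^+ 2 + y ^+ 2 = 1.
  by rewrite /x /y !expr_div_n -mulrDl -cmod_sqr divff// expf_neq0.
have x1 : -1 <= x <= 1 by have := sqr_ge0 y; nra.
have sx : Num.sqrt (1 - x ^+ 2) = `|y| by rewrite -xy addrAC subrr add0r sqrtr_sqr.
have pi0 := pi_gt0 R; have := acos_ge0 x1; have := acos_lepi x1 => ap a0.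
have [y0|y0] := leP 0 y.
  exists (cmod z), (acos x); split => //; first by apply/andP; split => //; lra.
  by rewrite acosK ?in_itv// sin_acos// sx ger0_norm.
(* As $y \ne 0$, the angle $2\pi - \arccos x$ is strictly below $2\pi$. *)
have a1 : acos x != 0.
  apply/eqP => h; have := acosK x1; rewrite h cos0 => h1.
  have : 0 < y ^+ 2 by rewrite exprn_even_gt0//= lt_eqF.
  move: xy; rewrite -h1; lra.
exists (cmod z), (2 * pi - acos x); split => //.
  by have : 0 < acos x; [rewrite lt_def a1|move=> ?; apply/andP; split; lra].
rewrite mulr_natl (addrC _ (- _)) cosD2pi sinD2pi cosN sinN acosK// sin_acos// sx.
by rewrite ltr0_norm// opprK.
Qed.

Lemma angle_scale theta eps (a : R) (z : C) : 0 < a -> angle theta eps z -> angle theta eps (a%:C * z).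
Proof.
move=> a0 [r [t [r0 te ->]]]; exists (a * r), t; split => //; first exact: mulr_gt0.
by apply/eqP; rewrite eq_complex/=; apply/andP; split; apply/eqP; ring.
Qed.

(** Rotation by $-\theta$ moves [z] to a point [w] near $r > 0$, whose argument is
    $\arctan(\mathrm{Im}\,w/\mathrm{Re}\,w)$. *)
Lemma angle_nbhs theta (eps r : R) : 0 < r -> 0 < eps -> exists2 d : R, 0 < d &
  forall z, cmod (z - ((r * cos theta) +i* (r * sin theta))) <= d -> angle theta eps z.
Proof.
move=> r0 e0.
have [eta eta0 He] : exists2 eta : R, 0 < eta & forall x : R, `|x| < eta -> `|atan x| < eps.
  have /cvgrPdist_lt/(_ eps e0) := @continuous_atan R 0.
  move=> /nbhs_ballP[eta /= eta0 He]; exists eta => // x xe.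
  have /= := He x; rewrite /ball /= atan0 !sub0r !normrN; exact.
(* The first bound keeps $\mathrm{Re}\,w \ge r/2$; the second then makes the quotient at most
   $\eta/2$. *)
pose d := Num.min (r / 2) (eta * r / 4).
have d0 : 0 < d by rewrite lt_min !divr_gt0// mulr_gt0.
have d1 : d <= r / 2 by rewrite ge_min lexx.
have d2 : d <= eta * r / 4 by rewrite ge_min lexx orbT.
exists d => // z; set z1 := _ +i* _ => zd.
pose e : C := cos theta +i* (- sin theta).
have e1 : cmod e = 1 by rewrite /cmod /= sqrrN cos2Dsin2 sqrtr1.
pose w := z * e.
have wr : cmod (w - r%:C) <= d.
  have -> : r%:C = z1 * e.
    apply/eqP; rewrite eq_complex/=; apply/andP; split; apply/eqP; last by ring.
    by rewrite -[LHS]mulr1 -(cos2Dsin2 theta); ring.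
  by rewrite -mulrBl cmodM e1 mulr1.
have ra : `|Re w - r| <= d by rewrite (le_trans _ wr)// -[r in X in X <= _]/(Re r%:C) -cReB Re_le_cmod.
have ib : `|Im w| <= d by rewrite (le_trans _ wr)// -[Im w]subr0 -[X in _ - X]/(Im r%:C) -cImB Im_le_cmod.
have a0 : r / 2 <= Re w by move: ra; rewrite ler_distl; lra.
have a1 : 0 < Re w by apply: lt_le_trans a0; rewrite divr_gt0.
have az : Re w != 0 by rewrite gt_eqF.
pose x := Im w / Re w.
have xe : `|x| < eta.
  rewrite normrM normfV (gtr0_norm a1) ltr_pdivrMr//; nra.
pose s := Num.sqrt (1 + x ^+ 2).
have s0 : 0 < s by rewrite sqrtr_gt0 ltr_pwDl// sqr_ge0.
have sz : s != 0 by rewrite gt_eqF.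
exists (Re w * s), (theta + atan x); split.
- exact: mulr_gt0.
- by rewrite addrAC subrr add0r He.
have ct : Re w * s * cos (atan x) = Re w by rewrite cos_atan mulfK.
have st : Re w * s * sin (atan x) = Im w.
  have : sin (atan x) = x * cos (atan x).
    have := congr1 (fun y => y * cos (atan x)) (atanK x); rewrite /tan divfK//.
    by rewrite cos_atan invr_neq0.
  by move=> ->; rewrite mulrCA ct /x divfK.
have zw : z = w * ((cos theta) +i* (sin theta)).
  rewrite /w -mulrA (_ : e * _ = 1) ?mulr1//.
  apply/eqP; rewrite eq_complex/=; apply/andP; split; apply/eqP; last by ring.
  by rewrite -(cos2Dsin2 theta); ring.
clearbody w; rewrite zw cosD sinD.
apply/eqP; rewrite eq_complex cReM cImM/=; apply/andP; split; apply/eqP; rewrite -[in LHS]ct -[in LHS]st; ring.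
Qed.

End Sectors.

(** * Curves without Julia directions *)

(** The near-covering form of compactness is applied to the filter [G] of properties that hold for
    all lists containing some fixed finite list of points of [A]. *)
Lemma compact_ball_cover (R : realType) (T : pseudoMetricType R) (A : set T) (r : T -> R) :
  compact A -> (forall x, A x -> 0 < r x) ->
  exists2 s : seq T, (forall x, x \in s -> A x) &
    forall y, A y -> exists2 x, x \in s & ball x (r x) y.
Proof.
move=> /compact_near_coveringP cA r0.
pose G : set_system (seq T) := [set S | exists2 s0 : seq T, (forall x, x \in s0 -> A x) &
  forall s : seq T, {subset s0 <= s} -> S s].
have GF : Filter G.
  split.
  - by exists [::].
  - move=> P Q [s1 A1 H1] [s2 A2 H2]; exists (s1 ++ s2).
      by move=> x; rewrite mem_cat => /orP[/A1|/A2].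
    by move=> s ss; split; [apply: H1|apply: H2] => x xs; apply: ss; rewrite mem_cat xs ?orbT.
  - by move=> P Q PQ [s0 A0 H0]; exists s0 => // s /H0 /PQ.
have [|s0 A0 H0] := cA _ G (fun s y => exists2 x, x \in s & ball x (r x) y) GF.
  move=> x Ax; exists (ball x (r x), [set s : seq T | x \in s]) => /=.
    split; first by apply: nbhsx_ballx; exact: r0.
    exists [:: x] => [y|s ss]; first by rewrite inE => /eqP ->.
    by apply: ss; rewrite mem_head.
  by move=> [y s] /= [xy xs]; exists x.
by exists s0 => //; exact: H0.
Qed.

Lemma finite_set_cmod_bound (R : realType) (A : set R[i]) : finite_set A ->
  exists B : R, 0 <= B /\ forall z, A z -> cmod z <= B.
Proof.
move=> /finite_seqP[s ->]; exists (\sum_(z <- s) cmod z); split.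
  by apply: sumr_ge0 => z _; exact: cmod_ge0.
move=> z /= zs; rewrite (big_rem z)//= lerDl; apply: sumr_ge0 => w _; exact: cmod_ge0.
Qed.

Lemma card_subset_exists (T : finType) (A : {set T}) n : (n <= #|A|)%N ->
  exists2 B : {set T}, B \subset A & #|B| = n.
Proof.
move=> nA; exists [set x in take n (enum A)].
  by apply/fintype.subsetP => x; rewrite inE => /mem_take; rewrite mem_enum.
rewrite cardsE; have /card_uniqP -> := take_uniq n (enum_uniq A).
by rewrite size_take -cardE; case: ltnP nA => // ? ?; apply/eqP; rewrite eqn_leq; apply/andP.
Qed.

Section JuliaFinal.
Variables (R : realType) (N : nat).
Local Notation C := R[i].
Variables (M : set (projspace R N)) (f : C -> projspace R N) (F : C -> 'rV[C]_N.+1).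
Hypothesis PM : projective_variety M.
Hypothesis Mf : forall z, M (f z).
Hypothesis rep : homogeneous_representation f F.

(** In a violating system, the set [J] of divisors with finitely many preimages in the angle has
    more than $2n$ elements. The intersection condition passes to this subfamily, and all these
    preimages lie in a disc $|z| \le B$. *)
Lemma not_julia_forms (theta : R) : 0 <= theta < 2 * pi -> ~ julia_direction M f theta ->
  exists n q (l : 'I_q -> 'I_N.+1 -> C) (eps c B : R),
  [/\ (2 * n < q)%N, 0 < eps, 0 < c,
    forall (I : {set 'I_q}) z, (n < #|I|)%N ->
      exists2 j, j \in I & c * vnorm (F z) <= cmod (linform (l j) (F z)) &
    forall j z, angle theta eps z -> B < cmod z -> linform (l j) (F z) != 0].
Proof.
move=> th nj; have [_ Fz] := rep.
have /existsNP[n /existsNP[q /existsNP[D /not_implyP[Ddiv /not_implyP[DI /existsNP[eps /not_implyP[eps0 NE]]]]]]] :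
  ~ forall (n q : nat) (D : 'I_q -> set (projspace R N)),
    (forall j, divisor_on M (D j)) ->
    (forall I : {set 'I_q}, #|I| = n.+1 -> \bigcap_(j in [set j | j \in I]) D j = set0) ->
    forall eps : R, 0 < eps -> exists E : {set 'I_q}, (#|E| <= 2 * n)%N /\
        forall j, j \notin E -> infinite_set [set z | angle theta eps z /\ D j (f z)].
  by move=> h; apply: nj; split.
pose X j := [set z | angle theta eps z /\ D j (f z)].
pose J : {set 'I_q} := [set j | `[< finite_set (X j) >]]%SET.
have Jn : (2 * n < #|J|)%N.
  rewrite ltnNge; apply/negP => Jle; apply: NE; exists J; split=> // j.
  by rewrite inE => /asboolPn.
have bnd (j : 'I_#|J|) : exists B : R, 0 <= B /\ forall z, X (enum_val j) z -> cmod z <= B.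
  by apply: finite_set_cmod_bound; have := enum_valP j; rewrite inE => /asboolP.
have [b Hb] := choice bnd.
have lin j : exists l, forall p v, homog_coords p v -> M p -> (D j p <-> linform l v = 0).
  have [H [/hyperplane_linform[l Hl] ->]] := Ddiv j.
  by exists l => p v pv Mp; rewrite -(Hl p v pv); split => [[]|].
have [l Hl] := choice lin.
have DJ (I : {set 'I_#|J|}) : #|I| = n.+1 ->
    \bigcap_(j in [set j | j \in I]) D (enum_val j) = set0.
  move=> cI; apply/seteqP; split => // p Hp.
  have : \bigcap_(j in [set j | j \in [set enum_val i | i in I]%SET]) D j = set0.
    by apply: DI; rewrite card_imset//; exact: enum_val_inj.
  by move=> <- j /= /imsetP[i iI ->]; exact: Hp.
have [c c0 Hc] := cone_lower_bound PM (fun j => Hl (enum_val j)) DJ.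
exists n, #|J|, (fun j => l (enum_val j)), eps, c, (\sum_j b j); split => //.
  move=> I z /card_subset_exists[I' /fintype.subsetP sI cI'].
  have [j jI h] := Hc I' (f z) (F z) cI' (Fz z) (Mf z).
  by exists j => //; exact: sI.
move=> j z az Bz; apply/eqP => /(Hl _ _ _ (Fz z) (Mf z)) Dz.
have [_ /(_ z (conj az Dz))] := Hb j; rewrite leNgt => /negP; apply.
apply: le_lt_trans Bz; rewrite (bigD1 j)//= lerDl; apply: sumr_ge0 => i _.
by have [] := Hb i.
Qed.

Variable mu : {measure set (R * R)%type -> \bar R}.
Hypothesis Hmu : riesz_measure (log_norm F) mu.

(** Angles are invariant under scaling by $2^k$, so one disc around [z1] inside the angle provides
    zero-free discs at all large scales, and the bound of [disc_mass] is the same for all of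
    them. *)
Lemma local_mass (z1 : C) : 1 <= cmod z1 -> (forall theta, ~ julia_direction M f theta) ->
  exists s K : R, exists k0 : nat, 0 < s /\ forall k, (k0 <= k)%N ->
    (mu (square (2 ^+ k * Re z1) (2 ^+ k * Im z1) (2 ^+ k * s)) <= K%:E)%E.
Proof.
move=> z1n nj; have [Fe Fz] := rep.
have z10 : z1 != 0 by rewrite -cmod_gt0 (lt_le_trans _ z1n).
have [r [t [r0 t2 z1E]]] := polar_form z10.
have [n [q [l [eps [c [B [nq eps0 c0 Hc Hl]]]]]]] := not_julia_forms t2 (nj t).
have [d d0 Hd] := angle_nbhs t r0 eps0.
have Fd i z : diffable (fun w => F w 0 i) z by exact: complex_derivable_cderiv (Fe i z).
have F0 z : F z != 0 by case: (Fz z).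
have [K HK] := disc_mass Fd F0 Hmu nq c0 Hc.
(* With $\rho \le 1/2$ and $|z_1| \ge 1$, points of the scaled disc have modulus at least $2^k/2$,
   which exceeds [B] once $2B < 2^k$. *)
pose rho := Num.min d 2^-1.
have rho0 : 0 < rho by rewrite lt_min d0 invr_gt0/=.
have rho1 : rho <= d by rewrite ge_min lexx.
have rho2 : rho <= 2^-1 by rewrite ge_min lexx orbT.
pose k0 := Num.bound `|2 * B|.
exists (rho / 256), K, k0; split; first by rewrite divr_gt0.
move=> k kk0; have p0 : 0 < 2 ^+ k :> R by rewrite exprn_gt0.
have pB : 2 * B < 2 ^+ k.
  apply: (le_lt_trans (ler_norm _)); apply: (lt_trans (archi_boundP (normr_ge0 _))).
  by rewrite -natrX ltr_nat (leq_ltn_trans kk0)// ltn_expl.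
have := HK ((2 ^+ k)%:C * z1) (2 ^+ k * rho); rewrite cReZ cImZ mulrA; apply.
  exact: mulr_gt0.
move=> j z zz.
have pz : (2 ^+ k)%:C != 0 :> C by rewrite -cmod_gt0 cmodR gtr0_norm.
pose w := z / (2 ^+ k)%:C.
have zw : z = (2 ^+ k)%:C * w by rewrite /w mulrCA mulfV// mulr1.
have wz : cmod (w - z1) <= rho.
  by move: zz; rewrite zw -mulrBr cmodM cmodR gtr0_norm// ler_pM2l.
apply: Hl.
  by rewrite zw; apply: angle_scale => //; apply: Hd; rewrite -z1E (le_trans wz).
rewrite zw cmodM cmodR gtr0_norm//.
have : 2^-1 <= cmod w by have := cmod_dist z1 w; rewrite cmodBC; lra.
by move=> h; nra.
Qed.

Lemma measure_seq_cover (I : eqType) (s : seq I) (Q : I -> set (R * R)) (A : set (R * R))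
    (K : I -> R) :
  measurable A -> (forall i, measurable (Q i)) ->
  (forall i, i \in s -> (mu (Q i) <= (K i)%:E)%E) ->
  (forall p, A p -> exists2 i, i \in s & Q i p) -> (mu A <= (\sum_(i <- s) K i)%:E)%E.
Proof.
move=> mA mQ; elim: s A mA => [|i s IH] A mA muQ AQ.
  rewrite big_nil (_ : A = set0) ?measure0//.
  by apply/seteqP; split => // p /AQ[].
rewrite big_cons EFinD -(setUIDK A (Q i)).
have mAI : measurable (A `&` Q i) by exact: measurableI.
have mAD : measurable (A `\` Q i) by exact: measurableD.
rewrite (le_trans (measureU2 mu mAI mAD))// leeD//.
  by rewrite (le_trans _ (muQ i (mem_head _ _)))// le_measure ?inE.
apply: IH => // [j js|p [/AQ[j]]]; first by apply: muQ; rewrite inE js orbT.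
by rewrite inE => /orP[/eqP ->|js] Qj nQ; [|exists j].
Qed.

Lemma continuous_modulus : continuous (fun p : R * R => Num.sqrt (p.1 ^+ 2 + p.2 ^+ 2)).
Proof.
have h : continuous (fun p : R * R => p.1 * p.1 + p.2 * p.2).
  by move=> p; exact: (cvgD (cvgM cvg_fst cvg_fst) (cvgM cvg_snd cvg_snd)).
move=> p; apply: (@continuous_comp _ _ _ (fun p : R * R => p.1 ^+ 2 + p.2 ^+ 2)).
  exact: h.
exact: sqrt_continuous.
Qed.

Lemma closed_annulus (a b : R) : closed (annulus a b).
Proof.
have -> : annulus a b = (fun p : R * R => Num.sqrt (p.1 ^+ 2 + p.2 ^+ 2)) @^-1` `[a, b].
  by apply/seteqP; split => p /=; rewrite in_itv.
by apply: closed_comp => [p _|]; [exact: continuous_modulus|exact: itv_closed].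
Qed.

Lemma compact_annulus (a b : R) : compact (annulus a b).
Proof.
apply: (subclosed_compact (@closed_annulus a b) (@compact_square R 0 0 b)) => p /andP[_ pb].
apply/squareP; rewrite !subr0; split; apply: le_trans pb.
  exact: (Re_le_cmod (p.1 +i* p.2)).
exact: (Im_le_cmod (p.1 +i* p.2)).
Qed.

(** Balls of the product metric are open squares, so compactness covers the annulus $1 \le |w| \le
    2$ by finitely many squares from [local_mass]; multiplication by $2^k$ carries this cover to the
    other annuli. *)
Lemma annulus_mass_bounded : (forall theta, ~ julia_direction M f theta) ->
  exists (K : R) (k0 : nat), forall k, (k0 <= k)%N ->
    (mu (annulus (2 ^+ k) (2 ^+ k.+1)) <= K%:E)%E.
Proof.
move=> nj.
have H (p : R * R) : exists a : R * R * nat, annulus 1 2 p -> 0 < a.1.1 /\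
    forall k, (a.2 <= k)%N ->
    (mu (square (2 ^+ k * p.1) (2 ^+ k * p.2) (2 ^+ k * a.1.1)) <= a.1.2%:E)%E.
  have [/andP[p1 _]|np] := pselect (annulus 1 2 p); last by exists (0, 0, 0%N).
  have [s [K [k0 [s0 h]]]] := local_mass (z1 := p.1 +i* p.2) p1 nj.
  by exists (s, K, k0) => _; split.
have [a Ha] := choice H.
have [p Ap|D' DA HD] := @compact_ball_cover R (R * R)%type (annulus 1 2) (fun p => (a p).1.1)
    (@compact_annulus 1 2).
  by have [] := Ha p Ap.
(* The sum of the thresholds dominates each of them. *)
exists (\sum_(p <- D') (a p).1.2), (\sum_(p <- D') (a p).2)%N => k kk0.
have p0 : 0 < 2 ^+ k :> R by rewrite exprn_gt0.
have pz : (2 ^+ k != 0 :> R) by rewrite gt_eqF.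
apply: (@measure_seq_cover _ D' (fun p => square (2 ^+ k * p.1) (2 ^+ k * p.2) (2 ^+ k * (a p).1.1))).
- rewrite -[annulus _ _]setCK; apply: measurableC; apply: open_measurable_plane.
  by rewrite openC; exact: closed_annulus.
- by move=> p; exact: measurable_square.
- move=> p pD; have [_] := Ha p (DA p pD); apply.
  by apply: leq_trans kk0; rewrite (big_rem p)//= leq_addr.
move=> z Az; pose w := ((2 ^+ k)^-1 * z.1, (2 ^+ k)^-1 * z.2).
have zE1 : z.1 = 2 ^+ k * w.1 by rewrite /w/= mulrA mulfV// mul1r.
have zE2 : z.2 = 2 ^+ k * w.2 by rewrite /w/= mulrA mulfV// mul1r.
clearbody w; have Aw : annulus 1 2 w.
  move: Az; rewrite /annulus /= zE1 zE2 !exprMn -mulrDr sqrtrM ?sqr_ge0// sqrtr_sqr gtr0_norm//.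
  by rewrite [2 ^+ k.+1]exprSr -[X in X <= _ * _]mulr1 !ler_pM2l.
have [p pD [/= b1 b2]] := HD w Aw; exists p => //.
apply/squareP; rewrite zE1 zE2 -!mulrBr !normrM (gtr0_norm p0) !ler_pM2l//.
by split; rewrite distrC ltW.
Qed.

End JuliaFinal.

Theorem theorem2 (R : realType) (N : nat) (M : set (projspace R N))
    (f : R[i] -> projspace R N)
    (mu : {measure set (R * R)%type -> \bar R}) :
  projective_variety M ->
  holomorphic_curve M f ->
  riesz_measure_of_curve f mu ->
  limn_esup (fun k : nat => mu (annulus (2 ^+ k) (2 ^+ k.+1))) = +oo%E ->
  exists theta : R, julia_direction M f theta.
Proof.
move=> PM [_ Mf] [F [rep Hmu]] sup; apply: contrapT => nj.
have [K [k0 HK]] := annulus_mass_bounded PM Mf rep Hmu (fun t jt => nj (ex_intro _ t jt)).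
have : (limn_esup (fun k => mu (annulus (2 ^+ k) (2 ^+ k.+1))) <= K%:E)%E.
  rewrite limn_esup_lim; apply: lime_le; first exact: is_cvg_esups.
  exists k0 => // m /= km; apply: ub_ereal_sup => _ [j /= mj <-].
  by apply: HK; exact: leq_trans mj.
by rewrite sup leye_eq.
Qed.
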